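(* Let $(X,d,\mu)$ be a doubling metric measure space and let $L$ be a non-negative self-adjoint operator on $L^2(X)$ satisfying the Davies-Gaffney estimate. Let $0<p\le 1$ and let $m\in\mathbb{N}$ with $m>\frac{n(2-p)}{4p}$. Let $T$ be a (linear or nonnegative sublinear) operator which is bounded on $L^2(X)$, and assume that there is a constant $C>0$ such that $$\Big(\int_{S_j(B)}|Ta|^2\,d\mu\Big)^{1/2}\le C\,2^{-2jm}\,V(B)^{\frac12-\frac1p}$$ for every $(p,2,m)$-atom $a$ associated to $L$ supported in the ball $B$ and all integers $j\ge 2$. Then: (i) $T$ is bounded from $H^p_L(X)$ to $L^p(X)$; (ii) if in addition $T$ is of weak type $(1,1)$ and $b$ is a BMO function on $X$, then the commutator $[b,T]$ maps $H^1_L(X)$ continuously into $L^{1,\infty}(X)$.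
   Context: Setting: $(X,d,\mu)$ is a metric space with a nonnegative Borel measure $\mu$. Put $B(x,r)=\{y: d(x,y)<r\}$, $V(x,r)=\mu(B(x,r))$, $V(B)=\mu(B)$. Doubling means: there is $C>0$ with $V(x,2r)\le C V(x,r)<\infty$ for all $x\in X$, $r>0$. Then there are constants $c,n>0$ with $V(x,\lambda r)\le c\lambda^n V(x,r)$ for all $\lambda\ge1$, $x\in X$, $r>0$; $n$ denotes this constant. For a ball $B=B(x_B,r_B)$ and $\lambda>0$ put $\lambda B=B(x_B,\lambda r_B)$, $S_0(B)=B$ and $S_j(B)=2^jB\setminus 2^{j-1}B$ for $j\ge1$. Davies-Gaffney estimate: $L$ generates an analytic semigroup $\{e^{-tL}\}_{t>0}$ and there exist $C,c>0$ such that for all open $U_1,U_2\subset X$, all $f_i\in L^2(X)$ with $\operatorname{supp} f_i\subset U_i$, and all $t>0$, $|\langle e^{-tL}f_1,f_2\rangle|\le C\exp\big(-\frac{\mathrm{dist}(U_1,U_2)^2}{ct}\big)\|f_1\|_{L^2(X)}\|f_2\|_{L^2(X)}$. Atoms: $a\in L^2(X)$ is a $(p,2,m)$-atom associated to $L$ if there are $b\in\mathcal{D}(L^m)$ and a ball $B$ such that $a=L^mb$; $\operatorname{supp}L^kb\subset B$ for $k=0,\dots,m$; and $\|(r_B^2L)^kb\|_{L^2(X)}\le r_B^{2m}V(B)^{\frac12-\frac1p}$ for $k=0,\dots,m$. If $\mu(X)<\infty$, the constant function $\mu(X)^{-1/p}$ is also considered an atom. Hardy space: for $0<p\le1$ and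 $m\in\mathbb N$, $m>\frac{n(2-p)}{4p}$, $\mathbb{H}^p_{L,at,m}(X)$ is the set of $f=\sum_j\lambda_ja_j$ with $(\lambda_j)\in\ell^p$, each $a_j$ a $(p,2,m)$-atom, the sum converging in $L^2(X)$, with $\|f\|=\inf(\sum_j|\lambda_j|^p)^{1/p}$, the infimum over all such representations. $H^p_L(X)$ is the completion of this space with respect to $\|\cdot\|$ (different admissible $m$ give the same space with equivalent norms). Boundedness on $H^p_L(X)$ means that the operator extends boundedly from this dense subspace. Commutator: $[b,T]f(x)=T\big((b(x)-b)f\big)(x)$ for functions $f$ with compact support. Nonnegative sublinear means $Tf\ge 0$, $T(f+g)\le Tf+Tg$ and $T(\lambda f)=|\lambda|Tf$. *)

(* Defs.v *)
From HB Require Import structures.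
From mathcomp Require Import all_boot all_order all_algebra.
From mathcomp Require Import complex.
From mathcomp Require Import all_classical all_reals all_analysis.

Set Implicit Arguments.
Unset Strict Implicit.
Unset Printing Implicit Defensive.

Import Order.TTheory GRing.Theory Num.Theory.
Import numFieldNormedType.Exports.
Local Open Scope classical_set_scope.
Local Open Scope ring_scope.
Local Open Scope complex_scope.

HB.mixin Record isBorelMetric (d : measure_display) (R : realType) X
    of Measurable d X & Metric R X := {
  borelE : @measurable d X = <<s (@open X) >>
}.

#[short(type="borelMetricType")]
HB.structure Definition BorelMetric (d : measure_display) (R : realType) :=
  { X of Measurable d X & Metric R X & isBorelMetric d R X }.

Section Spaces.
Context {d : measure_display} {R : realType} {X : borelMetricType d R}.
Variable mu : {measure set X -> \bar R}.

(* Scalars are complex.  Elements of the function spaces below are functions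
   X -> R[i]; equality between them is always meant mu-almost everywhere. *)
Implicit Types (f g h b : X -> R[i]).

Definition cabs (z : R[i]) : R := Normc.normc z.

Definition cmeasurable f : Prop :=
  measurable_fun setT (fun x => complex.Re (f x)) /\
  measurable_fun setT (fun x => complex.Im (f x)).

(* (\int |f|^p)^(1/p), for every real p > 0 (a quasi-norm when p < 1) *)
Definition cLnorm (p : R) f : \bar R :=
  Lnorm mu p%:E (fun x => (cabs (f x))%:E).

Definition cLp (p : R) : set (X -> R[i]) :=
  [set f | cmeasurable f /\ (cLnorm p f < +oo)%E].

Definition cL1_plus_L2 : set (X -> R[i]) :=
  [set f | exists f1 f2, [/\ cLp 1 f1, cLp 2 f2 & f = f1 \+ f2]].

Definition weakL1norm f : \bar R :=
  ereal_sup [set (t%:E * mu [set x | (t < cabs (f x))%R])%E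
            | t in [set t : R | 0 < t]].

Definition weakL1 : set (X -> R[i]) :=
  [set f | cmeasurable f /\ (weakL1norm f < +oo)%E].

Definition cintegral (D : set X) f : R[i] :=
  Rintegral mu D (fun x => complex.Re (f x)) +i*
  Rintegral mu D (fun x => complex.Im (f x)).

Definition inner f g : R[i] := cintegral setT (fun x => f x * (g x)^*).

Definition ae_equal f g : Prop := {ae mu, forall x, f x = g x}.

(* Support of the a.e. class of f: complement of the union of the open balls
   on which f = 0 a.e. *)
Definition esupp f : set X :=
  [set x | forall r : R, 0 < r -> (0 < mu (ball x r `&` [set y | f y != 0%R]))%E].

Definition bounded_support f : Prop :=
  exists x (r : R), esupp f `<=` ball x r.

Definition doubling : Prop :=
  exists2 C : R, 0 < C & forall (x : X) (r : R), 0 < r ->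
    (mu (ball x (2 * r)) <= C%:E * mu (ball x r))%E /\
    (mu (ball x r) < +oo)%E.

Definition doubling_exponent (n : R) : Prop :=
  exists2 c : R, 0 < c & forall (x : X) (r l : R), 0 < r -> 1 <= l ->
    (mu (ball x (l * r)) <= (c * l `^ n)%:E * mu (ball x r))%E.

Definition vol (x : X) (r : R) : R := fine (mu (ball x r)).

Definition annulus (x : X) (r : R) (j : nat) : set X :=
  if j is j'.+1 then ball x (2 ^+ j * r) `\` ball x (2 ^+ j' * r)
  else ball x r.

Definition linear_on (D : set (X -> R[i])) (T : (X -> R[i]) -> (X -> R[i])) :=
  forall (a : R[i]) f g, D f -> D g ->
    ae_equal (T ((a \*o f) \+ g)) ((a \*o T f) \+ T g).

(* In R[i], x <= y means that y - x is real and nonnegative. *)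
Definition nonneg_sublinear_on (D : set (X -> R[i]))
    (T : (X -> R[i]) -> (X -> R[i])) :=
  [/\ forall f, D f -> {ae mu, forall x, 0 <= T f x},
      forall f g, D f -> D g -> {ae mu, forall x, T (f \+ g) x <= T f x + T g x} &
      forall (a : R[i]) f, D f -> {ae mu, forall x, T (a \*o f) x = `|a| * T f x}].

Definition lin_or_sublin_on (D : set (X -> R[i]))
    (T : (X -> R[i]) -> (X -> R[i])) : Prop :=
  (forall f, D f -> cmeasurable (T f)) /\
  (linear_on D T \/ nonneg_sublinear_on D T).

Definition L2_bounded (T : (X -> R[i]) -> (X -> R[i])) : Prop :=
  exists2 C : R, 0 < C & forall f, cLp 2 f ->
    cLp 2 (T f) /\ (cLnorm 2 (T f) <= C%:E * cLnorm 2 f)%E.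

Definition weak_type11 (T : (X -> R[i]) -> (X -> R[i])) : Prop :=
  exists2 C : R, 0 < C & forall f, cLp 1 f ->
    (weakL1norm (T f) <= C%:E * cLnorm 1 f)%E.

Definition bounded_linear_L2 (S : (X -> R[i]) -> (X -> R[i])) : Prop :=
  linear_on (cLp 2) S /\ L2_bounded S.

Record unbounded_op := UnboundedOp {
  dom : set (X -> R[i]);
  app :> (X -> R[i]) -> (X -> R[i])
}.

Definition densely_defined_linear (L : unbounded_op) : Prop :=
  [/\ forall f, dom L f -> cLp 2 f /\ cLp 2 (L f),
      forall f g, dom L f -> cLp 2 g -> ae_equal f g ->
        dom L g /\ ae_equal (L f) (L g),
      forall (a : R[i]) f g, dom L f -> dom L g -> dom L ((a \*o f) \+ g),
      linear_on (dom L) L &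
      forall f (e : R), cLp 2 f -> 0 < e ->
        exists2 g, dom L g & (cLnorm 2 (f \- g)%R < e%:E)%E].

(* The right-hand side of the equivalence says that g is in the domain of the
   adjoint of L and that the adjoint maps g to h. *)
Definition selfadjoint (L : unbounded_op) : Prop :=
  densely_defined_linear L /\
  forall g h, cLp 2 g -> cLp 2 h ->
    (dom L g /\ ae_equal (L g) h) <->
    (forall f, dom L f -> inner (L f) g = inner f h).

Definition nonneg_op (L : unbounded_op) : Prop :=
  forall f, dom L f -> 0 <= inner (L f) f.

Fixpoint pow_dom (L : unbounded_op) (k : nat) : set (X -> R[i]) :=
  if k is k'.+1 then [set f | dom L f /\ pow_dom L k' (L f)] else cLp 2.

Definition sector (theta : R) : set R[i] :=
  [set z | exists rho phi : R, [/\ 0 < rho, `|phi| < theta &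
                                   z = (rho * cos phi) +i* (rho * sin phi)]].

Definition analytic_semigroup (theta : R)
    (S : R[i] -> (X -> R[i]) -> (X -> R[i])) : Prop :=
  let Sigma := sector theta `|` [set 0] in
  [/\ forall z, Sigma z -> bounded_linear_L2 (S z),
      forall f, cLp 2 f -> ae_equal (S 0 f) f,
      forall z w f, Sigma z -> Sigma w -> cLp 2 f ->
        ae_equal (S (z + w) f) (S z (S w f)),
      (* complex differentiability in operator norm on the open sector *)
      forall z, sector theta z ->
        exists2 A, bounded_linear_L2 A & forall e : R, 0 < e ->
        exists2 del : R, 0 < del & forall h : R[i], 0 < cabs h < del ->
          sector theta (z + h) -> forall f, cLp 2 f ->
          (cLnorm 2 ((h^-1 \*o (S (z + h) f \- S z f)) \- A f)%R
             <= e%:E * cLnorm 2 f)%E &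
      forall (theta' : R) f, 0 < theta' < theta -> cLp 2 f ->
        forall e : R, 0 < e -> exists2 del : R, 0 < del &
        forall z, sector theta' z -> cabs z < del ->
          (cLnorm 2 (S z f \- f)%R < e%:E)%E].

(* S t = e^{-tL}: the infinitesimal generator of S, with its exact domain,
   is -L. *)
Definition generates (L : unbounded_op)
    (S : R[i] -> (X -> R[i]) -> (X -> R[i])) : Prop :=
  forall f g, cLp 2 f -> cLp 2 g ->
    (dom L f /\ ae_equal (L f) g) <->
    ((fun t : R => cLnorm 2 ((t^-1%:C \*o (S t%:C f \- f)) \+ g)) @ 0^'+
       --> (0 : \bar R)%E).

Definition set_dist (U V : set X) : R :=
  inf [set r : R | exists x y, [/\ U x, V y & r = mdist x y]].

Definition davies_gaffney (L : unbounded_op) : Prop :=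
  exists (theta : R) (S : R[i] -> (X -> R[i]) -> (X -> R[i])),
    [/\ 0 < theta <= pi / 2, analytic_semigroup theta S, generates L S &
        exists C c : R, [/\ 0 < C, 0 < c &
          forall (U1 U2 : set X) f1 f2 (t : R), open U1 -> open U2 ->
            cLp 2 f1 -> cLp 2 f2 -> esupp f1 `<=` U1 -> esupp f2 `<=` U2 ->
            0 < t ->
            ((cabs (inner (S t%:C f1) f2))%:E <=
               (C * expR (- (set_dist U1 U2 ^+ 2 / (c * t))))%:E
               * cLnorm 2 f1 * cLnorm 2 f2)%E]].

Definition ball_atom (L : unbounded_op) (p : R) (m : nat)
    (a : X -> R[i]) (x : X) (r : R) : Prop :=
  cLp 2 a /\
  exists b, [/\ pow_dom L m b,
    ae_equal a (iter m L b),
    forall k, (k <= m)%N -> esupp (iter k L b) `<=` ball x r &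
    forall k, (k <= m)%N ->
      ((r ^+ (2 * k))%:E * cLnorm 2 (iter k L b) <=
         (r ^+ (2 * m) * vol x r `^ (2^-1 - p^-1))%:E)%E].

Definition atom (L : unbounded_op) (p : R) (m : nat) (a : X -> R[i]) : Prop :=
  (exists x r, 0 < r /\ ball_atom L p m a x r) \/
  [/\ (mu setT < +oo)%E, cLp 2 a &
      ae_equal a (cst ((fine (mu setT) `^ (- p^-1))%:C))].

Definition atomic_rep (L : unbounded_op) (p : R) (m : nat) f
    (lam : nat -> R[i]) (a : nat -> X -> R[i]) : Prop :=
  [/\ forall j, atom L p m (a j),
      (\sum_(0 <= j <oo) (cabs (lam j) `^ p)%:E < +oo)%E &
      (fun N => cLnorm 2 (f \- (fun x => \sum_(0 <= j < N) lam j * a j x)))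
        @ \oo --> (0 : \bar R)%E].

Definition hardy_at (L : unbounded_op) (p : R) (m : nat) : set (X -> R[i]) :=
  [set f | cLp 2 f /\ exists lam a, atomic_rep L p m f lam a].

Definition hardy_norm (L : unbounded_op) (p : R) (m : nat) f : \bar R :=
  ereal_inf [set s | exists lam a, atomic_rep L p m f lam a /\
    s = ((\sum_(0 <= j <oo) (cabs (lam j) `^ p)%:E) `^ p^-1)%E].

(* The completion H^p_L is represented by the Cauchy sequences of
   H^p_{L,at,m}; [hardy_lim_norm] is the norm of the element of the completion
   represented by xi. *)
Definition hardy_cauchy (L : unbounded_op) (p : R) (m : nat)
    (xi : nat -> X -> R[i]) : Prop :=
  (forall k, hardy_at L p m (xi k)) /\
  forall e : R, 0 < e -> exists N, forall k l, (N <= k)%N -> (N <= l)%N ->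
    (hardy_norm L p m (xi k \- xi l)%R < e%:E)%E.

Definition hardy_lim_norm (L : unbounded_op) (p : R) (m : nat)
    (xi : nat -> X -> R[i]) : \bar R :=
  limn (fun k => hardy_norm L p m (xi k)).

(* eta is a sequence of D converging to the element represented by xi *)
Definition hardy_approx (L : unbounded_op) (p : R) (m : nat)
    (D : set (X -> R[i])) (xi eta : nat -> X -> R[i]) : Prop :=
  (forall k, D (eta k)) /\
  (fun k => hardy_norm L p m (eta k \- xi k)) @ \oo --> (0 : \bar R)%E.

(* Op f h: "h is (a version of) the image of f", for f in D.
   The operator is bounded from (D, hardy_norm) to (Y, normY), D is dense in
   H^p_L, and the operator extends by continuity to a bounded operator from
   H^p_L to Y; g is the image of the element represented by xi. *)
Definition extends_boundedly (L : unbounded_op) (p : R) (m : nat)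
    (D : set (X -> R[i])) (Op : (X -> R[i]) -> (X -> R[i]) -> Prop)
    (Y : set (X -> R[i])) (normY : (X -> R[i]) -> \bar R) : Prop :=
  [/\ D `<=` hardy_at L p m,
      forall f, D f -> exists h, Op f h &
      exists2 C : R, 0 < C &
        (forall f h, D f -> Op f h ->
           Y h /\ (normY h <= C%:E * hardy_norm L p m f)%E) /\
        (forall xi, hardy_cauchy L p m xi ->
           exists g, [/\ Y g,
             (normY g <= C%:E * hardy_lim_norm L p m xi)%E,
             exists eta, hardy_approx L p m D xi eta &
             forall eta hs, hardy_approx L p m D xi eta ->
               (forall k, Op (eta k) (hs k)) ->
               (fun k => normY (hs k \- g)) @ \oo --> (0 : \bar R)%E])].

Definition average b (x : X) (r : R) : R[i] :=
  ((vol x r)^-1)%:C * cintegral (ball x r) b.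

Definition BMO b : Prop :=
  [/\ cmeasurable b,
      forall x (r : R), 0 < r ->
        (\int[mu]_(y in ball x r) (cabs (b y))%:E < +oo)%E &
      exists M : R, forall x (r : R), 0 < r ->
        (\int[mu]_(y in ball x r) (cabs (b y - average b x r))%:E
           <= (M * vol x r)%:E)%E].

(* [b, T] f (x) = T ((b(x) - b) f) (x).  Since each T ((c - b) f) is only
   defined almost everywhere and c = b(x) varies with x, the value at x is
   taken as the limit of T ((c - b) f) (x) for c -> b(x), c in Q + iQ: up to
   null sets, T ((c - b) f) (x) is Lipschitz in c with constant |T f (x)|.
   For linear T this is b T f - T (b f). *)
Definition is_commutator b (T : (X -> R[i]) -> (X -> R[i])) f g : Prop :=
  cmeasurable g /\
  {ae mu, forall x, forall e : R, 0 < e -> exists2 del : R, 0 < del &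
     forall q1 q2 : rat, let c : R[i] := ratr q1 +i* ratr q2 in
       cabs (c - b x) < del ->
       cabs (T (fun y => (c - b y) * f y) x - g x) < e}.

End Spaces.

(* Main.v *)
Require Import Defs.
From HB Require Import structures.
From mathcomp Require Import all_boot all_order all_algebra.
From mathcomp Require Import complex.
From mathcomp Require Import all_classical all_reals all_analysis.
From mathcomp Require Import measurable_realfun.
From mathcomp Require Import ring lra.

Set Implicit Arguments.
Unset Strict Implicit.
Unset Printing Implicit Defensive.

Import Order.TTheory GRing.Theory Num.Theory.
Import numFieldNormedType.Exports.
Local Open Scope classical_set_scope.
Local Open Scope ring_scope.
Local Open Scope complex_scope.

(** Why the theorem holds.  The hypothesis on atoms, together with the L^2 bound,
    says that T a is concentrated on the ball B of the atom a, with L^2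
    norms over the annuli S_j(B) that decay like 2^(-2jm).  Doubling bounds
    the measure of these annuli by 2^(jn) times that of B, and the condition on
    m says that the decay wins after Hoelder's inequality on each annulus
    (lemmas decay_rate, decay_Lp, atom_decay).  Hence the p-th power integrals of
    |T a| are bounded uniformly in a.  For an atomic decomposition
    f = sum lam_j a_j converging in L^2, continuity in measure and subadditivity
    give |T f| <= sum |lam_j| |T a_j| almost everywhere (rep_image_Lp), and summing
    p-th powers gives the bound on the dense subspace.  The extension to the
    completion (extension) is the same for both parts: it only uses that
    differences are mapped to differences up to domination, and that L^p and
    weak L^1 are complete and satisfy a Fatou property (fatou_quasinorm).

    For the commutator, b(x) - b is compared on each atom with b(x) - b_B, where
    b_B is the mean of b over the ball of the atom.  On a finite atomic sum f
    this gives
      |[b,T] f| <= sum |lam_j| |b - b_Bj| |T a_j| + |T (sum lam_j (b - b_Bj) a_j)|.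
    The first sum is bounded in L^1: the oscillation of b in L^2 over 2^j B grows
    only like j times the square root of the measure (osc2_growth), which does
    not affect the geometric decay of T a_j (decay_osc).  The argument of T in
    the second term is bounded in L^1 by the Cauchy-Schwarz inequality on the
    balls, and the weak type (1,1) of T applies.  Both use that the mean
    oscillation of b is also bounded in L^2, which is the John-Nirenberg
    inequality (john_nirenberg2); it is obtained here by a self-improvement
    argument on Vitali coverings rather than by exponential decay of level sets.
    For infinite decompositions the remainder is small in L^2 only, where b is
    not a bounded multiplier; one therefore truncates b and works on sets where
    |b| is bounded (commutator_splitting, commutator_dist_local), none of the
    bounds depending on the truncation.

    The hypothesis concerns (p,2,m)-atoms, while the commutator acts on
    (1,2,m)-atoms; each of the latter is a multiple of one of the former, by a
    power of the measure of its ball (annular_decay_rescale). *)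

(** * Complex-valued functions: modulus and measurability *)

Section ComplexModulus.
Context {R : realType}.
Implicit Types z w : R[i].

Lemma cabs_ge0 z : 0 <= cabs z.
Proof. by case: z => a b; rewrite /cabs /= sqrtr_ge0. Qed.

Lemma cabs0 : cabs (0 : R[i]) = 0.
Proof. exact: Normc.normc0. Qed.

Lemma cabs0_eq0 z : cabs z = 0 -> z = 0.
Proof. exact: Normc.eq0_normc. Qed.

Lemma cabsM z w : cabs (z * w) = cabs z * cabs w.
Proof. exact: Normc.normcM. Qed.

Lemma cabsD z w : cabs (z + w) <= cabs z + cabs w.
Proof. exact: le_normcD. Qed.

Lemma cabsN z : cabs (- z) = cabs z.
Proof. exact: normcN. Qed.

Lemma cabsB z w : cabs (z - w) <= cabs z + cabs w.
Proof. by rewrite -[cabs w]cabsN cabsD. Qed.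

Lemma cabs_distC z w : cabs (z - w) = cabs (w - z).
Proof. by rewrite -cabsN opprB. Qed.

Lemma cabs_triangle u z w : cabs (z - w) <= cabs (z - u) + cabs (u - w).
Proof. by have := cabsD (z - u) (u - w); rewrite addrA subrK. Qed.

Lemma cabs_dist_le z w : `|cabs z - cabs w| <= cabs (z - w).
Proof.
have := cabsD (z - w) w; have := cabsD (w - z) z.
rewrite !subrK (cabs_distC w) ler_norml => h1 h2; apply/andP; split; lra.
Qed.

Lemma cabs_real (x : R) : cabs x%:C = `|x|.
Proof. by rewrite /cabs /= expr0n /= addr0 sqrtr_sqr. Qed.

Lemma cabs_norm z : cabs `|z| = cabs z.
Proof. by rewrite normc_def; case: z => a b; rewrite cabs_real ger0_norm // sqrtr_ge0. Qed.

Lemma cabsE z : cabs z = (complex.Re z ^+ 2 + complex.Im z ^+ 2) `^ 2^-1.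
Proof. by rewrite powR12_sqrt ?addr_ge0 ?sqr_ge0 //; case: z. Qed.

Lemma cabs_sqr z : cabs z ^+ 2 = complex.Re z ^+ 2 + complex.Im z ^+ 2.
Proof. by case: z => a b; rewrite /cabs /= sqr_sqrtr // addr_ge0 // sqr_ge0. Qed.

Lemma le_Re_cabs z : `|complex.Re z| <= cabs z.
Proof.
rewrite -ler_sqr ?nnegrE ?cabs_ge0 // cabs_sqr real_normK ?num_real //.
by rewrite lerDl sqr_ge0.
Qed.

Lemma le_Im_cabs z : `|complex.Im z| <= cabs z.
Proof.
rewrite -ler_sqr ?nnegrE ?cabs_ge0 // cabs_sqr real_normK ?num_real //.
by rewrite lerDr sqr_ge0.
Qed.

Lemma cabs_le_ReIm z : cabs z <= `|complex.Re z| + `|complex.Im z|.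
Proof.
rewrite -ler_sqr ?nnegrE ?addr_ge0 // ?cabs_ge0 // cabs_sqr.
rewrite sqrrD !real_normK ?num_real //.
by rewrite addrAC lerDl mulrn_wge0 // mulr_ge0.
Qed.

Lemma cabs_sum (I : Type) (s : seq I) (P : pred I) (F : I -> R[i]) :
  cabs (\sum_(i <- s | P i) F i) <= \sum_(i <- s | P i) cabs (F i).
Proof.
elim/big_rec2: _ => [|i y z _ le_yz]; first by rewrite cabs0.
by apply: (le_trans (cabsD _ _)); rewrite lerD2l.
Qed.

End ComplexModulus.

#[global] Hint Extern 0 (is_true (0 <= cabs _)) => exact: cabs_ge0 : core.

Section ComplexMeasurable.
Context {d : measure_display} {R : realType} {X : borelMetricType d R}.
Implicit Types f g : X -> R[i].

Lemma cmeasurable_cabs f : cmeasurable f ->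
  measurable_fun setT (fun x => cabs (f x)).
Proof.
move=> [mr mi].
rewrite (_ : (fun x => _) =
  (fun x => (complex.Re (f x) ^+ 2 + complex.Im (f x) ^+ 2) `^ 2^-1)); last first.
  by apply/funext => x; rewrite cabsE.
apply: (measurableT_comp (measurable_powR 2^-1)).
by apply: measurable_funD; apply: measurable_funX.
Qed.

Lemma cmeasurableD f g : cmeasurable f -> cmeasurable g -> cmeasurable (f \+ g).
Proof.
move=> [fr fi] [gr gi]; split.
- rewrite (_ : (fun x => _) = (fun x => complex.Re (f x)) \+ (fun x => complex.Re (g x))).
    exact: measurable_funD.
  by apply/funext => x /=; case: (f x) => ? ?; case: (g x).
- rewrite (_ : (fun x => _) = (fun x => complex.Im (f x)) \+ (fun x => complex.Im (g x))).
    exact: measurable_funD.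
  by apply/funext => x /=; case: (f x) => ? ?; case: (g x).
Qed.

Lemma cmeasurableM f g : cmeasurable f -> cmeasurable g -> cmeasurable (f \* g).
Proof.
move=> [fr fi] [gr gi]; split.
- rewrite (_ : (fun x => _) =
    (fun x => complex.Re (f x) * complex.Re (g x)) \-
    (fun x => complex.Im (f x) * complex.Im (g x))).
    by apply: measurable_funB; apply: measurable_funM.
  by apply/funext => x /=; case: (f x) => ? ?; case: (g x).
- rewrite (_ : (fun x => _) =
    (fun x => complex.Re (f x) * complex.Im (g x)) \+
    (fun x => complex.Im (f x) * complex.Re (g x))).
    by apply: measurable_funD; apply: measurable_funM.
  by apply/funext => x /=; case: (f x) => ? ?; case: (g x).
Qed.

Lemma cmeasurable_cst (c : R[i]) : @cmeasurable d R X (fun=> c).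
Proof. by split; apply: measurable_cst. Qed.

Lemma cmeasurableZ (c : R[i]) f : cmeasurable f -> cmeasurable (c \*o f).
Proof. exact/cmeasurableM/cmeasurable_cst. Qed.

Lemma cmeasurableN f : cmeasurable f -> cmeasurable (fun x => - f x).
Proof.
move=> /(cmeasurableZ (-1)); congr cmeasurable.
by apply/funext => x /=; rewrite mulN1r.
Qed.

Lemma cmeasurableB f g : cmeasurable f -> cmeasurable g -> cmeasurable (f \- g).
Proof. by move=> mf mg; apply: (cmeasurableD mf (cmeasurableN mg)). Qed.

Lemma cmeasurable_sum (F : nat -> X -> R[i]) m n :
  (forall i, cmeasurable (F i)) ->
  cmeasurable (fun x => \sum_(m <= i < n) F i x).
Proof.
move=> mF; elim: (index_iota m n) => [|i s IHs].
  rewrite (_ : (fun x => _) = (fun=> 0)); first exact: cmeasurable_cst.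
  by apply/funext => x; rewrite big_nil.
rewrite (_ : (fun x => _) = F i \+ (fun x => \sum_(j <- s) F j x)).
  exact: cmeasurableD.
by apply/funext => x; rewrite big_cons.
Qed.

End ComplexMeasurable.

(** * Integrals of nonnegative functions *)

Section NonnegIntegral.
Context {d : measure_display} {T : measurableType d} {R : realType}.
Variable mu : {measure set T -> \bar R}.
Implicit Types (u v w : T -> R) (A B D E : set T).

(** Integrands in R rather than in the extended reals, so that real arithmetic
    applies to them; the lemmas assume measurability on the whole space because
    the same function is integrated over many balls. *)
Definition rint D u : \bar R := (\int[mu]_(x in D) (u x)%:E)%E.

Lemma rint_ge0 D u : (forall x, 0 <= u x) -> (0 <= rint D u)%E.
Proof. by move=> u0; apply: integral_ge0 => x _; rewrite lee_fin. Qed.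

Lemma meas_EFin D u : measurable_fun setT u ->
  measurable_fun D (fun x => (u x)%:E).
Proof. by move=> mu_; apply/measurable_EFinP; apply: measurable_funTS. Qed.

Lemma le_rint D u v : measurable D ->
  measurable_fun setT u -> measurable_fun setT v -> (forall x, 0 <= u x) ->
  (forall x, D x -> u x <= v x) -> (rint D u <= rint D v)%E.
Proof.
move=> mD mfu mfv u0 uv; apply: ge0_le_integral => //.
- by move=> x _; rewrite lee_fin.
- exact: meas_EFin.
- exact: meas_EFin.
Qed.

Lemma ae_le_rint D u v : measurable D ->
  measurable_fun setT u -> measurable_fun setT v -> (forall x, 0 <= u x) ->
  (forall x, 0 <= v x) ->
  {ae mu, forall x, D x -> u x <= v x} -> (rint D u <= rint D v)%E.
Proof.
move=> mD mfu mfv u0 v0 uv; apply: ae_ge0_le_integral => //.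
- by move=> x _; rewrite lee_fin.
- exact: meas_EFin.
- by move=> x _; rewrite lee_fin.
- exact: meas_EFin.
Qed.

Lemma rint_subset A B u : measurable A -> measurable B ->
  measurable_fun setT u -> (forall x, 0 <= u x) -> A `<=` B ->
  (rint A u <= rint B u)%E.
Proof.
move=> mA mB mfu u0 AB; apply: ge0_subset_integral => //; first exact: meas_EFin.
by move=> x _; rewrite lee_fin.
Qed.

Lemma rintD D u v : measurable D ->
  measurable_fun setT u -> measurable_fun setT v -> (forall x, 0 <= u x) ->
  (forall x, 0 <= v x) -> rint D (fun x => u x + v x) = (rint D u + rint D v)%E.
Proof.
move=> mD mfu mfv u0 v0; rewrite /rint.
under eq_integral do rewrite EFinD.
apply: ge0_integralD => //; try by move=> x _; rewrite lee_fin.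
- exact: meas_EFin.
- exact: meas_EFin.
Qed.

Lemma rintZ D u (k : R) : measurable D ->
  measurable_fun setT u -> (forall x, 0 <= u x) -> 0 <= k ->
  rint D (fun x => k * u x) = (k%:E * rint D u)%E.
Proof.
move=> mD mfu u0 k0; rewrite /rint.
under eq_integral do rewrite EFinM.
apply: ge0_integralZl_EFin => //; first by move=> x _; rewrite lee_fin.
exact: meas_EFin.
Qed.

Lemma rint_cst D (k : R) : measurable D -> rint D (fun=> k) = (k%:E * mu D)%E.
Proof. by move=> mD; rewrite /rint; apply: integral_cst. Qed.

Lemma rint_setU A B u : measurable A -> measurable B -> measurable_fun setT u ->
  (forall x, 0 <= u x) -> (rint (A `|` B) u <= rint A u + rint B u)%E.
Proof.
move=> mA mB mfu u0.
rewrite (_ : A `|` B = A `|` (B `\` A)); last first.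
  by rewrite setDE setUIr setUv setIT.
rewrite /rint ge0_integral_setU //; first last.
- by apply/disj_set2P; rewrite setDE setIC -setIA setICl setI0.
- by move=> x _; rewrite lee_fin.
- exact: meas_EFin.
- exact: measurableD.
by apply: leeD => //; apply: rint_subset => //; exact: measurableD.
Qed.

End NonnegIntegral.

Arguments rint {d T R} mu D%_classical_set_scope u%_ring_scope.

(** * Inequalities for powers and integrals *)

Section PowerInequalities.
Context {R : realType}.
Implicit Types a b p : R.

Lemma powR2 a : 0 <= a -> a `^ 2 = a ^+ 2.
Proof. by move=> a0; rewrite -powR_mulrn. Qed.

Lemma powRK p a : 0 < p -> 0 <= a -> (a `^ p) `^ p^-1 = a.
Proof. by move=> p0 a0; rewrite -powRrM mulfV ?gt_eqF // powRr1. Qed.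

Lemma powRVK p a : 0 < p -> 0 <= a -> (a `^ p^-1) `^ p = a.
Proof. by move=> p0 a0; rewrite -powRrM mulVf ?gt_eqF // powRr1. Qed.

(** t / (a + b) <= (t / (a + b)) ^ p for t = a and t = b; the left-hand sides
    add up to 1. *)
Lemma powR_subadd p a b : 0 < p <= 1 -> 0 <= a -> 0 <= b ->
  (a + b) `^ p <= a `^ p + b `^ p.
Proof.
move=> /andP[p0 p1] a0 b0.
have [s0|s0] := eqVneq (a + b) 0.
  by rewrite s0 powR0 ?gt_eqF // addr_ge0 // powR_ge0.
have s_gt0 : 0 < a + b by rewrite lt_neqAle eq_sym s0 addr_ge0.
have key (t : R) : 0 <= t -> t <= a + b -> t / (a + b) * (a + b) `^ p <= t `^ p.
  move=> t0 ts; have [->|tn0] := eqVneq t 0; first by rewrite !mul0r powR_ge0.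
  rewrite -[X in _ <= X `^ p](divfK s0) powRM ?divr_ge0 ?(ltW s_gt0) //.
  have t_gt0 : 0 < t by rewrite lt_neqAle eq_sym tn0.
  rewrite ler_wpM2r ?powR_ge0 // ger1_powR // divr_gt0 //=.
  by rewrite ler_pdivrMr // mul1r.
have := lerD (key a a0 _) (key b b0 _); rewrite lerDl lerDr => /(_ b0 a0).
by rewrite -mulrDl -mulrDl divff // mul1r.
Qed.

Lemma powR_sum_subadd p (F : nat -> R) N : 0 < p <= 1 -> (forall i, 0 <= F i) ->
  (\sum_(0 <= i < N) F i) `^ p <= \sum_(0 <= i < N) F i `^ p.
Proof.
move=> p01 F0; elim: N => [|N IH].
  by rewrite !big_nil powR0 // gt_eqF //; case/andP: p01.
rewrite !big_nat_recr //=.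
by apply: (le_trans (powR_subadd _ _ _)); rewrite ?sumr_ge0 // lerD2r.
Qed.

(** The elementary substitute for Hoelder's inequality: splitting at height l
    trades a p-th power for a constant and a square. *)
Lemma powR_le_cst_sqr p a l : 0 < p <= 2 -> 0 <= a -> 0 < l ->
  a `^ p <= l `^ p + l `^ (p - 2) * a ^+ 2.
Proof.
move=> /andP[p0 p2] a0 l0; have [al|la] := leP a l.
  rewrite -[leLHS]addr0 lerD ?mulr_ge0 ?powR_ge0 ?sqr_ge0 //.
  by rewrite ge0_ler_powR ?nnegrE // ltW.
have a_gt0 := lt_trans l0 la.
rewrite -[leLHS]add0r lerD ?powR_ge0 //.
have -> : a `^ p = a `^ (p - 2) * a ^+ 2.
  by rewrite -powR2 // -powRD ?subrK // (gt_eqF a_gt0) implybT.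
rewrite ler_wpM2r ?sqr_ge0 // -[p - 2]opprB !powRN lef_pV2 ?posrE ?powR_gt0 //.
by rewrite ge0_ler_powR ?nnegrE ?subr_ge0 // ltW.
Qed.

End PowerInequalities.

Section Archimedean.
Context {R : realType}.

Lemma ex_inv_succ_lt (e : R) : 0 < e -> exists k : nat, k.+1%:R^-1 < e.
Proof.
move=> e0; exists (Num.truncn e^-1); rewrite invf_plt ?posrE //.
by case/andP: (truncn_itv (ltW (eqbRL (invr_gt0 e) e0))).
Qed.

Lemma ex_pow2_gt (a : R) : exists k : nat, a < 2 ^+ k.
Proof.
exists (Num.truncn `|a|).+1; apply: le_lt_trans (ler_norm a) _.
apply: (@lt_le_trans _ _ (Num.truncn `|a|).+1%:R).
  by case/andP: (truncn_itv (normr_ge0 a)).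
by rewrite -natrX ler_nat ltnW // ltn_expl.
Qed.

End Archimedean.

Section IntegralInequalities.
Context {d : measure_display} {T : measurableType d} {R : realType}.
Variable mu : {measure set T -> \bar R}.
Implicit Types (u v w : T -> R) (A B D E : set T).

Lemma measurable_powRf u p : measurable_fun setT u ->
  measurable_fun setT (fun x => u x `^ p).
Proof. by move=> mfu; apply: (measurableT_comp (measurable_powR p)). Qed.

(** Hoelder's inequality between L^2 and L^p on a set of finite measure, up to
    the factor 2. *)
Lemma rint_interp D u (p A W : R) : measurable D -> measurable_fun setT u ->
  (forall x, 0 <= u x) -> 0 < p <= 2 -> 0 < A -> 0 < W ->
  (rint mu D (fun x => u x ^+ 2)%R <= (A ^+ 2)%:E)%E -> (mu D <= W%:E)%E ->
  (rint mu D (fun x => u x `^ p)%R <= (2 * (A `^ p * W `^ (1 - p / 2)))%:E)%E.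
Proof.
move=> mD mfu u0 p02 A0 W0 intA muW.
(* the height at which both parts of the bound have the same size *)
pose l := A * W `^ (- 2^-1).
have l0 : 0 < l by rewrite mulr_gt0 // powR_gt0.
apply: (@le_trans _ _
   (rint mu D (fun x => l `^ p + l `^ (p - 2) * u x ^+ 2)%R)).
  apply: le_rint => //.
  - exact: measurable_powRf.
  - apply: measurable_funD; first exact: measurable_cst.
    by apply: measurable_funM; [exact: measurable_cst | exact: measurable_funX].
  - by move=> x; rewrite powR_ge0.
  - by move=> x _; apply: powR_le_cst_sqr.
have mfu2 : measurable_fun setT (fun x => u x ^+ 2) by exact: measurable_funX.
rewrite rintD //; first last.
- by move=> x; rewrite mulr_ge0 ?powR_ge0 ?sqr_ge0.
- by move=> x; rewrite powR_ge0.
- by apply: measurable_funM => //; exact: measurable_cst.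
rewrite rintZ ?powR_ge0 //; last by move=> x; rewrite sqr_ge0.
rewrite rint_cst // [leRHS](_ : _ =
   (l `^ p)%:E * W%:E + (l `^ (p - 2))%:E * (A ^+ 2)%:E)%E; last first.
  rewrite -!EFinM -EFinD; congr EFin.
  have AA x : A `^ x * W `^ (- 2^-1 * x) = l `^ x.
    by rewrite powRM ?powR_ge0 // ?ltW // powRrM.
  have e1 : W `^ (- 2^-1 * p) * W = W `^ (1 - p / 2).
    rewrite -[X in _ * X](powRr1 (ltW W0)) -powRD; first by congr (_ `^ _); lra.
    by rewrite (gt_eqF W0) implybT.
  have e2 : A `^ (p - 2) * A ^+ 2 = A `^ p.
    by rewrite -(powR2 (ltW A0)) -powRD ?subrK // (gt_eqF A0) implybT.
  have e3 : W `^ (- 2^-1 * (p - 2)) = W `^ (1 - p / 2) by congr (_ `^ _); lra.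
  by rewrite -!AA -mulrA e1 e3 mulrAC e2 mulr_natl mulr2n.
by apply: leeD; apply: lee_wpmul2l; rewrite // lee_fin powR_ge0.
Qed.

(** The Cauchy-Schwarz inequality, from u v <= (B / 2A) u^2 + (A / 2B) v^2. *)
Lemma rint_CauchySchwarz D u v (A B : R) : measurable D ->
  measurable_fun setT u -> measurable_fun setT v ->
  (forall x, 0 <= u x) -> (forall x, 0 <= v x) -> 0 < A -> 0 < B ->
  (rint mu D (fun x => u x ^+ 2)%R <= (A ^+ 2)%:E)%E ->
  (rint mu D (fun x => v x ^+ 2)%R <= (B ^+ 2)%:E)%E ->
  (rint mu D (fun x => u x * v x)%R <= (A * B)%:E)%E.
Proof.
move=> mD mfu mfv u0 v0 A0 B0 intA intB.
have mfu2 : measurable_fun setT (fun x => u x ^+ 2) by exact: measurable_funX.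
have mfv2 : measurable_fun setT (fun x => v x ^+ 2) by exact: measurable_funX.
have a0 : 0 <= B / (2 * A) by rewrite divr_ge0 ?mulr_ge0 // ltW.
have b0 : 0 <= A / (2 * B) by rewrite divr_ge0 ?mulr_ge0 // ltW.
apply: (@le_trans _ _
   (rint mu D (fun x => B / (2 * A) * u x ^+ 2 + A / (2 * B) * v x ^+ 2)%R)).
  apply: le_rint => //.
  - exact: measurable_funM.
  - by apply: measurable_funD; apply: measurable_funM => //; exact: measurable_cst.
  - by move=> x; rewrite mulr_ge0.
  - move=> x _.
    have -> : B / (2 * A) * u x ^+ 2 + A / (2 * B) * v x ^+ 2 =
      u x * v x + (B * u x - A * v x) ^+ 2 / (2 * A * B).
      by field; rewrite !gt_eqF.
    by rewrite lerDl divr_ge0 ?sqr_ge0 // !mulr_ge0 // ltW.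
rewrite rintD //; first last.
- by move=> x; rewrite mulr_ge0 ?sqr_ge0.
- by move=> x; rewrite mulr_ge0 ?sqr_ge0.
- by apply: measurable_funM => //; exact: measurable_cst.
- by apply: measurable_funM => //; exact: measurable_cst.
rewrite !rintZ //; try by move=> x; rewrite sqr_ge0.
rewrite [leRHS](_ : _ = (B / (2 * A))%:E * (A ^+ 2)%:E +
   (A / (2 * B))%:E * (B ^+ 2)%:E)%E; last first.
  by rewrite -!EFinM -EFinD; congr EFin; field; rewrite !gt_eqF.
by apply: leeD; apply: lee_wpmul2l; rewrite // lee_fin.
Qed.

Lemma measurable_gt u (t : R) : measurable_fun setT u ->
  measurable [set x | t < u x].
Proof.
move=> mfu; rewrite -[X in measurable X]setTI.
have := mfu measurableT _ (measurable_itv `]t, +oo[).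
by congr (measurable (_ `&` _)); apply/seteqP; split=> x; rewrite /= in_itv /= andbT.
Qed.

Lemma chebyshev_rint u (t : R) : measurable_fun setT u -> (forall x, 0 <= u x) ->
  0 < t -> (t%:E * mu [set x | (t < u x)%R] <= rint mu setT u)%E.
Proof.
move=> mfu u0 t0; have mA := measurable_gt t mfu.
rewrite -rint_cst //; apply: (@le_trans _ _ (rint mu [set x | t < u x] u)).
  apply: le_rint => //.
  - by move=> x; rewrite ltW.
  - by move=> x /= /ltW.
by apply: rint_subset.
Qed.

Lemma chebyshev_le u (t C : R) : measurable_fun setT u -> (forall x, 0 <= u x) ->
  0 < t -> (rint mu setT u <= C%:E)%E ->
  (mu [set x | (t < u x)%R] <= (C / t)%:E)%E.
Proof.
move=> mfu u0 t0 uC; rewrite mulrC EFinM lee_pdivlMl //.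
exact: le_trans (chebyshev_rint mfu u0 t0) uC.
Qed.

Lemma chebyshev_powR u (p t C : R) : measurable_fun setT u ->
  (forall x, 0 <= u x) -> 0 < p -> 0 < t ->
  (rint mu setT (fun x => u x `^ p)%R <= C%:E)%E ->
  (mu [set x | (t < u x)%R] <= (C / t `^ p)%:E)%E.
Proof.
move=> mfu u0 p0 t0 uC.
rewrite (_ : [set x | _] = [set x | (t `^ p < u x `^ p)%R]).
  apply: chebyshev_le => //; [exact: measurable_powRf | by move=> x; rewrite powR_ge0 | exact: powR_gt0].
apply/seteqP; split=> x /= h.
  by rewrite gt0_ltr_powR // nnegrE // ltW.
by rewrite ltNge; apply/negP => h2; move: h; rewrite ltNge ge0_ler_powR ?nnegrE // ltW.
Qed.

Lemma fatou_rint D (u : nat -> T -> R) v (A : \bar R) : measurable D ->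
  (forall i, measurable_fun setT (u i)) -> measurable_fun setT v ->
  (forall i x, 0 <= u i x) -> (forall x, 0 <= v x) ->
  {ae mu, forall x, u ^~ x @ \oo --> v x} ->
  (forall i, rint mu D (u i) <= A)%E -> (rint mu D v <= A)%E.
Proof.
move=> mD mfu mfv u0 v0 uv uA.
apply: (@le_trans _ _ (\int[mu]_(x in D) limn_einf (fun i => (u i x)%:E))%E).
  apply: ae_ge0_le_integral => //.
  - by move=> x _; rewrite lee_fin.
  - exact: meas_EFin.
  - move=> x _; rewrite limn_einf_lim; apply: lime_ge; first exact: is_cvg_einfs.
    apply: nearW => n; apply: le_ereal_inf_tmp => _ [i _ <-].
    by rewrite lee_fin.
  - apply: measurableT_comp => //; apply: measurable_fun_limn_esup => i.
    by apply: measurableT_comp => //; exact: meas_EFin.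
  - apply: filterS uv => x uvx _.
    have /cvg_limn_einf_sup[-> _] // : (fun i => (u i x)%:E) @ \oo --> (v x)%:E.
    by apply: cvg_EFin => //; exact: nearW.
have F : (\int[mu]_(x in D) limn_einf (fun i => (u i x)%:E) <=
    limn_einf (fun i => rint mu D (u i)))%E.
  apply: (@fatou _ _ _ mu D mD (fun i x => (u i x)%:E)).
    by move=> i; exact: meas_EFin.
  by move=> i x _; rewrite lee_fin.
apply: (le_trans F).
rewrite limn_einf_lim; apply: lime_le; first exact: is_cvg_einfs.
apply: nearW => n; apply: (@le_trans _ _ (rint mu D (u n))); last exact: uA.
by apply: ereal_inf_lbound; exists n => /=.
Qed.

(** Exceptional sets of measure at most 1 / (k + 1) intersect in a null set.
    This replaces the extraction of almost everywhere convergent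
    subsequences. *)
Lemma ae_le_approx u (v : T -> \bar R) :
  (forall e1 e2 : R, 0 < e1 -> 0 < e2 -> exists E, [/\ measurable E,
     (mu E <= e2%:E)%E &
     {ae mu, forall x, (u x)%:E <= v x + e1%:E \/ E x}%E]) ->
  {ae mu, forall x, (u x)%:E <= v x}%E.
Proof.
move=> H.
have H1 (e1 : R) : 0 < e1 -> {ae mu, forall x, (u x)%:E <= v x + e1%:E}%E.
  move=> e10.
  have /choice[E HE] k : exists E, [/\ measurable E, (mu E <= (k.+1%:R^-1)%:E)%E &
     {ae mu, forall x, (u x)%:E <= v x + e1%:E \/ E x}%E].
    by apply: H => //; rewrite invr_gt0.
  have E0 : mu (\bigcap_k E k) = 0%E.
    apply/eqP; rewrite -measure_le0; apply/lee_addgt0Pr => e e0; rewrite add0e.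
    have [k ke] := ex_inv_succ_lt e0.
    have [mE Ek _] := HE k.
    apply: (@le_trans _ _ (mu (E k))).
      apply: le_measure; rewrite ?inE //.
        by apply: bigcapT_measurable => i; have [] := HE i.
      exact: bigcap_inf.
    by apply: (le_trans Ek); rewrite lee_fin ltW.
  have ae1 : {ae mu, forall x, forall k, (u x)%:E <= v x + e1%:E \/ E k x}%E.
    by apply: ae_foralln => k; have [] := HE k.
  have ae2 : {ae mu, forall x, ~ (\bigcap_k E k) x}.
    exists (\bigcap_k E k); split=> //.
      by apply: bigcapT_measurable => i; have [] := HE i.
    by move=> x /= /contrapT.
  apply: filterS2 ae1 ae2 => x h1 h2; apply: contrapT => h3.
  by apply: h2 => k _; case: (h1 k).
have : {ae mu, forall x, forall k : nat, (u x)%:E <= v x + (k.+1%:R^-1)%:E}%E.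
  by apply: ae_foralln => k; apply: H1; rewrite invr_gt0.
apply: filterS => x hx; apply/lee_addgt0Pr => e e0.
have [k ke] := ex_inv_succ_lt e0.
by apply: (le_trans (hx k)); rewrite leeD2l // lee_fin ltW.
Qed.

End IntegralInequalities.

(** * L^p and weak L^1 quasi-norms *)

Section PointwiseLimits.
Context {d : measure_display} {R : realType} {X : borelMetricType d R}.

Lemma real_cauchy_cvg (u : nat -> R) :
  (forall e : R, 0 < e -> exists N, forall i j, (N <= i)%N -> (N <= j)%N ->
     `|u i - u j| <= e) -> cvgn u.
Proof.
move=> cu; apply/cauchy_cvgP/cauchy_exP => e e0.
have [N HN] := cu (e / 2) (divr_gt0 e0 (ltr0Sn _ _)).
exists (u N); exists N => // i /= Ni.
apply: (le_lt_trans (HN N i (leqnn _) Ni)).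
by rewrite ltr_pdivrMr // ltr_pMr // ltr1n.
Qed.

Lemma measurable_real_limit (u : nat -> X -> R) :
  (forall i, measurable_fun setT (u i)) ->
  exists2 g : X -> R, measurable_fun setT g &
    forall x (l : R), u ^~ x @ \oo --> l -> g x = l.
Proof.
move=> mfu; exists (fun x => fine (limn_esup (fun i => (u i x)%:E))).
  apply: measurableT_comp => //; apply: measurable_fun_limn_esup => i.
  exact: meas_EFin.
move=> x l ul.
have /cvg_limn_einf_sup[_ ->] // : (fun i => (u i x)%:E) @ \oo --> l%:E.
by apply: cvg_EFin => //; exact: nearW.
Qed.

Definition clim (z : nat -> R[i]) (l : R[i]) : Prop :=
  forall e : R, 0 < e -> exists N, forall i, (N <= i)%N -> cabs (z i - l) <= e.

Definition ccauchy (z : nat -> R[i]) : Prop :=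
  forall e : R, 0 < e -> exists N, forall i j, (N <= i)%N -> (N <= j)%N ->
    cabs (z i - z j) <= e.

Lemma ReB (z w : R[i]) : complex.Re (z - w) = complex.Re z - complex.Re w.
Proof. by case: z => ? ?; case: w. Qed.

Lemma ImB (z w : R[i]) : complex.Im (z - w) = complex.Im z - complex.Im w.
Proof. by case: z => ? ?; case: w. Qed.

Lemma measurable_complex_limit (h : nat -> X -> R[i]) :
  (forall i, cmeasurable (h i)) ->
  exists2 g, cmeasurable g &
    forall x, ccauchy (h ^~ x) -> clim (h ^~ x) (g x).
Proof.
move=> mh.
have [gr mgr Hr] := measurable_real_limit (fun i => proj1 (mh i)).
have [gi mgi Hi] := measurable_real_limit (fun i => proj2 (mh i)).
exists (fun x => gr x +i* gi x) => // x ch.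
have cr : cvgn (fun i => complex.Re (h i x)).
  apply: real_cauchy_cvg => e /ch[N HN]; exists N => i j Ni Nj.
  by rewrite -ReB; apply: le_trans (le_Re_cabs _) (HN i j Ni Nj).
have ci : cvgn (fun i => complex.Im (h i x)).
  apply: real_cauchy_cvg => e /ch[N HN]; exists N => i j Ni Nj.
  by rewrite -ImB; apply: le_trans (le_Im_cabs _) (HN i j Ni Nj).
rewrite (Hr x _ cr) (Hi x _ ci) => e e0.
have e2 : 0 < e / 2 by rewrite divr_gt0.
have /cvgrPdist_le/(_ _ e2)[N1 _ HN1] := cr.
have /cvgrPdist_le/(_ _ e2)[N2 _ HN2] := ci.
exists (maxn N1 N2) => i; rewrite geq_max => /andP[/HN1 /= h1 /HN2 /= h2].
apply: (le_trans (cabs_le_ReIm _)); rewrite ReB ImB /= [leRHS]splitr.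
by apply: lerD; rewrite distrC.
Qed.

Lemma clim_cabs (z : nat -> R[i]) l :
  clim z l -> (fun i => cabs (z i)) @ \oo --> cabs l.
Proof.
move=> zl; apply/cvgrPdist_le => e /zl[N HN]; exists N => // i /= /HN.
apply: le_trans; rewrite distrC; exact: cabs_dist_le.
Qed.

Lemma clim_sub_cst (z : nat -> R[i]) l w :
  clim z l -> clim (fun i => w - z i) (w - l).
Proof.
move=> zl e /zl[N HN]; exists N => i /HN.
have E (a b c : R[i]) : a - b - (a - c) = c - b by rewrite opprB [LHS]addrC subrKA.
by rewrite E cabs_distC.
Qed.

End PointwiseLimits.

Section LpNorms.
Context {d : measure_display} {R : realType} {X : borelMetricType d R}.
Variable mu : {measure set X -> \bar R}.
Implicit Types f g h : X -> R[i].
Implicit Types p t : R.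

Lemma cLnormE p f :
  cLnorm mu p f = (rint mu setT (fun x => cabs (f x) `^ p)%R `^ p^-1)%E.
Proof.
rewrite /cLnorm unlock; congr (_ `^ _)%E; apply: eq_integral => x _.
by rewrite abse_EFin ger0_norm // poweR_EFin.
Qed.

Lemma poweRV_le p (x : \bar R) (A : R) : 0 < p -> (0 <= x)%E -> 0 <= A ->
  (x `^ p^-1 <= A%:E)%E <-> (x <= (A `^ p)%:E)%E.
Proof.
move=> p0; case: x => [r| |] // r0 A0.
  rewrite poweR_EFin !lee_fin; split=> h.
    rewrite -[r](powRVK p0) // ge0_ler_powR ?nnegrE ?powR_ge0 //; exact: ltW.
  rewrite -[A](powRK p0) // ge0_ler_powR ?nnegrE ?powR_ge0 ?invr_ge0 //.
  exact: ltW.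
by rewrite poweRyr ?invr_eq0 ?gt_eqF // !leye_eq.
Qed.

Lemma rint_cabs_ge0 p f : (0 <= rint mu setT (fun x => cabs (f x) `^ p)%R)%E.
Proof. by apply: rint_ge0 => x; rewrite powR_ge0. Qed.

Lemma cLnorm_ge0 p f : (0 <= cLnorm mu p f)%E.
Proof. by rewrite cLnormE poweR_ge0. Qed.

Lemma cLnorm_le p f (A : R) : 0 < p -> 0 <= A ->
  (cLnorm mu p f <= A%:E)%E <->
  (rint mu setT (fun x => cabs (f x) `^ p)%R <= (A `^ p)%:E)%E.
Proof. by move=> p0 A0; rewrite cLnormE; apply: poweRV_le => //; exact: rint_cabs_ge0. Qed.

Lemma cLnorm2_le f (A : R) : 0 <= A ->
  (cLnorm mu 2 f <= A%:E)%E <->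
  (rint mu setT (fun x => cabs (f x) ^+ 2)%R <= (A ^+ 2)%:E)%E.
Proof.
move=> A0; rewrite cLnorm_le // -powR2 //.
by under [X in (rint _ _ X <= _)%E]eq_fun do rewrite powR2 //.
Qed.

Lemma cLnorm1 f : cLnorm mu 1 f = rint mu setT (fun x => cabs (f x))%R.
Proof.
rewrite cLnormE invr1 poweRe1 ?rint_cabs_ge0 //; congr (rint _ _ _).
by apply/funext => x; rewrite powRr1.
Qed.

Lemma ereal_real_bound (x : \bar R) : (0 <= x)%E -> (x < +oo)%E ->
  exists2 A : R, 0 < A & (x <= A%:E)%E.
Proof.
case: x => [r| |] // r0 _; exists (r + 1); first by rewrite ltr_wpDl.
by rewrite lee_fin lerDl.
Qed.

Lemma cLpP p f : 0 < p -> cLp mu p f <-> cmeasurable f /\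
  (rint mu setT (fun x => cabs (f x) `^ p)%R < +oo)%E.
Proof.
move=> p0; split=> -[mf fp]; split=> //.
  have [A A0 fA] := ereal_real_bound (cLnorm_ge0 p f) fp.
  by apply: (le_lt_trans (proj1 (cLnorm_le f p0 (ltW A0)) fA)); rewrite ltry.
by rewrite cLnormE poweR_lty.
Qed.

Lemma cLp1P f : cLp mu 1 f <-> cmeasurable f /\
  (rint mu setT (fun x => cabs (f x))%R < +oo)%E.
Proof. by rewrite /cLp /= cLnorm1. Qed.

Lemma cLp2P f : cLp mu 2 f <-> cmeasurable f /\
  (rint mu setT (fun x => cabs (f x) ^+ 2)%R < +oo)%E.
Proof. by rewrite cLpP //; under [X in rint _ _ X]eq_fun do rewrite powR2 //. Qed.

Lemma le_weakL1norm f (A : \bar R) :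
  (forall t, 0 < t -> (t%:E * mu [set x | (t < cabs (f x))%R] <= A)%E) ->
  (weakL1norm mu f <= A)%E.
Proof. by move=> H; apply: ge_ereal_sup => _ [t /= t0 <-]; apply: H. Qed.

Lemma weakL1norm_ge f t : 0 < t ->
  (t%:E * mu [set x | (t < cabs (f x))%R] <= weakL1norm mu f)%E.
Proof. by move=> t0; apply: ereal_sup_ubound; exists t. Qed.

Lemma weakL1norm_ge0 f : (0 <= weakL1norm mu f)%E.
Proof.
by apply: le_trans (weakL1norm_ge f ltr01); rewrite mule_ge0 // lee_fin.
Qed.

Lemma weakL1norm_dist f t (C : R) : 0 < t -> (weakL1norm mu f <= C%:E)%E ->
  (mu [set x | (t < cabs (f x))%R] <= (C / t)%:E)%E.
Proof.
move=> t0 fC; rewrite mulrC EFinM lee_pdivlMl //.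
exact: le_trans (weakL1norm_ge f t0) fC.
Qed.

(** What L^p and weak L^1 share: these properties of N make the space of its
    finite elements complete and its balls closed under almost everywhere
    convergence. *)
Definition fatou_quasinorm (N : (X -> R[i]) -> \bar R) : Prop :=
  [/\ (forall f, 0 <= N f)%E,
      (forall f g, cmeasurable f -> cmeasurable g ->
         {ae mu, forall x, (cabs (f x) <= cabs (g x))%R} -> N f <= N g)%E,
      forall (h : nat -> X -> R[i]) g (A : \bar R),
        (forall i, cmeasurable (h i)) -> cmeasurable g ->
        {ae mu, forall x, clim (h ^~ x) (g x)} ->
        (forall i, N (h i) <= A)%E -> (N g <= A)%E,
      forall e1 e2 : R, 0 < e1 -> 0 < e2 -> exists2 e3 : R, 0 < e3 &
        forall h, cmeasurable h -> (N h <= e3%:E)%E ->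
          (mu [set x | (e1 < cabs (h x))%R] <= e2%:E)%E &
      exists2 K : R, 0 < K & forall f g, cmeasurable f -> cmeasurable g ->
        (N (f \+ g)%R <= K%:E * (N f + N g))%E].

Lemma cLnorm_fatou_quasinorm p : 0 < p <= 1 -> fatou_quasinorm (cLnorm mu p).
Proof.
move=> /andP[p0 p1]; have mpow f : cmeasurable f ->
    measurable_fun setT (fun x => cabs (f x) `^ p).
  by move=> mf; apply: measurable_powRf; exact: cmeasurable_cabs.
split.
- exact: cLnorm_ge0.
- move=> f g mf mg fg; rewrite !cLnormE.
  case E : (rint mu setT (fun x => (cabs (g x) `^ p)%R)%R) => [r| |].
  + have r0 : 0 <= r by rewrite -lee_fin -E rint_cabs_ge0.
    rewrite poweR_EFin; apply/poweRV_le; rewrite ?rint_cabs_ge0 ?powR_ge0 //.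
    rewrite powRVK // -E; apply: ae_le_rint => //; try exact: mpow.
      by move=> x; rewrite powR_ge0.
      by move=> x; rewrite powR_ge0.
    by apply: filterS fg => x fgx _; rewrite ge0_ler_powR ?nnegrE // ltW.
  + by rewrite poweRyr ?leey // invr_eq0 gt_eqF.
  + by move: (rint_cabs_ge0 p g); rewrite E.
- move=> h g A mh mg hg hA.
  have A0 : (0 <= A)%E by exact: le_trans (cLnorm_ge0 p (h 0%N)) (hA 0%N).
  case: A A0 hA => [r| |] // r0 hA; last exact: leey.
  apply/cLnorm_le => //; apply: (@fatou_rint _ _ _ mu setT (fun i x => cabs (h i x) `^ p)) => //.
  + by move=> i; exact: mpow.
  + exact: mpow.
  + by move=> i x; rewrite powR_ge0.
  + by move=> x; rewrite powR_ge0.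
  + apply: filterS hg => x /clim_cabs hx.
    apply/cvgrPdist_le => e e0.
    (* the power is Hoelder continuous: |a^p - b^p| <= |a - b|^p *)
    have e1 : 0 < e `^ p^-1 by rewrite powR_gt0.
    have /cvgrPdist_le/(_ _ e1)[N _ HN] := hx.
    exists N => // i /= /HN /= hN.
    have key a b : 0 <= a -> 0 <= b -> `|a - b| <= e `^ p^-1 ->
        a `^ p <= b `^ p + e.
      move=> a0 b0 ab; rewrite -[e](powRVK p0) ?(ltW e0) //.
      apply: (@le_trans _ _ ((b + e `^ p^-1) `^ p)).
        rewrite ge0_ler_powR ?nnegrE ?addr_ge0 ?powR_ge0 //; first exact: ltW.
        by rewrite -lerBlDl (le_trans (ler_norm _)).
      by apply: powR_subadd; rewrite ?p0 ?powR_ge0.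
    rewrite ler_norml; apply/andP; split.
      by rewrite lerNl opprB lerBlDl key // distrC.
    by rewrite lerBlDl key.
  + by move=> i; apply/cLnorm_le.
- move=> e1 e2 e10 e20; pose e3 := (e2 * e1 `^ p) `^ p^-1.
  have e30 : 0 < e3 by rewrite powR_gt0 // mulr_gt0 // powR_gt0.
  exists e3 => // h mh /cLnorm_le -/(_ p0 (ltW e30)).
  rewrite powRVK ?mulr_ge0 ?powR_ge0 ?(ltW e20) // => hh.
  apply: le_trans (chebyshev_powR (cmeasurable_cabs mh) _ p0 e10 hh) _ => //.
  by rewrite mulfK // gt_eqF // powR_gt0.
- exists (2 `^ p^-1); first by rewrite powR_gt0.
  move=> f g mf mg.
  have [Nf|Nf] := eqVneq (cLnorm mu p f) +oo%E.
    rewrite Nf addye; last by rewrite gt_eqF // (lt_le_trans _ (cLnorm_ge0 p g)).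
    by rewrite gt0_muley ?leey // lte_fin powR_gt0.
  have [Ng|Ng] := eqVneq (cLnorm mu p g) +oo%E.
    rewrite Ng addey; last by rewrite gt_eqF // (lt_le_trans _ (cLnorm_ge0 p f)).
    by rewrite gt0_muley ?leey // lte_fin powR_gt0.
  move: Nf Ng (cLnorm_ge0 p f) (cLnorm_ge0 p g).
  case Ef : (cLnorm mu p f) => [a| |] // _; case Eg : (cLnorm mu p g) => [b| |] // _.
  rewrite !lee_fin => a0 b0.
  have /cLnorm_le -/(_ p0 a0) fa : (cLnorm mu p f <= a%:E)%E by rewrite Ef.
  have /cLnorm_le -/(_ p0 b0) gb : (cLnorm mu p g <= b%:E)%E by rewrite Eg.
  rewrite -EFinD -EFinM; apply/cLnorm_le; rewrite ?mulr_ge0 ?powR_ge0 ?addr_ge0 //.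
  apply: (@le_trans _ _
    (rint mu setT (fun x => cabs (f x) `^ p + cabs (g x) `^ p)%R)).
    apply: le_rint => //.
    + exact/mpow/cmeasurableD.
    + by apply: measurable_funD; exact: mpow.
    + by move=> x; rewrite powR_ge0.
    + move=> x _; apply: le_trans (powR_subadd _ _ _); rewrite ?p0 //.
      by rewrite ge0_ler_powR ?nnegrE ?addr_ge0 ?cabsD // ltW.
  rewrite rintD //; [|exact: mpow|exact: mpow|by move=> x; rewrite powR_ge0..].
  apply: (le_trans (leeD fa gb)); rewrite -EFinD lee_fin.
  rewrite powRM ?powR_ge0 ?addr_ge0 // powRVK // mulr_natl mulr2n.
  by apply: lerD; rewrite ge0_ler_powR ?nnegrE ?addr_ge0 ?(ltW p0) ?lerDl ?lerDr.
Qed.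

Lemma weakL1norm_fatou_quasinorm : fatou_quasinorm (weakL1norm mu).
Proof.
have mgt f t : cmeasurable f -> measurable [set x | t < cabs (f x)].
  by move=> mf; apply: measurable_gt; exact: cmeasurable_cabs.
split.
- exact: weakL1norm_ge0.
- move=> f g mf mg [Z [mZ Z0 ZP]]; apply: le_weakL1norm => t t0.
  apply: le_trans (weakL1norm_ge g t0); apply: lee_wpmul2l; first by rewrite lee_fin ltW.
  apply: (@le_trans _ _ (mu ([set x | t < cabs (g x)] `|` Z))).
    apply: le_measure; rewrite ?inE; [exact: mgt|by apply: measurableU => //; exact: mgt|].
    move=> x /= tf; have [fg|/ZP Zx] := pselect (cabs (f x) <= cabs (g x)).
      by left; exact: lt_le_trans fg.
    by right.
  by rewrite measureU0 //; exact: mgt.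
- move=> h g A mh mg [Z [mZ Z0 ZP]] hA; apply: le_weakL1norm => t t0.
  (* E n increases to a set containing almost every point where |g| > t *)
  pose E n := \bigcap_(i in [set i | (n <= i)%N]) [set x | t < cabs (h i x)].
  have mE n : measurable (E n) by apply: bigcap_measurable => [|i _]; [exists n => /= | exact: mgt].
  have ndE : nondecreasing_seq E.
    move=> m n mn; apply/subsetPset => x Ex i /= ni; apply: Ex.
    exact: leq_trans mn ni.
  have EA n : (t%:E * mu (E n) <= A)%E.
    apply: le_trans (hA n); apply: le_trans (weakL1norm_ge _ t0).
    apply: lee_wpmul2l; first by rewrite lee_fin ltW.
    apply: le_measure; rewrite ?inE //; first exact: mgt.
    by move=> x; apply => /=.
  have mUE : measurable (\bigcup_n E n) by exact: bigcupT_measurable.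
  have UEA : (t%:E * mu (\bigcup_n E n) <= A)%E.
    have c : (t%:E * (mu \o E) n)%E @[n --> \oo] --> (t%:E * mu (\bigcup_n E n))%E.
      by apply: cvgeZl => //; exact: nondecreasing_cvg_mu.
    rewrite -(cvg_lim _ c) //; apply: lime_le; first by apply/cvg_ex; eexists; exact: c.
    exact: nearW.
  apply: le_trans UEA; apply: lee_wpmul2l; first by rewrite lee_fin ltW.
  apply: (@le_trans _ _ (mu ((\bigcup_n E n) `|` Z))).
    apply: le_measure; rewrite ?inE; [exact: mgt|exact: measurableU|].
    move=> x /= tg; have [hg|/ZP Zx] := pselect (clim (h ^~ x) (g x)); last by right.
    left; have [|N HN] := hg ((cabs (g x) - t) / 2).
      by rewrite divr_gt0 // subr_gt0.
    exists N => // i /= /HN; have := cabs_triangle (h i x) (g x) 0.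
    rewrite !subr0 [cabs (g x - h i x)]cabs_distC; lra.
  by rewrite measureU0.
- move=> e1 e2 e10 e20; exists (e2 * e1); first exact: mulr_gt0.
  move=> h mh hh; apply: le_trans (weakL1norm_dist e10 hh) _.
  by rewrite mulfK ?gt_eqF.
- exists 2 => // f g mf mg; apply: le_weakL1norm => t t0.
  have t2 : 0 < t / 2 by rewrite divr_gt0.
  apply: (@le_trans _ _ (t%:E * (mu [set x | (t / 2 < cabs (f x))%R] +
      mu [set x | (t / 2 < cabs (g x))%R]))%E).
    apply: lee_wpmul2l; first by rewrite lee_fin ltW.
    apply: (le_trans _ (measureU2 _ _ _)); [|exact: mgt|exact: mgt].
    apply: le_measure; rewrite ?inE; [exact: (mgt _ t (cmeasurableD mf mg))|by apply: measurableU; exact: mgt|].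
    move=> x /= tfg; case: (ltP (t / 2) (cabs (f x))) => hf; first by left.
    right; rewrite /=; have := cabsD (f x) (g x); lra.
  have -> : (t%:E = 2%:E * (t / 2)%:E)%E by rewrite -EFinM; congr EFin; field.
  rewrite -muleA; apply: lee_wpmul2l; first by rewrite lee_fin.
  rewrite ge0_muleDr //.
  by apply: leeD; exact: weakL1norm_ge.
Qed.

(** The subsequence is chosen such that consecutive differences exceed 2^-i only
    on sets of summable measure; the Borel-Cantelli lemma applies. *)
Lemma cauchy_in_measure (h : nat -> X -> R[i]) :
  (forall k, cmeasurable (h k)) ->
  (forall e1 e2 : R, 0 < e1 -> 0 < e2 -> exists N, forall k l,
     (N <= k)%N -> (N <= l)%N ->
     (mu [set x | (e1 < cabs (h k x - h l x))%R] <= e2%:E)%E) ->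
  exists g (phi : nat -> nat), [/\ cmeasurable g, forall i, (i <= phi i)%N &
    {ae mu, forall x, clim (fun i => h (phi i) x) (g x)}].
Proof.
move=> mh ch; pose ep i : R := 1 / (2 ^ i.+1)%:R.
have ep0 i : 0 < ep i by rewrite divr_gt0 // ltr0n expn_gt0.
have /choice[N HN] i := ch (ep i) (ep i) (ep0 i) (ep0 i).
pose phi i := (\sum_(j < i.+1) N j + i)%N.
have phi_ge i j : (i <= j)%N -> (N i <= phi j)%N.
  move=> ij; rewrite /phi (bigD1 (Ordinal (ij : (i < j.+1)%N))) //=.
  by rewrite -addnA leq_addr.
pose F i := [set x | ep i < cabs (h (phi i) x - h (phi i.+1) x)].
have mF i : measurable (F i).
  by apply: measurable_gt; apply: cmeasurable_cabs; exact: cmeasurableB.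
have F0 : mu (lim_sup_set F) = 0%E.
  apply: lim_sup_set_cvg0 => //.
  apply: (@le_lt_trans _ _ (\sum_(i <oo) (ep i)%:E)%E).
    apply: lee_nneseries => [i _ //|i _]; apply: HN; exact: phi_ge.
  by apply: (le_lt_trans (epsilon_trick0 xpredT ler01)); rewrite ltry.
have [g mg Hg] := measurable_complex_limit (fun i => mh (phi i)).
exists g, phi; split => // [i|]; first by rewrite leq_addl.
exists (lim_sup_set F); split => //.
  by apply: bigcap_measurable => // k _; exact: bigcup_measurable.
move=> x /= hx; apply: contrapT => hn; apply: hx; apply: Hg.
have [n Hn] : exists n, forall i, (n <= i)%N ->
    cabs (h (phi i) x - h (phi i.+1) x) <= ep i.
  move: hn; rewrite /lim_sup_set -[~ _]/((~` _) x) setC_bigcap => -[n _ hn].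
  exists n => i ni; rewrite leNgt; apply/negP => bad; apply: hn.
  by exists i.
have ep_half i : ep i.+1 = ep i / 2.
  by rewrite /ep [in LHS]expnS natrM; field; rewrite pnatr_eq0 expn_eq0.
have tele k i : (n <= i)%N ->
    cabs (h (phi i) x - h (phi (i + k)%N) x) <= 2 * ep i - 2 * ep (i + k)%N.
  move=> ni; elim: k => [|k IH]; first by rewrite addn0 !subrr cabs0.
  apply: (le_trans (cabs_triangle (h (phi (i + k)%N) x) _ _)).
  have := Hn (i + k)%N (leq_trans ni (leq_addr _ _)).
  rewrite addnS ep_half; move: IH; lra.
move=> e e0.
have [m em] : exists m, ep m < e / 4.
  have [m em] := ex_pow2_gt (e / 4)^-1; exists m; rewrite /ep div1r.
  rewrite invf_plt ?posrE ?divr_gt0 // ?ltr0n ?expn_gt0 //.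
  by rewrite natrX (lt_le_trans em) // ler_eXn2l // ltr1n.
have bound i : (maxn n m <= i)%N -> cabs (h (phi (maxn n m)) x - h (phi i) x) <= e / 2.
  move=> mi; rewrite -(subnKC mi); apply: (le_trans (tele _ _ (leq_maxl _ _))).
  have ep_mono a b : (a <= b)%N -> ep b <= ep a.
    move=> ab; rewrite /ep !div1r lef_pV2 ?posrE ?ltr0n ?expn_gt0 //.
    by rewrite ler_nat leq_exp2l.
  have := ep_mono _ _ (leq_maxr n m); have := ep0 (maxn n m + (i - maxn n m))%N.
  by move: em; lra.
exists (maxn n m) => i j ni nj.
apply: (le_trans (cabs_triangle (h (phi (maxn n m)) x) _ _)).
by rewrite cabs_distC [e]splitr lerD // bound.
Qed.

End LpNorms.

(** * Balls, coverings and the doubling property *)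

Section Balls.
Context {d : measure_display} {R : realType} {X : borelMetricType d R}.
Implicit Types (x y z : X) (r s t : R).

Lemma mballE x r y : ball x r y = (mdist x y < r) :> Prop.
Proof. by rewrite ballEmdist. Qed.

Lemma ball_sub x y r s : mdist x y + r <= s -> ball y r `<=` ball x s.
Proof.
move=> xyr z; rewrite !mballE => yz; apply: lt_le_trans xyr.
by apply: le_lt_trans (metric_triangle _ y _) _; rewrite ltrD2l.
Qed.

Lemma ball_le x r s : r <= s -> ball x r `<=` ball x s.
Proof. by move=> rs; apply: ball_sub; rewrite mdistxx add0r. Qed.

Lemma openP (U : set X) :
  open U <-> forall x, U x -> exists2 e, 0 < e & ball x e `<=` U.
Proof.
rewrite openE; split=> oU x /oU; first by move=> /nbhs_ballP[e /= e0 eU]; exists e.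
by case=> e e0 eU; apply/nbhs_ballP; exists e.
Qed.

Lemma open_mball x r : open (ball x r).
Proof.
apply/openP => y; rewrite mballE => xy; exists (r - mdist x y); rewrite ?subr_gt0 //.
by apply: ball_sub; rewrite subrKC.
Qed.

Lemma open_measurableX (U : set X) : open U -> measurable U.
Proof. by move=> oU; rewrite borelE; exact: sub_gen_smallest. Qed.

Lemma measurable_mball x r : measurable (ball x r).
Proof. exact/open_measurableX/open_mball. Qed.

Lemma mball_center x r : 0 < r -> ball x r x.
Proof. exact: ballxx. Qed.

Lemma balls_meet x y r s z : ball x r z -> ball y s z -> mdist x y < r + s.
Proof.
rewrite !mballE => xz yz; apply: le_lt_trans (metric_triangle _ z _) _.
by rewrite (metric_sym z) ltrD.
Qed.

Lemma mball_cover x y r : 0 < r -> exists N : nat, ball x (2 ^+ N * r) y.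
Proof.
move=> r0; have [N HN] := ex_pow2_gt (mdist x y / r).
by exists N; rewrite mballE -ltr_pdivrMr.
Qed.

Definition disjointb (A B : set X) : bool := `[< A `&` B = set0 >].

(** The finite Vitali lemma: choosing balls greedily by decreasing radius, each
    ball of the family meets a chosen one of at least its radius. *)
Lemma vitali_finite (l : seq (X * R)) :
  (forall p, p \in l -> 0 < p.2) ->
  exists D : seq (X * R), [/\ {subset D <= l},
    pairwise (fun p q => disjointb (ball p.1 p.2) (ball q.1 q.2)) D &
    forall p, p \in l -> exists2 q, q \in D &
      ball p.1 p.2 `<=` ball q.1 (4 * q.2)].
Proof.
have [n] := ubnP (size l); elim: n l => // n IH l sl l0.
have [->|lnil] := eqVneq l [::]; first by exists [::]; split.
have [p pl pmax] : exists2 p, p \in l & forall q, q \in l -> q.2 <= p.2.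
  elim: l lnil {IH sl l0} => // a l IHl _.
  have [->|/IHl[p pl pmax]] := eqVneq l [::].
    by exists a; rewrite ?mem_head // => q; rewrite inE => /eqP ->.
  have [ap|pa] := leP a.2 p.2.
    exists p; first by rewrite inE pl orbT.
    by move=> q; rewrite inE => /orP[/eqP ->//|/pmax].
  exists a; first exact: mem_head.
  move=> q; rewrite inE => /orP[/eqP ->//|/pmax qp].
  exact: le_trans qp (ltW pa).
pose l' := [seq q <- l | disjointb (ball p.1 p.2) (ball q.1 q.2)].
have [|q|D [Dl Dd DP]] := IH l'.
- move: sl; rewrite ltnS; apply: leq_trans; apply: (@leq_ltn_trans (count (predC1 p) l)).
    rewrite size_filter; apply: sub_count => q /= /asboolP pq.
    apply/eqP => qp; move: pq; rewrite qp setIid => /seteqP[/(_ p.1) + _].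
    by apply; apply: mball_center; exact: l0.
  rewrite -(count_predC (predC1 p) l) -[X in (X < _)%N]addn0 ltn_add2l.
  by rewrite -has_count; apply/hasP; exists p => //=; rewrite eqxx.
- by rewrite mem_filter => /andP[_ /l0].
exists (p :: D); split.
- move=> q; rewrite inE => /orP[/eqP ->//|/Dl].
  by rewrite mem_filter => /andP[].
- rewrite /= Dd andbT; apply/allP => q /Dl.
  by rewrite mem_filter => /andP[].
- move=> q ql; have [pq|pq] := boolP (disjointb (ball p.1 p.2) (ball q.1 q.2)).
    have /DP[q' q'D qq'] : q \in l' by rewrite mem_filter pq.
    by exists q' => //; rewrite inE q'D orbT.
  exists p; first exact: mem_head.
  move/asboolP/eqP/set0P : pq => [z [pz qz]].
  have := balls_meet pz qz; have := pmax q ql => qp pqd.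
  by apply: ball_sub; move: (l0 _ pl); lra.
Qed.

Variable mu : {measure set X -> \bar R}.

Lemma sum_rint_disjoint (I : eqType) (l : seq I) (B : I -> set X) (w : X -> R)
  (U : set X) : measurable U -> (forall i, measurable (B i)) ->
  measurable_fun setT w -> (forall x, 0 <= w x) ->
  pairwise (fun i j => disjointb (B i) (B j)) l ->
  (forall i, i \in l -> B i `<=` U) ->
  (\sum_(i <- l) rint mu (B i) w <= rint mu U w)%E.
Proof.
move=> mU mB mw w0; elim: l U mU => [|i l IHl] U mU /=.
  by rewrite big_nil rint_ge0.
move=> /andP[/allP idis ldis] BU; rewrite big_cons.
apply: (@le_trans _ _ (rint mu (B i) w + rint mu (U `\` B i) w)%E).
  apply: leeD => //; apply: IHl => //; first exact: measurableD.
  move=> j jl y By; split; first by apply: BU By; rewrite inE jl orbT.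
  by move=> Biy; have /asboolP/seteqP[/(_ y) + _] := idis j jl; apply.
have BiU : B i `<=` U by exact/BU/mem_head.
rewrite -[in leRHS](setDUK BiU) /rint [leRHS]ge0_integral_setU ?setDUK //.
- exact: measurableD.
- exact: meas_EFin.
- by move=> x _; rewrite lee_fin.
- by apply/disj_set2P; rewrite setDE setIC -setIA setICl setI0.
Qed.

Lemma rint_bigcup_seq (I : eqType) (l : seq I) (B : I -> set X) (A : set X)
  (u : X -> R) : measurable A -> (forall i, measurable (B i)) ->
  measurable_fun setT u -> (forall x, 0 <= u x) ->
  (forall x, A x -> exists2 i, i \in l & B i x) ->
  (rint mu A u <= \sum_(i <- l) rint mu (B i) u)%E.
Proof.
move=> mA mB mfu u0; elim: l A mA => [|i l IHl] A mA AB.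
  rewrite big_nil (_ : A = set0); first by rewrite /rint integral_set0.
  by apply/seteqP; split=> // x /AB[].
rewrite big_cons -(setUIDK A (B i)).
apply: (le_trans (rint_setU _ _ _ _ _)) => //.
- exact: measurableI.
- exact: measurableD.
apply: leeD; first by apply: rint_subset => //; exact: measurableI.
apply: IHl; first exact: measurableD.
move=> x [Ax nBx]; have [j] := AB x Ax; rewrite inE => /orP[/eqP -> //|jl Bj].
by exists j.
Qed.

Lemma rint_bigcup_le (A : nat -> set X) (u : X -> R) (M : \bar R) :
  nondecreasing_seq A -> (forall i, measurable (A i)) ->
  measurable_fun setT u -> (forall x, 0 <= u x) ->
  (forall i, rint mu (A i) u <= M)%E -> (rint mu (\bigcup_i A i) u <= M)%E.
Proof.
move=> ndA mA mfu u0 AM.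
have c : rint mu (A i) u @[i --> \oo] --> rint mu (\bigcup_i A i) u.
  apply: ge0_nondecreasing_set_cvg_integral => //.
    by move=> i; exact: meas_EFin.
  by move=> i x _; rewrite lee_fin.
rewrite -(cvg_lim _ c) //; apply: lime_le; first by apply/cvg_ex; eexists; exact: c.
exact: nearW.
Qed.

Lemma rint_balls_le x r (u : X -> R) (M : \bar R) : 0 < r ->
  measurable_fun setT u -> (forall y, 0 <= u y) ->
  (forall N, rint mu (ball x (2 ^+ N * r)) u <= M)%E -> (rint mu setT u <= M)%E.
Proof.
move=> r0 mfu u0 H; rewrite (_ : setT = \bigcup_N ball x (2 ^+ N * r)).
  apply: rint_bigcup_le => // [m n mn|i]; last exact: measurable_mball.
  apply/subsetPset; apply: ball_le; rewrite ler_pM2r //.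
  by rewrite ler_weXn2l // ler1n.
apply/seteqP; split=> // y _; have [N HN] := mball_cover x y r0.
by exists N.
Qed.

End Balls.

Section Doubling.
Context {d : measure_display} {R : realType} {X : borelMetricType d R}.
Variable mu : {measure set X -> \bar R}.
Implicit Types (x y z : X) (r s t e : R).
Variable Cd : R.
Hypothesis Cd0 : 0 < Cd.
Hypothesis dbl : forall x r, 0 < r ->
  (mu (ball x (2 * r)) <= Cd%:E * mu (ball x r))%E /\ (mu (ball x r) < +oo)%E.

Lemma volE x r : 0 < r -> mu (ball x r) = (vol mu x r)%:E.
Proof.
move=> r0; rewrite /vol fineK // ge0_fin_numE //; by case: (dbl x r0).
Qed.

Lemma vol_ge0 x r : 0 <= vol mu x r.
Proof. by rewrite /vol fine_ge0. Qed.

Lemma vol_le x y r s : 0 < r -> 0 < s -> ball x r `<=` ball y s ->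
  vol mu x r <= vol mu y s.
Proof.
move=> r0 s0 xy; rewrite -lee_fin -!volE //.
by apply: le_measure; rewrite ?inE //; exact: measurable_mball.
Qed.

Lemma vol_double x r : 0 < r -> vol mu x (2 * r) <= Cd * vol mu x r.
Proof.
move=> r0; rewrite -lee_fin EFinM -!volE ?mulr_gt0 //.
by case: (dbl x r0).
Qed.

Lemma vol_pow2 x r k : 0 < r -> vol mu x (2 ^+ k * r) <= Cd ^+ k * vol mu x r.
Proof.
move=> r0; elim: k => [|k IH]; first by rewrite !expr0 !mul1r.
rewrite !exprS -!mulrA; apply: (le_trans (vol_double _ _)).
  by rewrite mulr_gt0 // exprn_gt0.
by rewrite ler_wpM2l // ltW.
Qed.

Lemma vol4 x r : 0 < r -> vol mu x (4 * r) <= Cd ^+ 2 * vol mu x r.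
Proof. by move=> r0; have := vol_pow2 x 2 r0; rewrite -natrX. Qed.

(** A null ball forces the doubled balls around its centre, hence the whole
    space, to be null. *)
Lemma vol_gt0_or_null :
  (forall x r, 0 < r -> 0 < vol mu x r) \/ mu setT = 0%E.
Proof.
have [H|/existsNP[x /existsNP[r /not_implyP[r0 /negP]]]] :=
  pselect (forall x r, 0 < r -> 0 < vol mu x r); first by left.
rewrite -leNgt => V0; right.
apply/eqP; rewrite -measure_le0 -[leLHS]mul1e -(rint_cst mu 1 measurableT).
apply: (rint_balls_le (x := x) r0) => // N.
rewrite rint_cst ?mul1e; last exact: measurable_mball.
rewrite volE ?mulr_gt0 ?exprn_gt0 // lee_fin.
apply: (le_trans (vol_pow2 x N r0)).
by rewrite (_ : vol mu x r = 0) ?mulr0 //; apply/eqP; rewrite eq_le V0 vol_ge0.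
Qed.

Hypothesis vpos : forall x r, 0 < r -> 0 < vol mu x r.

(** Balls are totally bounded: around the points of a separated set there are
    disjoint balls, whose measures doubling bounds from below. *)
Lemma finite_net x0 r e : 0 < r -> 0 < e ->
  exists l : seq X, forall y, ball x0 r y -> exists2 z, z \in l & mdist z y < e.
Proof.
move=> r0 e0.
pose sep (l : seq X) := (forall z, z \in l -> ball x0 r z) /\
  pairwise (fun a b => e <= mdist a b) l.
pose P n := `[< exists2 l, sep l & size l = n >].
have e2 : 0 < e / 2 by rewrite divr_gt0.
have [k Hk] : exists k : nat, 2 * r <= 2 ^+ k * (e / 2).
  have [k Hk] := ex_pow2_gt (2 * r / (e / 2)).
  by exists k; rewrite -ler_pdivrMr // ltW.
pose kap := vol mu x0 r / Cd ^+ k.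
have kap0 : 0 < kap by rewrite divr_gt0 ?vpos ?exprn_gt0.
have vz z : ball x0 r z -> kap <= vol mu z (e / 2).
  move=> x0z; rewrite ler_pdivrMr ?exprn_gt0 // mulrC.
  apply: le_trans (vol_pow2 _ _ e2); apply: vol_le; rewrite ?mulr_gt0 ?exprn_gt0 //.
  apply: ball_sub; rewrite metric_sym; move: x0z Hk; rewrite mballE; lra.
have P0 : exists n, P n by exists 0%N; apply/asboolP; exists [::].
have Pb n : P n -> (n <= Num.truncn (vol mu x0 (r + e) / kap))%N.
  move=> /asboolP[l [lb lsep] <-].
  have vle : (\sum_(z <- l) rint mu (ball z (e / 2)) (fun=> 1%R) <=
      rint mu (ball x0 (r + e)) (fun=> 1%R))%E.
    apply: (@sum_rint_disjoint _ _ _ mu _ l (fun z => ball z (e / 2))) => //.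
    - exact: measurable_mball.
    - by move=> z; exact: measurable_mball.
    - apply: sub_pairwise lsep => a b ab; apply/asboolP/seteqP; split=> // z [az bz].
      have := balls_meet az bz; rewrite -splitr; move: ab; lra.
    - move=> z /lb; rewrite mballE => x0z; apply: ball_sub; move: x0z e0; lra.
  rewrite truncn_ge_nat; last by rewrite divr_ge0 ?vol_ge0 // ltW.
  rewrite ler_pdivlMr //.
  rewrite -lee_fin -volE ?addr_gt0 // -[mu _]mul1e -rint_cst; last exact: measurable_mball.
  apply: le_trans vle; elim: l lb {lsep} => [|z l IHl] lb.
    by rewrite big_nil /= mul0r.
  rewrite big_cons /= mulrS mulrDl mul1r EFinD; apply: leeD.
    rewrite rint_cst ?mul1e; last exact: measurable_mball.
    by rewrite volE // lee_fin; apply/vz/lb/mem_head.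
  by apply: IHl => y yl; apply: lb; rewrite inE yl orbT.
have [n /asboolP[l [lb lsep] ln] nmax] := ex_maxnP P0 Pb.
exists l => y x0y; apply: contrapT => noz.
suff : (n.+1 <= n)%N by rewrite ltnn.
apply: nmax; apply/asboolP; exists (y :: l); last by rewrite /= ln.
split; first by move=> z; rewrite inE => /orP[/eqP ->//|/lb].
rewrite /= lsep andbT; apply/allP => z zl; rewrite leNgt; apply/negP => yz.
by apply: noz; exists z; rewrite // metric_sym.
Qed.

Lemma separable : exists sg : nat -> X, forall x e, 0 < e ->
  exists i, ball (sg i) e x.
Proof.
have /choice[l Hl] (k : nat) : exists l : seq X, forall y,
    ball (point : X) k.+1%:R y -> exists2 z, z \in l & mdist z y < k.+1%:R^-1.
  by apply: finite_net; rewrite ?invr_gt0.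
exists (fun n => if unpickle n is Some (k, i) then nth point (l k) i else point).
move=> x e e0; have [k1 xk1] := ex_inv_succ_lt e0.
pose k := maxn (Num.truncn (mdist point x)) k1.
have xk : mdist point x < k.+1%:R.
  apply: (@lt_le_trans _ _ (Num.truncn (mdist point x)).+1%:R).
    by case/andP: (truncn_itv (mdist_ge0 point x)).
  by rewrite ler_nat ltnS leq_maxl.
have ek : k.+1%:R^-1 < e.
  by apply: le_lt_trans xk1; rewrite lef_pV2 ?posrE // ler_nat ltnS leq_maxr.
have [|z zl zx] := Hl k x; first by rewrite mballE.
exists (pickle (k, index z (l k))); rewrite pickleK nth_index // mballE.
exact: lt_trans zx ek.
Qed.

(** Lindelof's theorem: one member of F is chosen for each of the countably many
    small balls around the points of a dense sequence that fit into one. *)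
Lemma lindelof_balls (F : set (X * R)) : F !=set0 ->
  exists G : nat -> X * R, (forall n, F (G n)) /\
    forall p z, F p -> ball p.1 p.2 z -> exists n, ball (G n).1 (G n).2 z.
Proof.
move=> [p0 Fp0]; have [sg Hsg] := separable.
have /choice[G HG] (n : nat) : exists q, F q /\ forall i k, unpickle n = Some (i, k) ->
    (exists2 p, F p & ball (sg i) k.+1%:R^-1 `<=` ball p.1 p.2) ->
    ball (sg i) k.+1%:R^-1 `<=` ball q.1 q.2.
  case E : (@unpickle (nat * nat)%type n) => [[i k]|]; last by exists p0.
  have [[p Fp sub]|H] := pselect (exists2 p, F p & ball (sg i) k.+1%:R^-1 `<=` ball p.1 p.2).
    by exists p; split => // i' k' [<- <-].
  by exists p0; split => // i' k' [<- <-].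
exists G; split=> [n|p z Fp]; first by case: (HG n).
rewrite mballE => pz; pose e := (p.2 - mdist p.1 z) / 2.
have e0 : 0 < e by rewrite divr_gt0 // subr_gt0.
have [k ek] := ex_inv_succ_lt e0.
have k0 : (0 : R) < k.+1%:R^-1 by rewrite invr_gt0.
have [i iz] := Hsg z _ k0; exists (pickle (i, k)).
have [_ /(_ i k (pickleK _))] := HG (pickle (i, k)); apply => //.
exists p => //; apply: ball_sub; have := metric_triangle p.1 z (sg i).
move: iz; rewrite mballE (metric_sym z) => iz.
have -> : p.2 = mdist p.1 z + 2 * e by rewrite /e; field.
move: {k0} k.+1%:R^-1 iz ek => del iz ek; lra.
Qed.

(** The Vitali covering argument, for integrals: finitely many balls almost
    exhaust E, a disjoint subfamily of these covers the same set once its balls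
    are enlarged 4 times, and over disjoint balls the integrals of w add up. *)
Lemma vitali_integral (E U : set X) (F : set (X * R)) (u w : X -> R) :
  measurable E -> measurable U ->
  measurable_fun setT u -> measurable_fun setT w ->
  (forall x, 0 <= u x) -> (forall x, 0 <= w x) ->
  (forall p, F p -> 0 < p.2) ->
  (forall x, E x -> exists2 p, F p & ball p.1 p.2 x) ->
  (forall p, F p -> ball p.1 p.2 `<=` U) ->
  (forall p, F p -> (rint mu (ball p.1 (4 * p.2)) u <= rint mu (ball p.1 p.2) w)%E) ->
  (rint mu E u <= rint mu U w)%E.
Proof.
move=> mE mU mfu mfw u0 w0 Fpos EF FU Fuw.
have [F0|nF] := pselect (F !=set0); last first.
  rewrite (_ : E = set0); first by rewrite /rint integral_set0 rint_ge0.
  by apply/seteqP; split=> // x /EF[p Fp _]; apply: nF; exists p.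
have [G [FG HG]] := lindelof_balls F0.
pose A N := E `&` \bigcup_(i in `I_N) ball (G i).1 (G i).2.
have mA N : measurable (A N).
  apply: measurableI => //; apply: bigcup_measurable => i _.
  exact: measurable_mball.
have ndA : nondecreasing_seq A.
  move=> m n mn; apply/subsetPset => x [Ex [i /= im Gx]]; split=> //.
  by exists i => //=; exact: leq_trans mn.
rewrite (_ : E = \bigcup_N A N); last first.
  apply/seteqP; split=> [x Ex|x [N _ []] //].
  have [p Fp px] := EF x Ex; have [n Gn] := HG p x Fp px.
  by exists n.+1 => //; split=> //; exists n => /=.
apply: rint_bigcup_le => // N.
pose l := [seq G i | i <- iota 0 N].
have Fl p : p \in l -> F p by move=> /mapP[i _ ->].
have [D [Dl Ddis DP]] := vitali_finite (fun p pl => Fpos _ (Fl p pl)).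
apply: (@le_trans _ _ (\sum_(q <- D) rint mu (ball q.1 (4 * q.2)) u)%E).
  apply: (@rint_bigcup_seq _ _ _ mu _ D (fun q : X * R => ball q.1 (4 * q.2))) => //.
    by move=> q; exact: measurable_mball.
  move=> x [_ [i /= iN Gx]].
  have /DP[q qD sub] : G i \in l by apply/map_f; rewrite mem_iota.
  by exists q => //; exact: sub.
apply: (@le_trans _ _ (\sum_(q <- D) rint mu (ball q.1 q.2) w)%E).
  by rewrite !big_seq; apply: lee_sum => q /Dl/Fl/Fuw.
apply: (@sum_rint_disjoint _ _ _ mu _ D (fun q : X * R => ball q.1 q.2)) => //.
- by move=> q; exact: measurable_mball.
- by move=> q /Dl/Fl/FU.
Qed.

Lemma measurable_neq0 (f : X -> R[i]) : cmeasurable f -> measurable [set y | f y != 0].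
Proof.
move=> mf; rewrite (_ : [set y | _] = [set y | 0 < cabs (f y)]).
  by apply: measurable_gt; exact: cmeasurable_cabs.
apply/seteqP; split=> y /=.
  move=> fy; rewrite lt_neqAle cabs_ge0 andbT eq_sym.
  by apply: contra fy => /eqP/cabs0_eq0 ->.
by apply: contraTneq => ->; rewrite cabs0 ltxx.
Qed.

(** By Lindelof's theorem the complement of the ball is covered by countably
    many balls on which f vanishes almost everywhere. *)
Lemma negligible_off_esupp (f : X -> R[i]) x r : cmeasurable f ->
  esupp mu f `<=` ball x r -> {ae mu, forall y, ~ ball x r y -> f y = 0}.
Proof.
move=> mf fx.
have mf0 := measurable_neq0 mf.
pose F := [set p : X * R | 0 < p.2 /\ mu (ball p.1 p.2 `&` [set y | f y != 0]) = 0%E].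
have HF y : ~ ball x r y -> exists2 p, F p & ball p.1 p.2 y.
  move=> ny; have /existsNP[e /not_implyP[e0 /negP]] : ~ esupp mu f y by move/fx.
  rewrite -leNgt measure_le0 => /eqP f0.
  by exists (y, e) => //; exact: mball_center.
have [F0|nF] := pselect (F !=set0); last first.
  by apply: aeW => y /HF[p Fp _]; exfalso; apply: nF; exists p.
have [G [FG HG]] := lindelof_balls F0.
have : {ae mu, forall y, forall n, ~ (ball (G n).1 (G n).2 y /\ f y != 0)}.
  apply: ae_foralln => n; exists (ball (G n).1 (G n).2 `&` [set y | f y != 0]).
  split; [|by case: (FG n)|by move=> y /= /contrapT].
  by apply: measurableI => //; exact: measurable_mball.
apply: filterS => y Hy /HF[p Fp py]; apply: contrapT => /eqP fy.
by have [n Gy] := HG p y Fp py; apply: (Hy n).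
Qed.

(** A ball far away from one carrying almost all of the measure would, when
    enlarged 4 times, contain the latter, against the doubling property. *)
Lemma finite_bounded : (mu setT < +oo)%E ->
  exists x r, 0 < r /\ forall y, ball x r y.
Proof.
move=> muT; pose x0 : X := point; pose S := fine (mu setT).
have SE : mu setT = S%:E by rewrite fineK // ge0_fin_numE.
have S0 : 0 < S.
  have := vpos x0 ltr01; rewrite -!lte_fin -SE -volE // => h.
  by apply: lt_le_trans h _; apply: le_measure; rewrite ?inE //; exact: measurable_mball.
have C20 : 0 < Cd ^+ 2 by rewrite exprn_gt0.
pose eta := S / (1 + Cd ^+ 2).
have eta0 : 0 < eta by rewrite divr_gt0 // addr_gt0.
have [N HN] : exists N : nat, S - eta < vol mu x0 (2 ^+ N * 1).
  apply: contrapT => /forallNP H.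
  have : (mu setT <= (S - eta)%:E)%E.
    rewrite -[leLHS]mul1e -(rint_cst mu 1 measurableT).
    apply: (rint_balls_le (x := x0) ltr01) => // N.
    rewrite rint_cst ?mul1e; last exact: measurable_mball.
    by rewrite volE ?mulr_gt0 ?exprn_gt0 // lee_fin leNgt; apply/negP.
  by rewrite SE lee_fin; move: eta0; lra.
set rho := 2 ^+ N * 1 in HN.
have rho0 : 0 < rho by rewrite mulr_gt0 // exprn_gt0.
exists x0, (2 * rho); split=> [|y]; first by rewrite mulr_gt0.
rewrite mballE ltNge; apply/negP => far; set D := mdist x0 y in far.
have D0 : 0 < D by move: rho0 far; lra.
have D2 : 0 < D / 2 by rewrite divr_gt0.
have le1 : vol mu y (D / 2) <= eta.
  have : (rint mu (ball x0 rho) (fun=> 1%R)%R + rint mu (ball y (D / 2)) (fun=> 1%R) <= mu setT)%E.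
    rewrite -[mu setT]mul1e -(rint_cst mu 1 measurableT).
    rewrite /rint -ge0_integral_setU //.
    - apply: rint_subset => //; apply: measurableU; exact: measurable_mball.
    - exact: measurable_mball.
    - exact: measurable_mball.
    - apply/disj_set2P/seteqP; split=> // z [xz yz].
      by have := balls_meet xz yz; rewrite -/D; move: far; lra.
  rewrite !rint_cst ?mul1e; try exact: measurable_mball.
  rewrite !volE // SE lee_fin; move: HN; lra.
have : vol mu x0 rho <= vol mu y (4 * (D / 2)).
  apply: vol_le; rewrite ?mulr_gt0 //; apply: ball_sub.
  by rewrite metric_sym -/D; move: far; lra.
have := vol4 y D2 => h4 hx.
have : S - eta < Cd ^+ 2 * eta.
  apply: lt_le_trans HN _; apply: le_trans hx _; apply: le_trans h4 _.
  by rewrite ler_pM2l.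
rewrite ltrBlDr -[X in _ < _ + X]mul1r -mulrDl addrC /eta mulrCA divff ?mulr1 ?ltxx //.
by rewrite gt_eqF // addr_gt0.
Qed.

End Doubling.

Section OuterRegularity.
Context {d : measure_display} {R : realType} {X : borelMetricType d R}.
Variable mu : {measure set X -> \bar R}.

(** The sets squeezed between a closed and an open set whose difference has small
    measure inside G form a sigma-algebra containing the open sets. *)
Lemma outer_regular (G A : set X) (e : R) : open G -> (mu G < +oo)%E ->
  measurable A -> A `<=` G -> 0 < e ->
  exists U, [/\ open U, A `<=` U & (mu U <= mu A + e%:E)%E].
Proof.
move=> oG muG mA AG e0; have mG := open_measurableX oG.
pose reg := [set A : set X | forall e : R, 0 < e -> exists F U, [/\ closed F, open U,
  F `<=` A, A `<=` U & (mu (G `&` (U `\` F)) <= e%:E)%E]].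
have mclosed (F : set X) : closed F -> measurable F.
  by move=> cF; rewrite -[F]setCK; apply: measurableC; apply: open_measurableX; exact: closed_openC.
have GUF U F : open U -> closed F -> measurable (G `&` (U `\` F)).
  move=> oU cF; apply: measurableI => //; apply: measurableD.
    exact: open_measurableX.
  exact: mclosed.
have regO : @open X `<=` reg.
  move=> U oU {}e {}e0.
  pose F n := [set x | ball x n.+1%:R^-1 `<=` U].
  have cF n : closed (F n).
    rewrite -[F n]setCK; apply: open_closedC; apply/openP => x /= /existsNP[y /not_implyP[xy Uy]].
    exists (n.+1%:R^-1 - mdist x y); first by rewrite subr_gt0 -mballE.
    move=> z; rewrite mballE => xz /= Fz; apply/Uy/Fz; rewrite mballE.
    apply: le_lt_trans (metric_triangle _ x _) _.
    by rewrite (metric_sym z) -ltrBrDr.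
  have FU n : F n `<=` U by move=> x; apply; apply: mball_center; rewrite invr_gt0.
  have c : mu (G `&` (U `\` F n)) @[n --> \oo] --> mu (\bigcap_n (G `&` (U `\` F n))).
    apply: nonincreasing_cvg_mu => //.
    - apply: le_lt_trans muG; apply: le_measure; rewrite ?inE //; exact: GUF.
    - by move=> n; exact: GUF.
    - by apply: bigcapT_measurable => n; exact: GUF.
    - move=> m n mn; apply/subsetPset => x [Gx [Ux nF]]; split=> //; split=> //.
      move=> Fm; apply: nF; apply: subset_trans Fm; apply: ball_le.
      by rewrite lef_pV2 ?posrE // ler_nat ltnS.
  have E0 : \bigcap_n (G `&` (U `\` F n)) = set0.
    apply/seteqP; split=> // x H; have [_ [Ux _]] := H 0%N I.
    have [del del0 xU] := (openP U).1 oU x Ux.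
    have [k kd] := ex_inv_succ_lt del0; have [_ [_]] := H k I.
    by apply; apply: subset_trans xU; apply: ball_le; exact: ltW.
  move: c; rewrite E0 measure0 => /fine_cvgP[fin /cvgrPdist_le/(_ e e0)[N _ HN]].
  case: fin => N' _ fin; exists (F (maxn N N')), U; split=> //.
  rewrite -[leLHS]fineK; last exact: fin (leq_maxr _ _).
  have := HN _ (leq_maxl N N'); rewrite sub0r normrN lee_fin.
  by apply: le_trans; exact: ler_norm.
have regS : sigma_algebra setT reg.
  split.
  - move=> {}e {}e0; exists set0, set0; split=> //; [exact: closed0|exact: open0|].
    by rewrite set0D setI0 measure0 lee_fin ltW.
  - move=> B HB {}e {}e0; have [F [U [cF oU FB BU le_e]]] := HB e e0.
    exists (~` U), (~` F); split; [exact: open_closedC|exact: closed_openC| | |].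
    + by move=> x Ux; split=> // /BU.
    + by move=> x [_ Bx] /FB.
    + by rewrite (_ : ~` F `\` ~` U = U `\` F) // setDE setCK setIC -setDE.
  - move=> B HB {}e {}e0.
    have ei n : 0 < e / 2 / (2 ^ n.+1)%:R by rewrite !divr_gt0 // ltr0n expn_gt0.
    have /choice[F HF] n := HB n _ (ei n).
    have {HF}/choice[U HU] := HF.
    have cF n : closed (F n) by case: (HU n).
    have oU n : open (U n) by case: (HU n).
    have oUU : open (\bigcup_n U n) by apply: bigcup_open.
    pose FN N := \bigcup_(i in `I_N) F i.
    have cFN N : closed (FN N) by apply: closed_bigcup => //; exact: finite_II.
    have c : mu (G `&` ((\bigcup_n U n) `\` FN N)) @[N --> \oo] -->
        mu (\bigcap_N (G `&` ((\bigcup_n U n) `\` FN N))).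
      apply: nonincreasing_cvg_mu => //.
      + apply: le_lt_trans muG; apply: le_measure; rewrite ?inE //; exact: GUF.
      + by move=> n; exact: GUF.
      + by apply: bigcapT_measurable => n; exact: GUF.
      + move=> m n mn; apply/subsetPset => x [Gx [Ux nF]]; split=> //; split=> //.
        by move=> [i /= im Fi]; apply: nF; exists i => //=; exact: leq_trans mn.
    have lim_le : (mu (\bigcap_N (G `&` ((\bigcup_n U n) `\` FN N))) <= (e / 2)%:E)%E.
      apply: (@le_trans _ _ (\sum_(n <oo) mu (G `&` (U n `\` F n)))%E).
        apply: measure_sigma_subadditive.
        - by move=> n; exact: GUF.
        - by apply: bigcapT_measurable => n; exact: GUF.
        - move=> x H; have [Gx [[n _ Un] _]] := H 0%N I.
          exists n => //; split=> //; split=> // Fn.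
          by have [_ [_ []]] := H n.+1 I; exists n => /=.
      apply: le_trans (epsilon_trick0 xpredT (ltW (divr_gt0 e0 (ltr0Sn _ 1)))).
      by apply: lee_nneseries => // n _; case: (HU n).
    have e2 : 0 < e / 2 by rewrite divr_gt0.
    have [N HN] : exists N, (mu (G `&` ((\bigcup_n U n) `\` FN N)) <= e%:E)%E.
      apply: contrapT => /forallNP H.
      have : (e%:E <= mu (\bigcap_N (G `&` ((\bigcup_n U n) `\` FN N))))%E.
        rewrite -(cvg_lim _ c) //; apply: lime_ge; first by apply/cvg_ex; eexists; exact: c.
        by apply: nearW => n; apply/ltW; rewrite ltNge; apply/negP/H.
      by move=> /le_trans/(_ lim_le); rewrite lee_fin; move: e0; lra.
    exists (FN N), (\bigcup_n U n); split=> //.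
    + by move=> x [i _ Fi]; exists i => //; case: (HU i) => _ _ + _ _; apply.
    + by move=> x [i _ Bi]; exists i => //; case: (HU i) => _ _ _ + _; apply.
have sub := smallest_sub regS regO.
have regA : reg A by apply: sub; rewrite -borelE.
have [F [U [cF oU FA AU le_e]]] := regA e e0.
exists (U `&` G); split; [exact: openI|by move=> x Ax; split; [exact: AU|exact: AG]|].
apply: (@le_trans _ _ (mu (A `|` (G `&` (U `\` F))))).
  apply: le_measure; rewrite ?inE.
  - exact: open_measurableX (openI oU oG).
  - by apply: measurableU => //; exact: GUF.
  - move=> x [Ux Gx]; have [Ax|nAx] := pselect (A x); [by left|right].
    by split=> //; split=> // /FA.
apply: (le_trans (measureU2 mu mA (GUF _ _ oU cF))).
by rewrite leeD2l.
Qed.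

End OuterRegularity.

(** * The John-Nirenberg inequality in L^2 *)

Section Clamp.
Context {R : realType}.

(** Truncation of complex numbers; being 1-Lipschitz, it does not increase
    mean oscillations. *)
Definition clampR (k t : R) : R := Num.max (- k) (Num.min k t).
Definition clampC (k : R) (z : R[i]) : R[i] :=
  clampR k (complex.Re z) +i* clampR k (complex.Im z).

Lemma max_lip (a s t : R) : `|Num.max a s - Num.max a t| <= `|s - t|.
Proof.
have h1 := ler_norm (s - t); have h2 := ler_norm (t - s).
rewrite distrC in h2; have h3 := normr_ge0 (s - t).
by rewrite ler_norml; case: (leP a s) => ha; case: (leP a t) => hb;
  apply/andP; split; lra.
Qed.

Lemma min_lip (a s t : R) : `|Num.min a s - Num.min a t| <= `|s - t|.
Proof.
have h1 := ler_norm (s - t); have h2 := ler_norm (t - s).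
rewrite distrC in h2; have h3 := normr_ge0 (s - t).
by rewrite ler_norml; case: (leP a s) => ha; case: (leP a t) => hb;
  apply/andP; split; lra.
Qed.

Lemma clampR_lip k s t : `|clampR k s - clampR k t| <= `|s - t|.
Proof. exact: le_trans (max_lip _ _ _) (min_lip _ _ _). Qed.

Lemma clampR_id k t : `|t| <= k -> clampR k t = t.
Proof.
rewrite ler_norml => /andP[kt tk].
by rewrite /clampR (min_idPr tk) (max_idPr kt).
Qed.

Lemma clampR_bound k t : 0 <= k -> `|clampR k t| <= k.
Proof.
move=> k0; rewrite /clampR ler_norml le_max lexx /= ge_max ge_min lexx andbT.
by rewrite ge0_cp.
Qed.

Lemma clampC_lip k z w : cabs (clampC k z - clampC k w) <= cabs (z - w).
Proof.
rewrite -ler_sqr ?nnegrE // !cabs_sqr !ReB !ImB /=.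
have sq (a b : R) : `|a| <= `|b| -> a ^+ 2 <= b ^+ 2.
  move=> ab; rewrite -(real_normK (num_real a)) -(real_normK (num_real b)).
  by rewrite ler_sqr ?nnegrE.
by apply: lerD; apply: sq; exact: clampR_lip.
Qed.

Lemma clampC_id k z : cabs z <= k -> clampC k z = z.
Proof.
move=> zk; rewrite /clampC !clampR_id; first by case: z {zk}.
  exact: le_trans (le_Im_cabs _) zk.
exact: le_trans (le_Re_cabs _) zk.
Qed.

Lemma clampC_bound k z : 0 <= k -> cabs (clampC k z) <= 2 * k.
Proof.
move=> k0; apply: le_trans (cabs_le_ReIm _) _ => /=.
by rewrite mulr_natl mulr2n lerD // clampR_bound.
Qed.

End Clamp.

Lemma cmeasurable_clamp {d : measure_display} {R : realType}
    {X : borelMetricType d R} (k : R) (g : X -> R[i]) :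
  cmeasurable g -> cmeasurable (fun x => clampC k (g x)).
Proof.
by move=> [mr mi]; split; apply: measurable_maxr; try exact: measurable_cst;
  apply: measurable_minr => //; exact: measurable_cst.
Qed.

Section JohnNirenberg.
Context {d : measure_display} {R : realType} {X : borelMetricType d R}.
Variable mu : {measure set X -> \bar R}.
Implicit Types (x y z : X) (r s t e : R).
Variable Cd : R.
Hypothesis Cd0 : 0 < Cd.
Hypothesis dbl : forall x r, 0 < r ->
  (mu (ball x (2 * r)) <= Cd%:E * mu (ball x r))%E /\ (mu (ball x r) < +oo)%E.
Hypothesis vpos : forall x r, 0 < r -> 0 < vol mu x r.
Local Notation V := (vol mu).

Lemma mdev (g : X -> R[i]) (c : R[i]) : cmeasurable g ->
  measurable_fun setT (fun y => cabs (g y - c)).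
Proof. by move=> mg; apply: cmeasurable_cabs; exact: cmeasurableB (cmeasurable_cst c). Qed.

(** The self-improving step: from a bound Q on the square mean oscillation over
    all balls one gets the bound Q / 2 + A, where A depends on M and on the
    doubling constant only.  On a given ball B, the oscillation h
    is bounded off the union Omega of the balls where the mean of h is large;
    Omega is covered by enlargements of balls with small total measure, on each
    of which Q bounds the square oscillation. *)
Section Step.
Variables (g : X -> R[i]) (c : X -> R -> R[i]) (M Q : R).
Hypothesis mg : cmeasurable g.
Hypothesis M0 : 0 < M.
Hypothesis Q0 : 0 <= Q.
Hypothesis osc1 : forall x r, 0 < r ->
  (rint mu (ball x r) (fun y => cabs (g y - c x r))%R <= (M * V x r)%:E)%E.
Hypothesis osc2 : forall x r, 0 < r ->
  (rint mu (ball x r) (fun y => cabs (g y - c x r) ^+ 2)%R <= (Q * V x r)%:E)%E.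

Lemma mean_dist x r (z : R[i]) (K : R) : 0 < r ->
  (rint mu (ball x r) (fun y => cabs (g y - z))%R <= (K * V x r)%:E)%E ->
  cabs (c x r - z) <= M + K.
Proof.
move=> r0 H; rewrite -(ler_pM2r (vpos x r0)) -lee_fin.
have mB := measurable_mball x r.
rewrite [leLHS]EFinM -(volE dbl) // -rint_cst // mulrDl EFinD.
apply: le_trans (leeD (osc1 x r0) H); rewrite -rintD //; try exact: mdev.
apply: le_rint => //; first by apply: measurable_funD; exact: mdev.
by move=> y _; rewrite [cabs (g y - c x r)]cabs_distC; exact: cabs_triangle.
Qed.

Variables (x0 : X) (r0 : R).
Hypothesis r00 : 0 < r0.
Let h y := cabs (g y - c x0 r0).
Let alpha := (2 + Cd ^+ 2) * Cd ^+ 2.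
Let Lam := 4 * Cd ^+ 2 * alpha + alpha * Cd ^+ 3 + (2 + Cd).
(* lam is the height of the stopping time, Lam large enough for the halving of Q *)
Let lam := Lam * M.

Let mh : measurable_fun setT h. Proof. exact: mdev. Qed.
Let h0 y : 0 <= h y. Proof. exact: cabs_ge0. Qed.
Let mh2 : measurable_fun setT (fun y => h y ^+ 2). Proof. exact: measurable_funX. Qed.
Let h20 y : 0 <= h y ^+ 2. Proof. exact: sqr_ge0. Qed.
Let C2 : 0 < Cd ^+ 2. Proof. exact: exprn_gt0. Qed.
Let alpha0 : 0 < alpha. Proof. by rewrite mulr_gt0 // addr_gt0. Qed.
Let Ma0 : 0 < M * alpha. Proof. exact: mulr_gt0. Qed.
Let t1 : 0 < 4 * Cd ^+ 2 * alpha. Proof. by apply: mulr_gt0 => //; apply: mulr_gt0. Qed.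
Let t2 : 0 < alpha * Cd ^+ 3. Proof. by rewrite mulr_gt0 // exprn_gt0. Qed.
Let Lam0 : 0 < Lam. Proof. by apply: addr_gt0; apply: addr_gt0. Qed.
Let lam0 : 0 < lam. Proof. by rewrite mulr_gt0. Qed.

Lemma big_ball_osc :
  (rint mu (ball x0 (4 * r0)) h <= (M * alpha * V x0 r0)%:E)%E.
Proof.
have r40 : 0 < 4 * r0 by rewrite mulr_gt0.
have dc : cabs (c x0 r0 - c x0 (4 * r0)) <= M + M * Cd ^+ 2.
  apply: mean_dist => //; apply: (@le_trans _ _ (rint mu (ball x0 (4 * r0))
      (fun y => cabs (g y - c x0 (4 * r0)))%R)).
    apply: rint_subset; try exact: measurable_mball; try exact: mdev; first by [].
    by apply: ball_le; move: r00; lra.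
  apply: (le_trans (osc1 x0 r40)); rewrite lee_fin -mulrA ler_pM2l //.
  exact: (vol4 Cd0 dbl).
apply: (@le_trans _ _ (rint mu (ball x0 (4 * r0))
   (fun y => cabs (g y - c x0 (4 * r0)) + (M + M * Cd ^+ 2))%R)).
  apply: le_rint => //; first exact: measurable_mball.
    by apply: measurable_funD; [exact: mdev|exact: measurable_cst].
  move=> y _; apply: (le_trans (cabs_triangle (c x0 (4 * r0)) _ _)).
  by rewrite lerD2l cabs_distC.
have cc0 : 0 <= M + M * Cd ^+ 2 by rewrite addr_ge0 // ?mulr_ge0 // ltW.
rewrite rintD //; [|exact: measurable_mball|exact: mdev].
rewrite rint_cst; last exact: measurable_mball.
rewrite (volE dbl) //; apply: (le_trans (leeD (osc1 x0 r40) (lexx _))).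
rewrite -EFinM -EFinD lee_fin -mulrDl /alpha.
have -> : M * ((2 + Cd ^+ 2) * Cd ^+ 2) * V x0 r0 =
  (M + (M + M * Cd ^+ 2)) * (Cd ^+ 2 * V x0 r0) by ring.
rewrite ler_pM2l; first exact: (vol4 Cd0 dbl).
by rewrite ltr_pwDl.
Qed.

(** A ball is bad when the mean of h over it exceeds the height lam. *)
Let bad y s := [/\ 0 < s, s <= r0, exists2 z, ball x0 r0 z & ball y s z &
  ((lam * V y s)%:E < rint mu (ball y s) h)%E].

Let bad_sub y s : bad y s -> ball y s `<=` ball x0 (4 * r0).
Proof.
move=> [s0 sr [z xz yz] _]; apply: ball_sub.
by have := balls_meet xz yz; move: r00; lra.
Qed.

Let bad_small y s : bad y s -> s <= r0 / 2.
Proof.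
move=> yb; have [s0 sr [z xz yz] hb] := yb; rewrite leNgt; apply/negP => rs.
move: hb; apply/negP; rewrite -leNgt.
apply: (@le_trans _ _ (rint mu (ball x0 (4 * r0)) h)).
  by apply: rint_subset; rewrite //; try exact: measurable_mball; exact: bad_sub.
apply: (le_trans big_ball_osc); rewrite lee_fin /lam.
apply: (@le_trans _ _ (M * alpha * (Cd ^+ 3 * V y s))).
  rewrite (ler_pM2l Ma0); apply: le_trans (vol_pow2 Cd0 dbl y 3 s0).
  apply: (vol_le dbl); rewrite ?mulr_gt0 ?exprn_gt0 //; apply: ball_sub.
  have := balls_meet xz yz; rewrite metric_sym -natrX.
  by move: r00 rs; rewrite (_ : (2 ^ 3)%N = 8%N) //; lra.
have -> : M * alpha * (Cd ^+ 3 * V y s) = (alpha * Cd ^+ 3) * M * V y s by ring.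
rewrite ler_pM2r ?vpos // ler_pM2r //.
by rewrite /Lam; move: t1 t2 Cd0; lra.
Qed.

Let Omega := [set x | exists y s, bad y s /\ ball y s x].

Let openOmega : open Omega.
Proof.
apply/openP => x [y [s [yb yx]]]; have [e e0 sub] := (openP _).1 (open_mball y s) x yx.
by exists e => // z /sub yz; exists y, s.
Qed.

(** Doubling a bad ball until it stops being bad. *)
Let stopping x : Omega x ->
  exists y s, [/\ bad y s, ~ bad y (2 * s) & ball y s x].
Proof.
move=> [y [s [yb yx]]]; have [s0 _ _ _] := yb.
have sk (k : nat) : s <= 2 ^+ k * s by rewrite ler_peMl ?(ltW s0) // exprn_ege1 // ler1n.
apply: contrapT => H.
have allbad (k : nat) : bad y (2 ^+ k * s).
  elim: k => [|k IH]; first by rewrite expr0 mul1r.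
  apply: contrapT => nb; apply: H; exists y, (2 ^+ k * s); split=> //.
    by move: nb; rewrite exprS mulrA.
  exact: ball_le yx.
have [k Hk] := ex_pow2_gt (r0 / s).
by have [_ + _ _] := allbad k; rewrite leNgt -ltr_pdivrMr // Hk.
Qed.

(** On a maximal bad ball the mean of h is comparable to lam, so that lam times
    its measure, and with it the square integral over the enlarged ball, is
    dominated by the integral of h. *)
Let stopping_osc y s : bad y s -> ~ bad y (2 * s) ->
  (rint mu (ball y (4 * s)) (fun y => h y ^+ 2)%R <=
   rint mu (ball y s) (fun y => (2 * Q + 8 * lam ^+ 2) * Cd ^+ 2 / lam * h y)%R)%E.
Proof.
move=> yb nb2; have [s0 sr [z xz yz] hb] := yb.
have s20 : 0 < 2 * s by rewrite mulr_gt0.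
have s40 : 0 < 4 * s by rewrite mulr_gt0.
have h2s : (rint mu (ball y (2 * s)) h <= (lam * V y (2 * s))%:E)%E.
  rewrite leNgt; apply/negP => h2; apply: nb2; split=> //.
    by have := bad_small yb; lra.
  by exists z => //; apply: ball_le yz; lra.
have d1 : cabs (c y (2 * s) - c x0 r0) <= M + lam by exact: mean_dist.
have d2 : cabs (c y (2 * s) - c y (4 * s)) <= M + M * Cd.
  apply: mean_dist => //; apply: (@le_trans _ _ (rint mu (ball y (4 * s))
      (fun z => cabs (g z - c y (4 * s)))%R)).
    apply: rint_subset; try exact: measurable_mball; try exact: mdev; first by [].
    by apply: ball_le; lra.
  apply: (le_trans (osc1 y s40)); rewrite lee_fin -mulrA ler_pM2l //.
  have := vol_double dbl y s20; congr (_ <= _); congr (V _ _); lra.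
have d3 : cabs (c y (4 * s) - c x0 r0) <= 2 * lam.
  apply: (le_trans (cabs_triangle (c y (2 * s)) _ _)).
  rewrite cabs_distC; have : M * (2 + Cd) <= lam.
    rewrite mulrC /lam ler_pM2r // /Lam; move: t1 t2; lra.
  by move: d1 d2; lra.
apply: (@le_trans _ _ (rint mu (ball y (4 * s))
    (fun w => 2 * cabs (g w - c y (4 * s)) ^+ 2 + 8 * lam ^+ 2)%R)).
  have m2 : measurable_fun setT (fun w => cabs (g w - c y (4 * s)) ^+ 2).
    by apply: measurable_funX; exact: mdev.
  apply: le_rint => //; first exact: measurable_mball.
    apply: measurable_funD; last exact: measurable_cst.
    by apply: measurable_funM => //; exact: measurable_cst.
  move=> w _; have hw : h w <= cabs (g w - c y (4 * s)) + 2 * lam.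
    by apply: (le_trans (cabs_triangle (c y (4 * s)) _ _)); rewrite lerD2l.
  apply: (@le_trans _ _ ((cabs (g w - c y (4 * s)) + 2 * lam) ^+ 2)).
    by rewrite ler_sqr ?nnegrE // addr_ge0 // mulr_ge0 // ltW.
  have := sqr_ge0 (cabs (g w - c y (4 * s)) - 2 * lam).
  rewrite sqrrB sqrrD !exprMn; lra.
have m2 : measurable_fun setT (fun w => cabs (g w - c y (4 * s)) ^+ 2).
  by apply: measurable_funX; exact: mdev.
have n2 w : 0 <= cabs (g w - c y (4 * s)) ^+ 2 by exact: sqr_ge0.
have l8 : 0 <= 8 * lam ^+ 2 by rewrite mulr_ge0 // sqr_ge0.
have mB4 := measurable_mball y (4 * s).
rewrite rintD //; [|by apply: measurable_funM => //; exact: measurable_cst|by move=> w; rewrite mulr_ge0].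
rewrite rintZ // rint_cst // (volE dbl) // rintZ //; last first.
- by rewrite !mulr_ge0 ?invr_ge0 ?addr_ge0 ?mulr_ge0 // ltW.
- exact: measurable_mball.
apply: (@le_trans _ _ (2%:E * (Q * V y (4 * s))%:E + (8 * lam ^+ 2)%:E * (V y (4 * s))%:E)%E).
  by apply: leeD => //; apply: lee_wpmul2l; rewrite ?lee_fin //; exact: osc2.
apply: (@le_trans _ _ (((2 * Q + 8 * lam ^+ 2) * Cd ^+ 2 / lam)%:E * (lam * V y s)%:E)%E).
  rewrite -!EFinM -EFinD lee_fin.
  have -> : (2 * Q + 8 * lam ^+ 2) * Cd ^+ 2 / lam * (lam * V y s) =
     (2 * Q + 8 * lam ^+ 2) * (Cd ^+ 2 * V y s) by field; rewrite gt_eqF.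
  rewrite [leLHS](_ : _ = (2 * Q + 8 * lam ^+ 2) * V y (4 * s)); last by ring.
  apply: ler_wpM2l; last exact: (vol4 Cd0 dbl).
  by apply: addr_ge0 => //; exact: mulr_ge0.
apply: lee_wpmul2l; last exact: ltW.
by rewrite lee_fin !mulr_ge0 ?invr_ge0 ?addr_ge0 ?mulr_ge0 // ltW.
Qed.

Let mOmega : measurable Omega. Proof. exact: open_measurableX. Qed.

(** The maximal bad balls cover Omega, and disjoint ones among them carry at
    most the integral of h over 4 B, a multiple of M times the measure of B. *)
Let on_Omega :
  (rint mu (ball x0 r0 `&` Omega) (fun y => h y ^+ 2)%R <=
   ((Q / 2 + 2 * lam ^+ 2) * V x0 r0)%:E)%E.
Proof.
pose kap := (2 * Q + 8 * lam ^+ 2) * Cd ^+ 2 / lam.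
have kap0 : 0 <= kap.
  by rewrite !mulr_ge0 ?invr_ge0 ?addr_ge0 ?mulr_ge0 ?sqr_ge0 // ltW.
apply: (@le_trans _ _ (rint mu (ball x0 (4 * r0)) (fun y => kap * h y)%R)).
  apply: (@vitali_integral _ _ _ mu Cd Cd0 dbl vpos _ _
    [set p | bad p.1 p.2 /\ ~ bad p.1 (2 * p.2)]) => //.
  - by apply: measurableI => //; exact: measurable_mball.
  - exact: measurable_mball.
  - by apply: measurable_funM => //; exact: measurable_cst.
  - by move=> x; rewrite mulr_ge0.
  - by move=> p [[]].
  - by move=> x [_ /stopping[y [s [yb nb yx]]]]; exists (y, s).
  - by move=> p [/bad_sub].
  - by move=> p [pb nb]; exact: stopping_osc.
rewrite rintZ //; last exact: measurable_mball.
apply: (@le_trans _ _ (kap%:E * (M * alpha * V x0 r0)%:E)%E).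
  by apply: lee_wpmul2l; rewrite ?lee_fin //; exact: big_ball_osc.
rewrite -EFinM lee_fin mulrA ler_pM2r ?vpos //.
(* lam is large enough for the oscillation Q of the small balls to be absorbed *)
have -> : kap * (M * alpha) = (Q / 2 + 2 * lam ^+ 2) * ((4 * Cd ^+ 2 * alpha) / Lam).
  rewrite /kap /lam; field; rewrite !gt_eqF //.
apply: ler_piMr.
  by rewrite addr_ge0 ?divr_ge0 // mulr_ge0 // sqr_ge0.
by rewrite ler_pdivrMr // mul1r /Lam; move: t2 Cd0; lra.
Qed.

(** Off Omega all small means of h are at most lam; a weak form of Lebesgue's
    differentiation theorem, with a loss of a constant, bounds h itself. *)
Let off_Omega : mu ((ball x0 r0 `\` Omega) `&` [set y | 3 * Cd ^+ 2 * lam < h y]) = 0%E.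
Proof.
set A := _ `&` _; have mA : measurable A.
  apply: measurableI; last exact: measurable_gt.
  by apply: measurableD => //; exact: measurable_mball.
have A4 : A `<=` ball x0 (4 * r0).
  by move=> x [[xB _] _]; apply: ball_le xB; move: r00; lra.
have mB4 : (mu (ball x0 (4 * r0)) < +oo)%E by case: (dbl x0 (mulr_gt0 (ltr0Sn _ 3) r00)).
have muA : (mu A < +oo)%E.
  by apply: le_lt_trans mB4; apply: le_measure; rewrite ?inE //; exact: measurable_mball.
apply/eqP; rewrite -measure_le0 leNgt; apply/negP => A0.
pose a := fine (mu A); have aE : mu A = a%:E by rewrite fineK // ge0_fin_numE.
have a0 : 0 < a by rewrite -lte_fin -aE.
have [U [oU AU muU]] := outer_regular (open_mball x0 (4 * r0)) mB4 mA A4 a0.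
have mU := open_measurableX oU.
have ub : (rint mu A h <= rint mu U (fun=> lam * Cd ^+ 2)%R)%E.
  apply: (@vitali_integral _ _ _ mu Cd Cd0 dbl vpos _ _
    [set p | [/\ A p.1, 0 < p.2, 4 * p.2 <= r0 & ball p.1 p.2 `<=` U]]) => //.
  - by move=> _; rewrite mulr_ge0 // ltW.
  - by move=> p [].
  - move=> x Ax; have [e e0 eU] := (openP U).1 oU x (AU x Ax).
    have s0 : 0 < Num.min e (r0 / 4) by rewrite lt_min e0 divr_gt0.
    exists (x, Num.min e (r0 / 4)); last exact: mball_center.
    split=> //=; first by rewrite mulrC -ler_pdivlMr // ge_min lexx orbT.
    by apply: subset_trans eU; apply: ball_le; rewrite ge_min lexx.
  - by move=> p [].
  - move=> [x s] [/= Ax s0 sr sU]; rewrite rint_cst; last exact: measurable_mball.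
    have s40 : 0 < 4 * s by rewrite mulr_gt0.
    apply: (@le_trans _ _ (lam * V x (4 * s))%:E).
      rewrite leNgt; apply/negP => hx; case: Ax => -[xB nO] _; apply: nO.
      exists x, (4 * s); split; last exact: mball_center.
      by split=> //; exists x => //; exact: mball_center.
    rewrite (volE dbl) // -EFinM lee_fin -(mulrA lam) (ler_pM2l lam0).
    exact: (vol4 Cd0 dbl).
have lb : ((3 * Cd ^+ 2 * lam)%:E * mu A <= rint mu A h)%E.
  rewrite -rint_cst //; apply: le_rint => //.
    by move=> _; rewrite !mulr_ge0 // ltW.
  by move=> x [_ /ltW].
move: (le_trans lb ub); rewrite rint_cst // => H.
have : ((3 * Cd ^+ 2 * lam)%:E * mu A <= (lam * Cd ^+ 2)%:E * (mu A + a%:E))%E.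
  apply: (le_trans H); apply: lee_wpmul2l => //.
  by rewrite lee_fin mulr_ge0 // ltW.
rewrite aE -EFinD -!EFinM lee_fin.
have -> : lam * Cd ^+ 2 * (a + a) = (Cd ^+ 2 * lam * a) * 2 by ring.
have -> : 3 * Cd ^+ 2 * lam * a = (Cd ^+ 2 * lam * a) * 3 by ring.
by rewrite ler_pM2l ?mulr_gt0 // ler_nat.
Qed.

Lemma john_nirenberg_step :
  (rint mu (ball x0 r0) (fun y => cabs (g y - c x0 r0) ^+ 2)%R <=
   ((Q / 2 + (2 + (3 * Cd ^+ 2) ^+ 2) * lam ^+ 2) * V x0 r0)%:E)%E.
Proof.
have mB := measurable_mball x0 r0.
rewrite -(setUIDK (ball x0 r0) Omega).
apply: (le_trans (rint_setU mu (measurableI _ _ mB mOmega) (measurableD mB mOmega) mh2 h20)).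
apply: (le_trans (leeD on_Omega (lexx _))).
have -> : (Q / 2 + (2 + (3 * Cd ^+ 2) ^+ 2) * lam ^+ 2) * V x0 r0 =
  (Q / 2 + 2 * lam ^+ 2) * V x0 r0 + (3 * Cd ^+ 2 * lam) ^+ 2 * V x0 r0 by ring.
rewrite EFinD; apply: leeD => //.
apply: (@le_trans _ _ (rint mu (ball x0 r0 `\` Omega) (fun=> (3 * Cd ^+ 2 * lam) ^+ 2)%R)).
  apply: ae_le_rint => //; first exact: measurableD.
    by move=> _; exact: sqr_ge0.
  exists ((ball x0 r0 `\` Omega) `&` [set y | 3 * Cd ^+ 2 * lam < h y]); split.
  - apply: measurableI; last exact: measurable_gt.
    exact: measurableD.
  - exact: off_Omega.
  - move=> y /= /not_implyP[By hy]; split=> //=; rewrite ltNge; apply/negP => hl.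
    by apply: hy; rewrite ler_sqr ?nnegrE // !mulr_ge0 // ltW.
rewrite rint_cst; last exact: measurableD.
rewrite [leRHS]EFinM -(volE dbl) //; apply: lee_wpmul2l; first by rewrite lee_fin sqr_ge0.
by apply: le_measure; rewrite ?inE //; exact: measurableD.
Qed.

End Step.

(** For bounded g the square oscillation is finite to begin with, and iterating
    the step makes the contribution of the bound K disappear. *)
Lemma john_nirenberg_bounded (g : X -> R[i]) (c : X -> R -> R[i]) (M K : R) :
  cmeasurable g -> 0 < M ->
  (forall x r, 0 < r ->
    (rint mu (ball x r) (fun y => cabs (g y - c x r))%R <= (M * V x r)%:E)%E) ->
  (forall x r y, cabs (g y - c x r) <= K) ->
  let alpha := (2 + Cd ^+ 2) * Cd ^+ 2 in
  let Lam := 4 * Cd ^+ 2 * alpha + alpha * Cd ^+ 3 + (2 + Cd) in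
  let A := 2 * ((2 + (3 * Cd ^+ 2) ^+ 2) * (Lam * M) ^+ 2) in
  forall x r, 0 < r ->
    (rint mu (ball x r) (fun y => cabs (g y - c x r) ^+ 2)%R <= (A * V x r)%:E)%E.
Proof.
move=> mg M0 osc bK alpha Lam A.
have A0 : 0 <= A.
  by rewrite mulr_ge0 // mulr_ge0 ?sqr_ge0 // addr_ge0 // sqr_ge0.
have H (n : nat) : forall x r, 0 < r ->
  (rint mu (ball x r) (fun y => cabs (g y - c x r) ^+ 2)%R <=
     ((K ^+ 2 / 2 ^+ n + A) * V x r)%:E)%E.
  elim: n => [|n IH] x r r0.
    rewrite expr0 divr1; apply: (@le_trans _ _ (rint mu (ball x r) (fun=> K ^+ 2)%R)).
      apply: le_rint; first exact: measurable_mball.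
      - by apply: measurable_funX; exact: mdev.
      - exact: measurable_cst.
      - by move=> y; exact: sqr_ge0.
      - by move=> y _; rewrite ler_sqr ?nnegrE // (le_trans _ (bK x r y)).
    rewrite rint_cst; last exact: measurable_mball.
    by rewrite (volE dbl) // -EFinM lee_fin ler_pM2r ?vpos // lerDl.
  have Q0 : 0 <= K ^+ 2 / 2 ^+ n + A by rewrite addr_ge0 // divr_ge0 ?sqr_ge0 // exprn_ge0.
  apply: (le_trans (john_nirenberg_step mg M0 Q0 osc IH x r0)).
  rewrite lee_fin ler_pM2r ?vpos // -/alpha -/Lam.
  rewrite (_ : K ^+ 2 / 2 ^+ n.+1 = K ^+ 2 / 2 ^+ n / 2); last first.
    by rewrite (exprSr 2 n) invfM mulrA.
  by rewrite /A; lra.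
move=> x r r0; apply/lee_addgt0Pr => e e0.
have [n Hn] := ex_pow2_gt (K ^+ 2 * V x r / e).
apply: (le_trans (H n x r r0)); rewrite -EFinD lee_fin mulrDl addrC lerD2l.
by rewrite mulrAC ler_pdivrMr ?exprn_gt0 // [e * _]mulrC -ler_pdivrMr // ltW.
Qed.

(** The bound for truncations of g does not depend on the height of the
    truncation, which may therefore tend to infinity. *)
Theorem john_nirenberg2 (g : X -> R[i]) (c : X -> R -> R[i]) (M : R) :
  cmeasurable g -> 0 < M ->
  (forall x r, 0 < r ->
    (rint mu (ball x r) (fun y => cabs (g y - c x r))%R <= (M * V x r)%:E)%E) ->
  exists2 M2 : R, 0 < M2 & forall x r, 0 < r ->
    (rint mu (ball x r) (fun y => cabs (g y - c x r) ^+ 2)%R <= (M2 ^+ 2 * V x r)%:E)%E.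
Proof.
move=> mg M0 osc.
pose alpha := (2 + Cd ^+ 2) * Cd ^+ 2.
pose Lam := 4 * Cd ^+ 2 * alpha + alpha * Cd ^+ 3 + (2 + Cd).
pose A := 2 * ((2 + (3 * Cd ^+ 2) ^+ 2) * (Lam * M) ^+ 2).
have A0 : 0 <= A.
  by rewrite mulr_ge0 // mulr_ge0 ?sqr_ge0 // addr_ge0 // sqr_ge0.
exists (A + 1) => [|x r r0]; first by rewrite ltr_wpDl.
apply: (@le_trans _ _ (A * V x r)%:E); last first.
  rewrite lee_fin ler_pM2r ?vpos // sqrrD mulr1 expr1n.
  by have := sqr_ge0 A; move: A0; lra.
apply: (@fatou_rint _ _ _ mu _
  (fun k y => cabs (clampC k%:R (g y) - clampC k%:R (c x r)) ^+ 2)).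
- exact: measurable_mball.
- by move=> k; apply: measurable_funX; apply: mdev; exact: cmeasurable_clamp.
- by apply: measurable_funX; exact: mdev.
- by move=> k y; exact: sqr_ge0.
- by move=> y; exact: sqr_ge0.
- have tb (z : R[i]) k : ((Num.truncn (cabs z)).+1 <= k)%N -> cabs z <= k%:R.
    move=> zk; apply: ltW; apply: (@lt_le_trans _ _ (Num.truncn (cabs z)).+1%:R).
      by case/andP: (truncn_itv (cabs_ge0 z)).
    by rewrite ler_nat.
  apply: aeW => y; apply: cvg_near_cst.
  exists (maxn (Num.truncn (cabs (g y))).+1 (Num.truncn (cabs (c x r))).+1) => //.
  move=> k; rewrite /mkset geq_max => /andP[k1 k2].
  by rewrite !clampC_id //; exact: tb.
- move=> k; apply: (@john_nirenberg_bounded (fun y => clampC k%:R (g y))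
    (fun x r => clampC k%:R (c x r)) M (4 * k%:R)) => //.
  + exact: cmeasurable_clamp.
  + move=> x' r' r'0; apply: le_trans (osc x' r' r'0); apply: le_rint.
    * exact: measurable_mball.
    * by apply: mdev; exact: cmeasurable_clamp.
    * exact: mdev.
    * by [].
    * by move=> y _; exact: clampC_lip.
  + move=> x' r' y; apply: (le_trans (cabsB _ _)).
    have := clampC_bound (g y) (ler0n R k); have := clampC_bound (c x' r') (ler0n R k); lra.
Qed.

End JohnNirenberg.

(** * Linear and sublinear operators *)

Section Lebesgue.
Context {d : measure_display} {R : realType} {X : borelMetricType d R}.
Variable mu : {measure set X -> \bar R}.
Implicit Types f g h : X -> R[i].

Lemma sqr_cabsD (z w : R[i]) : cabs (z + w) ^+ 2 <= 2 * cabs z ^+ 2 + 2 * cabs w ^+ 2.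
Proof.
apply: (@le_trans _ _ ((cabs z + cabs w) ^+ 2)).
  by rewrite ler_sqr ?nnegrE ?addr_ge0 ?cabsD.
by have := sqr_ge0 (cabs z - cabs w); rewrite sqrrB sqrrD; lra.
Qed.

Lemma measurable_cabs2 f : cmeasurable f -> measurable_fun setT (fun x => cabs (f x) ^+ 2).
Proof. by move=> mf; apply: measurable_funX; exact: cmeasurable_cabs. Qed.

Lemma rint2D f g : cmeasurable f -> cmeasurable g ->
  (rint mu setT (fun x => cabs (f x + g x) ^+ 2)%R <=
   2%:E * rint mu setT (fun x => cabs (f x) ^+ 2)%R +
   2%:E * rint mu setT (fun x => cabs (g x) ^+ 2)%R)%E.
Proof.
move=> mf mg; have m2f := measurable_cabs2 mf; have m2g := measurable_cabs2 mg.
rewrite -!rintZ //; try by move=> x; exact: sqr_ge0.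
rewrite -rintD //; try by move=> x; rewrite mulr_ge0 // sqr_ge0.
- apply: le_rint => //.
  + by apply: measurable_cabs2; exact: cmeasurableD.
  + by apply: measurable_funD; apply: measurable_funM => //; exact: measurable_cst.
  + by move=> x; exact: sqr_ge0.
  + by move=> x _; exact: sqr_cabsD.
- by apply: measurable_funM => //; exact: measurable_cst.
- by apply: measurable_funM => //; exact: measurable_cst.
Qed.

Lemma rint1D f g : cmeasurable f -> cmeasurable g ->
  (rint mu setT (fun x => cabs (f x + g x))%R <=
   rint mu setT (fun x => cabs (f x))%R + rint mu setT (fun x => cabs (g x))%R)%E.
Proof.
move=> mf mg; rewrite -rintD //; try exact: cmeasurable_cabs.
apply: le_rint => //.
- by apply: cmeasurable_cabs; exact: cmeasurableD.
- by apply: measurable_funD; exact: cmeasurable_cabs.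
- by move=> x _; exact: cabsD.
Qed.

Lemma rint2Z (a : R[i]) f : cmeasurable f ->
  rint mu setT (fun x => cabs (a * f x) ^+ 2)%R =
  ((cabs a ^+ 2)%:E * rint mu setT (fun x => cabs (f x) ^+ 2)%R)%E.
Proof.
move=> mf; rewrite -rintZ ?sqr_ge0 //; last by move=> x; exact: sqr_ge0.
  by congr (rint _ _ _); apply/funext => x; rewrite cabsM exprMn.
exact: measurable_cabs2.
Qed.

Lemma rint1Z (a : R[i]) f : cmeasurable f ->
  rint mu setT (fun x => cabs (a * f x))%R =
  ((cabs a)%:E * rint mu setT (fun x => cabs (f x))%R)%E.
Proof.
move=> mf; rewrite -rintZ //; last exact: cmeasurable_cabs.
by congr (rint _ _ _); apply/funext => x; rewrite cabsM.
Qed.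

Definition linear_closed_set (D : set (X -> R[i])) : Prop :=
  forall (a : R[i]) f g, D f -> D g -> D ((a \*o f) \+ g).

Lemma cLp2_linear : linear_closed_set (cLp mu 2).
Proof.
move=> a f g /cLp2P[mf f2] /cLp2P[mg g2]; apply/cLp2P; split.
  by apply: cmeasurableD => //; exact: cmeasurableZ.
apply: (le_lt_trans (rint2D (cmeasurableZ a mf) mg)).
apply: lte_add_pinfty; last by rewrite lte_mul_pinfty.
rewrite lte_mul_pinfty // (rint2Z a mf) lte_mul_pinfty ?lee_fin ?sqr_ge0 //.
Qed.

Lemma cLp1_linear : linear_closed_set (cLp mu 1).
Proof.
move=> a f g /cLp1P[mf f1] /cLp1P[mg g1]; apply/cLp1P; split.
  by apply: cmeasurableD => //; exact: cmeasurableZ.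
apply: (le_lt_trans (rint1D (cmeasurableZ a mf) mg)).
apply: lte_add_pinfty => //; rewrite (rint1Z a mf) lte_mul_pinfty ?lee_fin //.
Qed.

Lemma cL12_linear : linear_closed_set (cL1_plus_L2 mu).
Proof.
move=> a _ _ [f1 [f2 [Hf1 Hf2 ->]]] [g1 [g2 [Hg1 Hg2 ->]]].
exists ((a \*o f1) \+ g1), ((a \*o f2) \+ g2); split.
- exact: cLp1_linear.
- exact: cLp2_linear.
- by apply/funext => x /=; rewrite mulrDr addrACA.
Qed.

Section Closed.
Variable D : set (X -> R[i]).
Hypothesis linD : linear_closed_set D.

Lemma linB f g : D f -> D g -> D (f \- g).
Proof.
move=> Df Dg; have -> : f \- g = (-1 \*o g) \+ f.
  by apply/funext => x /=; rewrite mulN1r addrC.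
exact: linD.
Qed.

Lemma lin0 f : D f -> D (fun=> 0).
Proof.
move=> Df; have -> : (fun=> 0) = f \- f by apply/funext => x /=; rewrite subrr.
exact: linB.
Qed.

Lemma linZ a f : D f -> D (a \*o f).
Proof.
move=> Df; have -> : a \*o f = (a \*o f) \+ (fun=> 0).
  by apply/funext => x /=; rewrite addr0.
by apply: linD => //; exact: lin0 Df.
Qed.

Lemma linDD f g : D f -> D g -> D (f \+ g).
Proof.
move=> Df Dg; have -> : f \+ g = (1 \*o f) \+ g.
  by apply/funext => x /=; rewrite mul1r.
exact: linD.
Qed.

Lemma lin_sum (lam : nat -> R[i]) (a : nat -> X -> R[i]) N :
  (forall j, D (a j)) -> D (fun x => \sum_(0 <= j < N) lam j * a j x).
Proof.
move=> Da; elim: N => [|N IH].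
  rewrite (_ : (fun x => _) = (fun=> 0)); first exact: lin0 (Da 0%N).
  by apply/funext => x; rewrite big_nil.
rewrite (_ : (fun x => _) =
  (lam N \*o a N) \+ (fun x => \sum_(0 <= j < N) lam j * a j x)).
  exact: linD.
by apply/funext => x; rewrite big_nat_recr //= addrC.
Qed.

End Closed.

Lemma cLp2_L12 f : cLp mu 2 f -> cL1_plus_L2 mu f.
Proof.
move=> Hf; exists (fun=> 0), f; split=> //; last by apply/funext => x /=; rewrite add0r.
apply/cLp1P; split; first exact: cmeasurable_cst.
rewrite cabs0 rint_cst // mul0e //.
Qed.

Lemma cLp1_L12 f : cLp mu 1 f -> cL1_plus_L2 mu f.
Proof.
move=> Hf; exists f, (fun=> 0); split=> //; last by apply/funext => x /=; rewrite addr0.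
apply/cLp2P; split; first exact: cmeasurable_cst.
by rewrite cabs0 expr0n /= rint_cst // mul0e.
Qed.

End Lebesgue.

Section Subadditive.
Context {d : measure_display} {R : realType} {X : borelMetricType d R}.
Variable mu : {measure set X -> \bar R}.
Implicit Types f g h : X -> R[i].

(** What linear and nonnegative sublinear operators have in common, and all
    that is used of them below. *)
Definition subadditive_on (D : set (X -> R[i])) (T : (X -> R[i]) -> X -> R[i]) :=
  [/\ forall f, D f -> cmeasurable (T f),
      forall f g, D f -> D g ->
        {ae mu, forall x, cabs (T f x - T g x) <= cabs (T (f \- g) x)} &
      forall (a : R[i]) f, D f ->
        {ae mu, forall x, cabs (T (a \*o f) x) <= cabs a * cabs (T f x)}].

Lemma nonneg_cabsB (u v w : R[i]) : 0 <= u -> 0 <= v -> 0 <= w ->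
  u <= v + w -> v <= u + w -> cabs (u - v) <= cabs w.
Proof.
case: u => a a'; case: v => b b'; case: w => e e'; rewrite !lecE /=.
move=> /andP[/eqP -> a0] /andP[/eqP -> b0] /andP[/eqP -> e0] /andP[_ h1] /andP[_ h2].
have E (t : R) : cabs (t +i* 0) = `|t| by exact: cabs_real.
rewrite subrr expr0n /= !addr0 !sqrtr_sqr [leRHS]ger0_norm // ler_norml.
by apply/andP; split; lra.
Qed.

Lemma lin_or_sublin_subadditive (D : set (X -> R[i])) T : linear_closed_set D ->
  lin_or_sublin_on mu D T -> subadditive_on D T.
Proof.
move=> linD [mT [linT|[T0 TD TZ]]]; split=> //.
- move=> f g Df Dg; have := linT (-1) g f Dg Df.
  apply: filterS => x; have -> : (-1 \*o g) \+ f = f \- g.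
    by apply/funext => y /=; rewrite mulN1r addrC.
  by move=> -> /=; rewrite mulN1r addrC.
- move=> a f Df; have := linT (a - 1) f f Df Df.
  apply: filterS => x; have -> : ((a - 1) \*o f) \+ f = a \*o f.
    by apply/funext => y /=; rewrite mulrBl mul1r subrK.
  by move=> -> /=; rewrite mulrBl mul1r subrK cabsM.
- move=> f g Df Dg; have Dfg := linB linD Df Dg.
  have := TD _ _ Dfg Dg; have -> : (f \- g) \+ g = f.
    by apply/funext => y /=; rewrite subrK.
  have := TD _ _ (linZ linD (-1) Dfg) Df; have -> : (-1 \*o (f \- g)) \+ f = g.
    by apply/funext => y /=; rewrite mulN1r opprB subrK.
  move=> H1 H2.
  apply: filterS2 (filterI H1 H2) (filterI (T0 _ Df) (filterI (T0 _ Dg)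
    (filterI (T0 _ Dfg) (TZ (-1) _ Dfg)))).
  move=> x [h1 h2] [f0 [g0 [fg0 fgZ]]]; apply: nonneg_cabsB => //.
    by rewrite addrC.
  by move: h1; rewrite fgZ normrN1 mul1r addrC.
- move=> a f Df; have := TZ a f Df; apply: filterS => x ->.
  by rewrite cabsM cabs_norm.
Qed.

Section Properties.
Variables (D : set (X -> R[i])) (T : (X -> R[i]) -> X -> R[i]).
Hypothesis linD : linear_closed_set D.
Hypothesis HT : subadditive_on D T.

Lemma subadditive_split f g : D f -> D g ->
  {ae mu, forall x, cabs (T f x) <= cabs (T g x) + cabs (T (f \- g) x)}.
Proof.
case: HT => _ Tdiff _ Df Dg; apply: filterS (Tdiff f g Df Dg) => x h.
rewrite -[T f x](subrK (T g x)); apply: (le_trans (cabsD _ _)).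
by rewrite addrC lerD2l.
Qed.

Lemma subadditiveD f g : D f -> D g ->
  {ae mu, forall x, cabs (T (f \+ g) x) <= cabs (T f x) + cabs (T g x)}.
Proof.
move=> Df Dg; have := subadditive_split (linDD linD Df Dg) Df.
by have -> : (f \+ g) \- f = g by apply/funext => y /=; rewrite addrC addKr.
Qed.

Lemma subadditive_sum (lam : nat -> R[i]) (a : nat -> X -> R[i]) N :
  (forall j, D (a j)) ->
  {ae mu, forall x, cabs (T (fun x => \sum_(0 <= j < N) lam j * a j x) x) <=
     \sum_(0 <= j < N) cabs (lam j) * cabs (T (a j) x)}.
Proof.
case: HT => _ _ TZ Da; elim: N => [|N IH].
  have := TZ 0 (a 0%N) (Da 0%N); apply: filterS => x.
  rewrite cabs0 mul0r big_nil; congr (_ <= _); congr (cabs (T _ _)).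
  by apply/funext => y /=; rewrite mul0r big_nil.
have := subadditiveD (lin_sum linD lam N Da) (linZ linD (lam N) (Da N)).
have -> : (fun x => \sum_(0 <= j < N) lam j * a j x) \+ (lam N \*o a N) =
  (fun x => \sum_(0 <= j < N.+1) lam j * a j x).
  by apply/funext => y /=; rewrite big_nat_recr.
move=> H; apply: filterS2 (filterI IH H) (TZ (lam N) (a N) (Da N)) => x [h1 h2] h3.
apply: (le_trans h2); rewrite big_nat_recr //=.
by apply: lerD.
Qed.

End Properties.

Lemma subadditive_onS (D D' : set (X -> R[i])) T : D' `<=` D ->
  subadditive_on D T -> subadditive_on D' T.
Proof.
move=> sD [mT Td TZ]; split=> [f /sD /mT //|f g /sD Df /sD Dg|a f /sD Df].
  exact: Td.
exact: TZ.
Qed.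

Lemma L2_bounded_rint T : L2_bounded mu T -> exists2 C : R, 0 < C &
  forall f (A : R), cLp mu 2 f -> 0 <= A ->
    (rint mu setT (fun x => cabs (f x) ^+ 2)%R <= (A ^+ 2)%:E)%E ->
    (rint mu setT (fun x => cabs (T f x) ^+ 2)%R <= ((C * A) ^+ 2)%:E)%E.
Proof.
move=> [C C0 HC]; exists C => // f A f2 A0 /cLnorm2_le -/(_ A0) fA.
apply/cLnorm2_le; first by rewrite mulr_ge0 // ltW.
have [_ h] := HC f f2; apply: (le_trans h); rewrite EFinM.
by apply: lee_wpmul2l; rewrite // lee_fin ltW.
Qed.

Lemma L2_bounded_small T e1 e2 : L2_bounded mu T -> subadditive_on (cLp mu 2) T ->
  0 < e1 -> 0 < e2 -> exists2 e3 : R, 0 < e3 &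
  forall f, cLp mu 2 f -> (cLnorm mu 2 f <= e3%:E)%E ->
    (mu [set x | (e1 < cabs (T f x))%R] <= e2%:E)%E.
Proof.
move=> /L2_bounded_rint[C C0 HC] [mT _ _] e10 e20.
pose e3 := Num.sqrt e2 * e1 / C.
have e30 : 0 < e3 by rewrite divr_gt0 // mulr_gt0 // sqrtr_gt0.
exists e3 => // f f2 /cLnorm2_le -/(_ (ltW e30)) /HC -/(_ f2 (ltW e30)) h.
have -> : [set x | e1 < cabs (T f x)] = [set x | e1 ^+ 2 < cabs (T f x) ^+ 2].
  by apply/seteqP; split=> x /=; rewrite ltr_sqr ?nnegrE // ltW.
have e12 : 0 < e1 ^+ 2 by exact: exprn_gt0.
apply: (le_trans (chebyshev_le (measurable_cabs2 (mT f f2)) _ e12 h)).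
  by move=> x; exact: sqr_ge0.
rewrite lee_fin /e3 mulrCA divff ?gt_eqF // mulr1 exprMn (sqr_sqrtr (ltW e20)).
by rewrite mulfK ?gt_eqF.
Qed.

Lemma weak_type11_small T e1 e2 : weak_type11 mu T ->
  0 < e1 -> 0 < e2 -> exists2 e3 : R, 0 < e3 &
  forall f, cLp mu 1 f -> (rint mu setT (fun x => cabs (f x))%R <= e3%:E)%E ->
    (mu [set x | (e1 < cabs (T f x))%R] <= e2%:E)%E.
Proof.
move=> [C C0 HC] e10 e20; exists (e2 * e1 / C); first by rewrite divr_gt0 // mulr_gt0.
move=> f f1 fe.
have : (weakL1norm mu (T f) <= (e2 * e1)%:E)%E.
  apply: (le_trans (HC f f1)); rewrite cLnorm1.
  rewrite (_ : (e2 * e1)%:E = C%:E * (e2 * e1 / C)%:E)%E.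
    by apply: lee_wpmul2l; rewrite // lee_fin ltW.
  by rewrite -EFinM; congr EFin; rewrite mulrCA divff ?gt_eqF // mulr1.
move=> /(weakL1norm_dist e10) h; apply: (le_trans h).
by rewrite mulfK ?gt_eqF.
Qed.

End Subadditive.

(** * Atoms and powers of the operator *)

Section Atoms.
Context {d : measure_display} {R : realType} {X : borelMetricType d R}.
Variable mu : {measure set X -> \bar R}.
Implicit Types f g h : X -> R[i].

Lemma ae_equal_refl f : ae_equal mu f f. Proof. exact: aeW. Qed.

Lemma ae_equal_sym f g : ae_equal mu f g -> ae_equal mu g f.
Proof. by apply: filterS => x. Qed.

Lemma ae_equal_trans g f h : ae_equal mu f g -> ae_equal mu g h -> ae_equal mu f h.
Proof. by apply: filterS2 => x -> ->. Qed.

Lemma ae_equalZ (a : R[i]) f g : ae_equal mu f g -> ae_equal mu (a \*o f) (a \*o g).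
Proof. by apply: filterS => x /= ->. Qed.

Lemma cLnorm2_ae f g : cmeasurable f -> cmeasurable g -> ae_equal mu f g ->
  (cLnorm mu 2 f <= cLnorm mu 2 g)%E.
Proof.
move=> mf mg fg.
have [g2|g2] := eqVneq (cLnorm mu 2 g) +oo%E; first by rewrite g2 leey.
have gfin : (cLnorm mu 2 g < +oo)%E by rewrite ltey.
have [A0 AE] : exists2 A : R, 0 <= A & cLnorm mu 2 g = A%:E.
  exists (fine (cLnorm mu 2 g)); first by rewrite fine_ge0 // cLnorm_ge0.
  by rewrite fineK // ge0_fin_numE // cLnorm_ge0.
move=> gE; rewrite gE; apply/cLnorm2_le => //.
have /cLnorm2_le -/(_ AE) gA : (cLnorm mu 2 g <= A0%:E)%E by rewrite gE.
apply: le_trans gA; apply: ae_le_rint => //; try exact: measurable_cabs2.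
- by move=> x; exact: sqr_ge0.
- by move=> x; exact: sqr_ge0.
- by apply: filterS fg => x ->.
Qed.

Lemma cLnorm2Z_le (a : R[i]) f : cLp mu 2 f ->
  (cLnorm mu 2 (a \*o f) <= (cabs a)%:E * cLnorm mu 2 f)%E.
Proof.
move=> [mf fin].
have A0 : 0 <= fine (cLnorm mu 2 f) by rewrite fine_ge0 // cLnorm_ge0.
have fE : cLnorm mu 2 f = (fine (cLnorm mu 2 f))%:E.
  by rewrite fineK // ge0_fin_numE // cLnorm_ge0.
have /cLnorm2_le -/(_ A0) fA : (cLnorm mu 2 f <= (fine (cLnorm mu 2 f))%:E)%E by rewrite -fE.
rewrite fE -EFinM; apply/cLnorm2_le; first exact: mulr_ge0.
rewrite (rint2Z mu a mf) exprMn [leRHS]EFinM; apply: lee_wpmul2l => //.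
by rewrite lee_fin sqr_ge0.
Qed.

Lemma esupp_sub f g (Z : set X) : cmeasurable f -> cmeasurable g ->
  measurable Z -> mu Z = 0%E -> (forall y, ~ Z y -> g y = 0 -> f y = 0) ->
  esupp mu f `<=` esupp mu g.
Proof.
move=> mf mg mZ Z0 H x fx r r0; apply: (lt_le_trans (fx r r0)).
have mB := measurable_mball x r.
have mfB := measurableI _ _ mB (measurable_neq0 mf).
have mgB := measurableI _ _ mB (measurable_neq0 mg).
rewrite -(measureU0 mgB mZ Z0); apply: le_measure; rewrite ?inE //.
  exact: measurableU.
move=> y [yB /= fy]; have [Zy|nZ] := pselect (Z y); [by right|left].
by split=> //=; apply: contra fy => /eqP gy; rewrite (H y nZ gy).
Qed.

Lemma esupp_ae f g : cmeasurable f -> cmeasurable g -> ae_equal mu f g ->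
  esupp mu f `<=` esupp mu g.
Proof.
move=> mf mg [Z [mZ Z0 ZP]]; apply: (@esupp_sub f g Z) => // y nZ gy.
by apply: contrapT => fy; apply: nZ; apply: ZP => /=; rewrite gy.
Qed.

Lemma esuppZ (a : R[i]) f : cmeasurable f -> esupp mu (a \*o f) `<=` esupp mu f.
Proof.
move=> mf; apply: (@esupp_sub _ _ set0) => //; first exact: cmeasurableZ.
by move=> y _ /= ->; rewrite mulr0.
Qed.

Lemma esuppD f g : cmeasurable f -> cmeasurable g ->
  esupp mu (f \+ g) `<=` esupp mu f `|` esupp mu g.
Proof.
move=> mf mg x fgx; apply: contrapT => /not_orP[nf ng].
have [r r0 fr] : exists2 r : R, 0 < r & mu (ball x r `&` [set y | f y != 0]) = 0%E.
  move/existsNP : nf => [r /not_implyP[r0 /negP]]; rewrite -leNgt measure_le0 => /eqP.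
  by exists r.
have [s s0 gs] : exists2 s : R, 0 < s & mu (ball x s `&` [set y | g y != 0]) = 0%E.
  move/existsNP : ng => [s /not_implyP[s0 /negP]]; rewrite -leNgt measure_le0 => /eqP.
  by exists s.
have t0 : 0 < Num.min r s by rewrite lt_min r0.
have mr := measurableI _ _ (measurable_mball x r) (measurable_neq0 mf).
have ms := measurableI _ _ (measurable_mball x s) (measurable_neq0 mg).
have := fgx _ t0; rewrite ltNge => /negP; apply.
rewrite -fr -(measureU0 mr ms gs); apply: le_measure; rewrite ?inE.
- apply: measurableI; first exact: measurable_mball.
  by apply: measurable_neq0; exact: cmeasurableD.
- exact: measurableU.
move=> y [yB /= fgy]; have [f0|f0] := eqVneq (f y) 0.
  right; split; first by apply: ball_le yB; rewrite ge_min lexx orbT.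
  by apply: contra fgy => /= /eqP ->; rewrite f0 addr0.
by left; split=> //; apply: ball_le yB; rewrite ge_min lexx.
Qed.

Section Powers.
Variable L : @unbounded_op d R X.
Hypothesis HL : densely_defined_linear mu L.

Lemma pow_dom_cLp2 k f : pow_dom mu L k f -> cLp mu 2 f.
Proof. by case: HL => Ldom _ _ _ _; case: k => [//|k [/Ldom[]]]. Qed.

Lemma pow_dom_iter k f i : pow_dom mu L k f -> (i <= k)%N -> cLp mu 2 (iter i L f).
Proof.
elim: k f i => [|k IH] f [|i] //; first by move=> /pow_dom_cLp2.
by move=> [_ Lf] ik; rewrite iterSr; exact: IH.
Qed.

Lemma pow_dom_ae k f g : pow_dom mu L k f -> cLp mu 2 g -> ae_equal mu f g ->
  pow_dom mu L k g /\ forall i, (i <= k)%N -> ae_equal mu (iter i L f) (iter i L g).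
Proof.
case: HL => Ldom Lae _ _ _; elim: k f g => [|k IH] f g.
  by move=> _ Hg fg; split=> // -[|].
move=> [domf Lf] Hg fg; have [domg LfLg] := Lae f g domf Hg fg.
have [_ Lg2] := Ldom _ domg; have [Lg H] := IH _ _ Lf Lg2 LfLg.
split=> // -[//|i] ik; rewrite !iterSr; exact: H.
Qed.

Lemma pow_domZ k s f : pow_dom mu L k f -> pow_dom mu L k (s \*o f) /\
  forall i, (i <= k)%N -> ae_equal mu (iter i L (s \*o f)) (s \*o iter i L f).
Proof.
case: HL => Ldom Lae Llin Leq _; elim: k f => [|k IH] f.
  move=> Hf; split; first exact: (linZ (@cLp2_linear _ _ _ mu)).
  by case=> // _; exact: ae_equal_refl.
move=> [domf Lf].
have sE : ((s - 1) \*o f) \+ f = s \*o f.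
  by apply/funext => y /=; rewrite mulrBl mul1r subrK.
have doms : dom L (s \*o f) by rewrite -sE; exact: Llin.
have LsE : ae_equal mu (L (s \*o f)) (s \*o L f).
  rewrite -sE; apply: ae_equal_trans (Leq (s - 1) f f domf domf) _.
  by apply: aeW => y /=; rewrite mulrBl mul1r subrK.
have [sLf H] := IH _ Lf; have [_ Ls2] := Ldom _ doms.
have [Ls H'] := pow_dom_ae sLf Ls2 (ae_equal_sym LsE).
split=> // -[_|i ik]; first exact: ae_equal_refl.
rewrite !iterSr; apply: ae_equal_trans (H i ik).
exact/ae_equal_sym/H'.
Qed.

Lemma atom_cLp2 p m a : atom mu L p m a -> cLp mu 2 a.
Proof. by case=> [[x [r [_ []]]]|[]]. Qed.

Section BallAtom.
Variables (p : R) (m : nat) (a : X -> R[i]) (x : X) (r : R).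
Hypothesis r0 : 0 < r.
Hypothesis Ha : ball_atom mu L p m a x r.

Lemma ball_atom_esupp : esupp mu a `<=` ball x r.
Proof.
have [a2 [b [bm ab supb _]]] := Ha; apply: subset_trans (supb m (leqnn m)).
have [[ma _] [mb _]] := (a2, pow_dom_iter bm (leqnn m)).
exact: esupp_ae.
Qed.

(** The case k = m of the size condition on b, in which the powers of r
    cancel. *)
Lemma ball_atom_norm :
  (rint mu setT (fun x => cabs (a x) ^+ 2)%R <= ((vol mu x r `^ (2^-1 - p^-1)) ^+ 2)%:E)%E.
Proof.
have [a2 [b [bm ab _ nb]]] := Ha; apply/cLnorm2_le; first exact: powR_ge0.
have [[ma _] [mb _]] := (a2, pow_dom_iter bm (leqnn m)).
apply: (le_trans (cLnorm2_ae ma mb ab)).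
have := nb m (leqnn m); rewrite [leRHS]EFinM lee_pmul2l //.
by rewrite lte_fin exprn_gt0.
Qed.

(** The conditions on a and b are homogeneous, so that only the exponent of the
    measure of the ball changes. *)
Lemma ball_atom_rescale q : 0 < vol mu x r ->
  ball_atom mu L q m ((vol mu x r `^ (p^-1 - q^-1))%:C \*o a) x r.
Proof.
move=> v0; set s := (_)%:C; have [a2 [b [bm ab supb nb]]] := Ha.
have [sbm sbE] := pow_domZ s bm.
have mit k : (k <= m)%N -> cmeasurable (iter k L b) by move=> /(pow_dom_iter bm)[].
have mits k : (k <= m)%N -> cmeasurable (iter k L (s \*o b)) by move=> /(pow_dom_iter sbm)[].
split; first exact: (linZ (@cLp2_linear _ _ _ mu)).
exists (s \*o b); split=> //.
- by apply: ae_equal_trans (ae_equalZ s ab) _; exact/ae_equal_sym/sbE.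
- move=> k km; apply: subset_trans (supb k km).
  apply: (@subset_trans _ (esupp mu (s \*o iter k L b))); last exact: esuppZ (mit k km).
  by apply: esupp_ae; [exact: mits|exact/cmeasurableZ/mit|exact: sbE].
- move=> k km; have r2 : (0 <= (r ^+ (2 * k))%:E)%E by rewrite lee_fin exprn_ge0 // ltW.
  apply: (@le_trans _ _ ((r ^+ (2 * k))%:E * ((cabs s)%:E * cLnorm mu 2 (iter k L b)))%E).
    apply: lee_wpmul2l => //; apply: le_trans (cLnorm2Z_le s (pow_dom_iter bm km)).
    by apply: cLnorm2_ae; [exact: mits|exact/cmeasurableZ/mit|exact: sbE].
  rewrite muleCA; apply: (@le_trans _ _
    ((cabs s)%:E * (r ^+ (2 * m) * vol mu x r `^ (2^-1 - p^-1))%:E)%E).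
    by apply: lee_wpmul2l; [rewrite lee_fin|exact: nb].
  rewrite -EFinM lee_fin cabs_real ger0_norm ?powR_ge0 // mulrCA -powRD.
    by rewrite [p^-1 - _ + _]addrC addrA subrK.
  by rewrite (gt_eqF v0) implybT.
Qed.

End BallAtom.

Lemma cst_atom_norm p m a : 0 < p -> atom mu L p m a -> (0 < mu setT < +oo)%E ->
  ae_equal mu a (cst ((fine (mu setT) `^ (- p^-1))%:C)) ->
  (rint mu setT (fun x => cabs (a x) ^+ 2)%R <=
     ((fine (mu setT) `^ (2^-1 - p^-1)) ^+ 2)%:E)%E.
Proof.
move=> p0 Ha /andP[mu0 mufin] aE; have [ma _] := atom_cLp2 Ha.
set S := fine (mu setT) in aE *.
have SE : mu setT = S%:E by rewrite fineK // ge0_fin_numE // ltW.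
have S0 : 0 < S by rewrite -lte_fin -SE.
apply: (@le_trans _ _ (rint mu setT (fun=> (S `^ (- p^-1)) ^+ 2)%R)).
  apply: ae_le_rint => //; first exact: measurable_cabs2.
  - by move=> x; exact: sqr_ge0.
  - by move=> x; exact: sqr_ge0.
  - by apply: filterS aE => x -> _; rewrite cabs_real ger0_norm ?powR_ge0.
rewrite rint_cst // SE -EFinM lee_fin.
have S2 : S = (S `^ 2^-1) ^+ 2.
  by rewrite -powR_mulrn ?powR_ge0 // powRVK // ltW.
rewrite [X in _ * X]S2 -exprMn -powRD; first by rewrite addrC.
by rewrite (gt_eqF S0) implybT.
Qed.

End Powers.
End Atoms.

(** * Atomic decompositions and the Hardy quasi-norm *)

Definition interlace {A : Type} (u v : nat -> A) (i : nat) : A :=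
  if odd i then v i./2 else u i./2.

Lemma big_interlace (V : zmodType) (u v : nat -> V) N :
  \sum_(0 <= i < N) interlace u v i =
  \sum_(0 <= i < uphalf N) u i + \sum_(0 <= i < N./2) v i.
Proof.
elim: N => [|N IH]; first by rewrite !big_nil addr0.
rewrite big_nat_recr //= IH /interlace uphalf_half; case: ifP => oddN.
  by rewrite add1n [X in _ = _ + X]big_nat_recr //= addrA.
by rewrite add0n [X in _ = X + _]big_nat_recr //= addrAC.
Qed.

Lemma big_shift (V : zmodType) (u : nat -> V) N K :
  \sum_(0 <= j < K) u (N + j)%N = \sum_(0 <= j < N + K) u j - \sum_(0 <= j < N) u j.
Proof.
elim: K => [|K IH]; first by rewrite big_nil addn0 subrr.
by rewrite big_nat_recr //= IH addnS [in RHS]big_nat_recr //= addrAC.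
Qed.

Section Hardy.
Context {d : measure_display} {R : realType} {X : borelMetricType d R}.
Variable mu : {measure set X -> \bar R}.
Implicit Types f g h : X -> R[i].
Variables (L : @unbounded_op d R X) (p : R) (m : nat).
Hypothesis p0 : 0 < p.

Definition hsum (lam : nat -> R[i]) : \bar R :=
  (\sum_(0 <= j <oo) (cabs (lam j) `^ p)%:E)%E.

Lemma hsum_ge0 lam : (0 <= hsum lam)%E.
Proof. by apply: nneseries_ge0 => j _ _; rewrite lee_fin powR_ge0. Qed.

Lemma hsumN lam : hsum (fun j => - lam j) = hsum lam.
Proof. by apply: eq_eseriesr => j _; rewrite cabsN. Qed.

Lemma hsum_partial lam N :
  ((\sum_(0 <= j < N) cabs (lam j) `^ p)%:E <= hsum lam)%E.
Proof.
rewrite -sumEFin; apply: nneseries_lim_ge => j _ _.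
by rewrite lee_fin powR_ge0.
Qed.

Lemma hsum_le lam (S : \bar R) :
  (forall N, (\sum_(0 <= j < N) cabs (lam j) `^ p)%:E <= S)%E ->
  (hsum lam <= S)%E.
Proof.
move=> H; apply: lime_le.
  by apply: is_cvg_nneseries => j _ _; rewrite lee_fin powR_ge0.
by apply: nearW => N; rewrite sumEFin; exact: H.
Qed.

Lemma hsum_approx lam (s e : R) : hsum lam = s%:E -> 0 < e ->
  exists N, s - e < \sum_(0 <= j < N) cabs (lam j) `^ p.
Proof.
move=> hs e0; apply: contrapT => /forallNP H.
suff : (hsum lam <= (s - e)%:E)%E by rewrite hs lee_fin; move: e0; lra.
apply: hsum_le => N; rewrite lee_fin leNgt; apply/negP; exact: H.
Qed.

Lemma cvge0P (u : nat -> \bar R) : (forall n, 0 <= u n)%E ->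
  u @ \oo --> 0%E <->
  forall e : R, 0 < e -> exists N, forall n, (N <= n)%N -> (u n <= e%:E)%E.
Proof.
move=> u0; split.
  move=> /fine_cvgP[[N1 _ ufin] /cvgrPdist_le ucvg] e e0.
  have [N2 _ HN] := ucvg e e0; exists (maxn N1 N2) => n.
  rewrite geq_max => /andP[n1 n2]; rewrite -(fineK (ufin n n1)) lee_fin.
  by have := HN n n2; rewrite sub0r normrN /=; apply: le_trans; exact: ler_norm.
move=> H; apply/fine_cvgP; split.
  have [N HN] := H 1 ltr01; exists N => // n /= /HN un.
  by rewrite ge0_fin_numE // (le_lt_trans un) // ltry.
apply/cvgrPdist_le => e e0; have [N HN] := H e e0; exists N => // n /= /HN un.
have ufin : u n \is a fin_num by rewrite ge0_fin_numE // (le_lt_trans un) // ltry.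
by rewrite sub0r normrN ger0_norm ?fine_ge0 // -lee_fin fineK.
Qed.

Local Notation rep := (atomic_rep mu L p m).
Local Notation psum lam a N := (fun x => \sum_(0 <= j < N) lam j * a j x).

Lemma rep_meas f lam a : rep f lam a -> forall j, cLp mu 2 (a j).
Proof. by move=> [Ha _ _] j; apply: atom_cLp2 (Ha j). Qed.

Lemma psum_cLp2 f lam a N : rep f lam a -> cLp mu 2 (psum lam a N).
Proof. by move=> /rep_meas H; apply: (lin_sum (@cLp2_linear _ _ _ mu)). Qed.

Lemma rep_cvg f lam a : rep f lam a -> forall e : R, 0 < e ->
  exists N, forall n, (N <= n)%N -> (cLnorm mu 2 (f \- psum lam a n)%R <= e%:E)%E.
Proof. by move=> [_ _ /cvge0P]; apply => n; exact: cLnorm_ge0. Qed.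

Lemma repI f lam a : (forall j, atom mu L p m (a j)) -> (hsum lam < +oo)%E ->
  (forall e : R, 0 < e -> exists N, forall n, (N <= n)%N ->
    (cLnorm mu 2 (f \- psum lam a n)%R <= e%:E)%E) -> rep f lam a.
Proof. by move=> Ha hl H; split=> //; apply/cvge0P => // n; exact: cLnorm_ge0. Qed.

Lemma rep_opp f lam a : rep f lam a -> rep (fun x => - f x) (fun j => - lam j) a.
Proof.
move=> Hf; have [Ha hl _] := Hf; apply: repI => //.
  by rewrite hsumN.
move=> e /(rep_cvg Hf)[N HN]; exists N => n /HN; congr (_ <= _)%E.
rewrite /cLnorm; congr Lnorm; apply/funext => x /=.
rewrite [in RHS](eq_bigr (fun j => - (lam j * a j x))); last by move=> j _; rewrite /= mulNr.
by rewrite sumrN -opprD cabsN.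
Qed.

Lemma cLnorm2D_le f g (e : R) : cmeasurable f -> cmeasurable g -> 0 <= e ->
  (cLnorm mu 2 f <= e%:E)%E -> (cLnorm mu 2 g <= e%:E)%E ->
  (cLnorm mu 2 (f \+ g)%R <= (2 * e)%:E)%E.
Proof.
move=> mf mg e0 /cLnorm2_le -/(_ e0) fe /cLnorm2_le -/(_ e0) ge.
apply/cLnorm2_le; first exact: mulr_ge0.
apply: (le_trans (rint2D mu mf mg)).
apply: (@le_trans _ _ (2%:E * (e ^+ 2)%:E + 2%:E * (e ^+ 2)%:E)%E).
  by apply: leeD; apply: lee_wpmul2l; rewrite // lee_fin.
by rewrite -!EFinM -EFinD lee_fin exprMn; lra.
Qed.

(** Two atomic decompositions are added by interlacing them. *)
Lemma rep_add f g lam a kap b : cmeasurable f -> cmeasurable g ->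
  rep f lam a -> rep g kap b -> exists lam' a', rep (f \+ g) lam' a' /\
    (hsum lam' <= hsum lam + hsum kap)%E.
Proof.
move=> mf mg Hf Hg; have [Ha hlam _] := Hf; have [Hb hkap _] := Hg.
have hmix : (hsum (interlace lam kap) <= hsum lam + hsum kap)%E.
  apply: hsum_le => N.
  rewrite (eq_bigr (interlace (fun j => cabs (lam j) `^ p) (fun j => cabs (kap j) `^ p))).
    by rewrite big_interlace EFinD; apply: leeD; exact: hsum_partial.
  by move=> i _; rewrite /interlace; case: ifP.
exists (interlace lam kap), (interlace a b); split=> //; apply: repI.
- by move=> j; rewrite /interlace; case: ifP.
- by apply: (le_lt_trans hmix); exact: lte_add_pinfty.
move=> e e0; have e2 : 0 < e / 2 by rewrite divr_gt0.
have [N1 HN1] := rep_cvg Hf e2; have [N2 HN2] := rep_cvg Hg e2.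
exists (maxn N1 N2).*2 => n nN.
have n1 : (N1 <= uphalf n)%N.
  by rewrite (leq_trans (leq_maxl N1 N2)) // -[X in (X <= _)%N]doubleK uphalf_half (leq_trans (half_leq nN)) // leq_addl.
have n2 : (N2 <= n./2)%N.
  by rewrite (leq_trans (leq_maxr N1 N2)) // -[X in (X <= _)%N]doubleK half_leq.
have -> : (f \+ g) \- psum (interlace lam kap) (interlace a b) n =
    (f \- psum lam a (uphalf n)) \+ (g \- psum kap b n./2).
  apply/funext => x /=.
  rewrite (eq_bigr (interlace (fun j => lam j * a j x) (fun j => kap j * b j x))).
    by rewrite big_interlace opprD addrACA.
  by move=> i _; rewrite /interlace; case: ifP.
rewrite [e](_ : _ = 2 * (e / 2)); last by field.
have [mfn _] := psum_cLp2 (uphalf n) Hf; have [mgn _] := psum_cLp2 n./2 Hg.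
apply: cLnorm2D_le; [exact: cmeasurableB|exact: cmeasurableB|exact: ltW|exact: HN1|exact: HN2].
Qed.

Lemma rep_tail f lam a N : rep f lam a ->
  rep (f \- psum lam a N) (fun j => lam (N + j)%N) (fun j => a (N + j)%N).
Proof.
move=> Hf; have [Ha hlam _] := Hf.
apply: repI => [j //||e e0].
  apply: le_lt_trans hlam; apply: hsum_le => K.
  apply: le_trans (hsum_partial _ (N + K)); rewrite lee_fin.
  rewrite (big_shift (fun j => cabs (lam j) `^ p)) lerBlDr lerDl.
  by apply: sumr_ge0 => j _; rewrite powR_ge0.
have [N1 HN1] := rep_cvg Hf e0; exists N1 => n nN.
have := HN1 (N + n)%N (leq_trans nN (leq_addl _ _)); congr (_ <= _)%E.
rewrite /cLnorm; congr Lnorm; apply/funext => x /=; congr (cabs _)%:E.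
by rewrite (big_shift (fun j => lam j * a j x)) opprB addrA subrK.
Qed.

Lemma hsum_tail lam (e : R) : (hsum lam < +oo)%E -> 0 < e ->
  exists N, (hsum (fun j => lam (N + j)%N) <= e%:E)%E.
Proof.
move=> hl e0; have hs : hsum lam = (fine (hsum lam))%:E.
  by rewrite fineK // ge0_fin_numE // hsum_ge0.
have [N HN] := hsum_approx hs e0; exists N; apply: hsum_le => K.
have : ((\sum_(0 <= j < N + K) cabs (lam j) `^ p)%:E <= hsum lam)%E by exact: hsum_partial.
rewrite hs !lee_fin (big_shift (fun j => cabs (lam j) `^ p)).
by move: HN; lra.
Qed.

(** Partial sums again have infinite decompositions, padded by zero
    coefficients on the remaining atoms. *)
Lemma rep_psum f lam a N : rep f lam a ->
  rep (psum lam a N) (fun j => if (j < N)%N then lam j else 0) a.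
Proof.
move=> Hf; have [Ha hlam _] := Hf; apply: repI => //.
  apply: le_lt_trans hlam; apply: hsum_le => K.
  apply: le_trans (hsum_partial _ K); rewrite lee_fin; apply: ler_sum => j _.
  by case: ifP => // _; rewrite cabs0 powR0 ?gt_eqF // powR_ge0.
move=> e e0; exists N => n nN; apply/cLnorm2_le; first exact: ltW.
rewrite (_ : (fun x => _) = (fun=> 0)).
  by rewrite rint_cst // mul0e lee_fin sqr_ge0.
apply/funext => x /=.
rewrite (big_cat_nat (leq0n N) nN) /= [X in _ - (_ + X)]big1_seq; last first.
  move=> j /andP[_]; rewrite mem_index_iota => /andP[Nj _].
  by rewrite ltnNge Nj /= mul0r.
rewrite addr0 [X in _ - X](_ : _ = \sum_(0 <= j < N) lam j * a j x).
  by rewrite subrr cabs0 expr0n.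
by rewrite !big_nat; apply: eq_bigr => j /andP[_ ->].
Qed.

Local Notation hat := (hardy_at mu L p m).
Local Notation hnorm := (hardy_norm mu L p m).

Lemma hat_linB f g : hat f -> hat g -> hat (f \- g).
Proof.
move=> [f2 [lam [a Hf]]] [g2 [kap [b Hg]]].
split; first exact: (linB (@cLp2_linear _ _ _ mu)).
have [[mf _] [mg _]] := (f2, g2).
have [lam' [a' [H _]]] := rep_add mf (cmeasurableN mg) Hf (rep_opp Hg).
by exists lam', a'.
Qed.

(** The p-th power of the Hardy quasi-norm; unlike the quasi-norm itself, it is
    subadditive for p < 1. *)
Definition hpow f : \bar R :=
  ereal_inf [set s | exists lam a, rep f lam a /\ s = hsum lam].

Lemma hpow_ge0 f : (0 <= hpow f)%E.
Proof. by apply: le_ereal_inf_tmp => _ [lam [a [_ ->]]]; exact: hsum_ge0. Qed.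

Lemma hpow_le f lam a : rep f lam a -> (hpow f <= hsum lam)%E.
Proof. by move=> H; apply: ereal_inf_lbound; exists lam, a. Qed.

Lemma hpow_lt f (s : \bar R) : (hpow f < s)%E ->
  exists lam a, rep f lam a /\ (hsum lam < s)%E.
Proof. by move=> /ereal_inf_lt[_ [lam [a [H ->]]] hs]; exists lam, a. Qed.

Lemma poweR_le (x y : \bar R) (r : R) : 0 <= r -> (0 <= x)%E -> (x <= y)%E ->
  (x `^ r <= y `^ r)%E.
Proof.
move=> r0 x0 xy; apply: gt0_ler_poweR => //; rewrite in_itv /= leey andbT //.
exact: le_trans xy.
Qed.

Lemma poweRK (x : \bar R) (r : R) : 0 < r -> (0 <= x)%E ->
  ((x `^ r) `^ r^-1 = x)%E.
Proof. by move=> r0 x0; rewrite -poweRrM mulfV ?gt_eqF // poweRe1. Qed.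

Lemma poweRVK (x : \bar R) (r : R) : 0 < r -> (0 <= x)%E ->
  ((x `^ r^-1) `^ r = x)%E.
Proof. by move=> r0 x0; rewrite -poweRrM mulVf ?gt_eqF // poweRe1. Qed.

Lemma hnormE f : hnorm f = (hpow f `^ p^-1)%E.
Proof.
have h0 : (0 <= hnorm f)%E.
  by apply: le_ereal_inf_tmp => _ [lam [a [_ ->]]]; exact: poweR_ge0.
apply/eqP; rewrite eq_le; apply/andP; split.
  rewrite -[leLHS](poweRK p0 h0) poweR_le ?poweR_ge0 // ?invr_ge0 ?(ltW p0) //.
  apply: le_ereal_inf_tmp => _ [lam [a [H ->]]].
  rewrite -(poweRVK p0 (hsum_ge0 lam)) poweR_le ?(ltW p0) //.
  by apply: ereal_inf_lbound; exists lam, a.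
apply: le_ereal_inf_tmp => _ [lam [a [H ->]]].
apply: poweR_le; rewrite ?invr_ge0 ?(ltW p0) ?hpow_ge0 //.
exact: hpow_le H.
Qed.

Lemma hnorm_ge0 f : (0 <= hnorm f)%E.
Proof. by rewrite hnormE poweR_ge0. Qed.

Lemma hnorm_le_hpow f (e : R) : 0 <= e ->
  (hnorm f <= e%:E)%E <-> (hpow f <= (e `^ p)%:E)%E.
Proof. by move=> e0; rewrite hnormE; apply: poweRV_le => //; exact: hpow_ge0. Qed.

Lemma hpowD f g : cmeasurable f -> cmeasurable g ->
  (hpow (f \+ g)%R <= hpow f + hpow g)%E.
Proof.
move=> mf mg.
have [f8|ffin] := eqVneq (hpow f) +oo%E.
  by rewrite f8 addye ?leey // gt_eqF // (lt_le_trans _ (hpow_ge0 g)).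
have [g8|gfin] := eqVneq (hpow g) +oo%E.
  by rewrite g8 addey ?leey // gt_eqF // (lt_le_trans _ (hpow_ge0 f)).
have fF : hpow f \is a fin_num by rewrite ge0_fin_numE ?hpow_ge0 // ltey.
have gF : hpow g \is a fin_num by rewrite ge0_fin_numE ?hpow_ge0 // ltey.
apply/lee_addgt0Pr => e e0; have e2 : 0 < e / 2 by rewrite divr_gt0.
have [|lam [a [Hf hf]]] := @hpow_lt f (hpow f + (e / 2)%:E)%E.
  by rewrite lteDl // lte_fin.
have [|kap [b [Hg hg]]] := @hpow_lt g (hpow g + (e / 2)%:E)%E.
  by rewrite lteDl // lte_fin.
have [lam' [a' [H h]]] := rep_add mf mg Hf Hg.
apply: (le_trans (hpow_le H)); apply: (le_trans h).
apply: (le_trans (leeD (ltW hf) (ltW hg))).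
by rewrite addeACA -EFinD -splitr.
Qed.

Lemma hpowN f : (hpow (fun x => - f x)%R <= hpow f)%E.
Proof.
apply: le_ereal_inf_tmp => _ [lam [a [/rep_opp H ->]]].
by apply: (le_trans (hpow_le H)); rewrite hsumN.
Qed.

Lemma hpow_distC f g : hpow (f \- g)%R = hpow (g \- f)%R.
Proof.
have E (u v : X -> R[i]) : u \- v = (fun x => - (v \- u) x).
  by apply/funext => x /=; rewrite opprB.
by apply/eqP; rewrite eq_le {1}E hpowN /= {1}E hpowN.
Qed.

Lemma hpow_triangle f g h : cmeasurable f -> cmeasurable g -> cmeasurable h ->
  (hpow (f \- h)%R <= hpow (f \- g)%R + hpow (g \- h)%R)%E.
Proof.
move=> mf mg mh; have -> : f \- h = (f \- g) \+ (g \- h).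
  by apply/funext => x /=; rewrite addrA subrK.
by apply: hpowD; exact: cmeasurableB.
Qed.

Lemma hpow_sub f g : cmeasurable f -> cmeasurable g ->
  (hpow f <= hpow g + hpow (f \- g)%R)%E.
Proof.
move=> mf mg; have {1}-> : f = g \+ (f \- g).
  by apply/funext => x /=; rewrite addrC subrK.
by apply: hpowD => //; exact: cmeasurableB.
Qed.

Lemma hat_hpow f : hat f -> (hpow f < +oo)%E.
Proof. by move=> [_ [lam [a H]]]; have [_ + _] := H; apply: le_lt_trans; exact: hpow_le H. Qed.

(** Zero coefficients are put on the atoms of f; without any f in the space
    there might be no atom at all. *)
Lemma hpow_self f g : hat f -> hpow (g \- g)%R = 0%E.
Proof.
move=> [_ [lam [a [Ha _ _]]]]; apply/eqP; rewrite eq_le hpow_ge0 andbT.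
have h0 : hsum (fun=> 0) = 0%E.
  by rewrite /hsum; apply: eseries0 => j _ _; rewrite cabs0 powR0 // gt_eqF.
have H : rep (g \- g) (fun=> 0) a.
  apply: repI => //; first by rewrite h0.
  move=> e e0; exists 0%N => n _; apply/cLnorm2_le; first exact: ltW.
  rewrite (_ : (fun x => _) = (fun=> 0)).
    by rewrite rint_cst // mul0e lee_fin sqr_ge0.
  apply/funext => x /=; rewrite subrr big1 ?subrr ?cabs0 ?expr0n //.
  by move=> j _; rewrite mul0r.
by apply: (le_trans (hpow_le H)); rewrite h0.
Qed.

Lemma hnorm_bound f (y : \bar R) (C : R) : 0 < C ->
  (forall lam a, rep f lam a -> y <= C%:E * hsum lam `^ p^-1)%E ->
  (y <= C%:E * hnorm f)%E.
Proof.
move=> C0 H; rewrite -ereal_inf_pZl //; apply: le_ereal_inf_tmp => _ [_ [lam [a [Hr ->]]] <-].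
exact: H Hr.
Qed.

(** The remainder of an atomic decomposition has the tail of the decomposition
    as an atomic decomposition. *)
Lemma hnorm_psum_approx f lam a (e : R) : rep f lam a -> 0 < e ->
  exists N, (hnorm (psum lam a N \- f)%R < e%:E)%E.
Proof.
move=> H e0; have [_ hl _] := H; have e2 : 0 < e / 2 by rewrite divr_gt0.
have [N HN] := hsum_tail hl (powR_gt0 p e2); exists N.
apply: (@le_lt_trans _ _ (e / 2)%:E); last first.
  by rewrite lte_fin ltr_pdivrMr // ltr_pMr // ltr1n.
apply/hnorm_le_hpow; first exact: ltW.
rewrite hpow_distC; apply: le_trans HN; exact: hpow_le (rep_tail N H).
Qed.

Lemma hardy_cauchy_hpow xi : hardy_cauchy mu L p m xi ->
  forall e : R, 0 < e -> exists N, forall k l, (N <= k)%N -> (N <= l)%N ->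
    (hpow (xi k \- xi l)%R <= e%:E)%E.
Proof.
move=> [_ H] e e0; have [N HN] := H (e `^ p^-1) (powR_gt0 _ e0).
exists N => k l kN lN; have /ltW/hnorm_le_hpow := HN k l kN lN.
by rewrite powRVK ?(ltW e0) //; apply; rewrite powR_ge0.
Qed.

(** Since the p-th power of the quasi-norm is subadditive, the quasi-norms of a
    Cauchy sequence converge. *)
Lemma hardy_lim_normP xi : hardy_cauchy mu L p m xi ->
  exists2 l : R, 0 <= l & hardy_lim_norm mu L p m xi = l%:E /\
    forall e : R, 0 < e -> exists N, forall k, (N <= k)%N ->
      (hpow (xi k) <= ((l + e) `^ p)%:E)%E.
Proof.
move=> Hxi; have [hxi _] := Hxi.
have mxi k : cmeasurable (xi k) by have [[]] := hxi k.
pose u k := fine (hpow (xi k)).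
have uE k : hpow (xi k) = (u k)%:E.
  by rewrite /u fineK // ge0_fin_numE ?hpow_ge0 // hat_hpow.
have u0 k : 0 <= u k by rewrite /u fine_ge0 // hpow_ge0.
have /cvg_ex[v uv] : cvgn u.
  apply: real_cauchy_cvg => e /(hardy_cauchy_hpow Hxi)[N HN].
  exists N => k l kN lN.
  have key i j : (N <= i)%N -> (N <= j)%N -> u i <= u j + e.
    move=> iN jN; rewrite -lee_fin EFinD -!uE.
    apply: (le_trans (hpow_sub (mxi i) (mxi j))); apply: leeD => //; exact: HN.
  have := key k l kN lN; have := key l k lN kN.
  by rewrite ler_norml => h1 h2; apply/andP; split; lra.
have v0 : 0 <= v.
  rewrite -(cvg_lim _ uv) //; apply: limr_ge; first by apply/cvg_ex; exists v.
  exact: nearW.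
pose l := v `^ p^-1; have l0 : 0 <= l by rewrite powR_ge0.
have lv : l `^ p = v by rewrite powRVK.
have upper (e : R) : 0 < e -> exists N, forall k, (N <= k)%N -> u k <= (l + e) `^ p.
  move=> e0; have d0 : 0 < (l + e) `^ p - v.
    by rewrite subr_gt0 -lv gt0_ltr_powR ?nnegrE ?addr_ge0 ?(ltW e0) // ltrDl.
  have /cvgrPdist_le/(_ _ d0)[N _ HN] := uv; exists N => k /HN /=.
  by rewrite ler_norml => /andP[h _]; move: h; lra.
have lower (e : R) : 0 < e -> exists N, forall k, (N <= k)%N -> l - e <= u k `^ p^-1.
  move=> e0; have [le0|le0] := leP (l - e) 0.
    by exists 0%N => k _; apply: (le_trans le0); rewrite powR_ge0.
  have d0 : 0 < v - (l - e) `^ p.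
    by rewrite subr_gt0 -lv gt0_ltr_powR ?nnegrE ?(ltW le0) // gtrDl oppr_lt0.
  have /cvgrPdist_le/(_ _ d0)[N _ HN] := uv; exists N => k /HN /=.
  rewrite ler_norml => /andP[_ h]; rewrite -[l - e](powRK p0 (ltW le0)).
  by rewrite ge0_ler_powR ?nnegrE ?powR_ge0 ?invr_ge0 ?(ltW p0) //; move: h; lra.
exists l => //; split; last first.
  by move=> e /upper[N HN]; exists N => k /HN; rewrite uE lee_fin.
rewrite /hardy_lim_norm; apply/cvg_lim => //.
have -> : (fun k => hnorm (xi k)) = EFin \o (fun k => u k `^ p^-1).
  by apply/funext => k; rewrite hnormE uE poweR_EFin.
apply/cvg_EFin; first exact: nearW.
apply/cvgrPdist_le => e e0; have [N1 H1] := upper e e0; have [N2 H2] := lower e e0.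
exists (maxn N1 N2) => // k; rewrite /mkset geq_max => /andP[/H1 h1 /H2 h2].
have h3 : u k `^ p^-1 <= l + e.
  rewrite -[l + e](powRK p0); last by rewrite addr_ge0 // ltW.
  by rewrite ge0_ler_powR ?nnegrE ?powR_ge0 ?invr_ge0 ?(ltW p0).
by rewrite /= ler_norml; apply/andP; split; lra.
Qed.

End Hardy.

(** * Extension to the completion *)

Section Extension.
Context {d : measure_display} {R : realType} {X : borelMetricType d R}.
Variable mu : {measure set X -> \bar R}.
Variables (L : @unbounded_op d R X) (p : R) (m : nat).
Hypothesis p0 : 0 < p.
Variables (D : set (X -> R[i])) (Op : (X -> R[i]) -> (X -> R[i]) -> Prop).
Variable Nm : (X -> R[i]) -> \bar R.
Hypothesis HN : fatou_quasinorm mu Nm.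
Local Notation hnorm := (hardy_norm mu L p m).
Local Notation hpow := (hpow mu L p m).

Hypothesis D_hat : D `<=` hardy_at mu L p m.
Hypothesis D_dense : forall f, hardy_at mu L p m f -> forall e : R, 0 < e ->
  exists2 g, D g & (hnorm (g \- f)%R < e%:E)%E.
Hypothesis Op_ex : forall f, D f -> exists h, Op f h.
Hypothesis Op_meas : forall f h, D f -> Op f h -> cmeasurable h.
Variable C : R.
Hypothesis C0 : 0 < C.
Hypothesis Op_bound : forall f h, D f -> Op f h -> (Nm h <= C%:E * hnorm f)%E.
Hypothesis Op_diff : forall f g h k, D f -> D g -> Op f h -> Op g k ->
  (Nm (h \- k)%R <= C%:E * hnorm (f \- g)%R)%E.

Lemma quasinorm_opp h : cmeasurable h -> Nm (fun x => - h x)%R = Nm h.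
Proof.
case: HN => _ mono _ _ _ mh; have mnh := cmeasurableN mh.
by apply/eqP; rewrite eq_le; apply/andP; split; apply: mono => //;
  apply: aeW => x; rewrite cabsN.
Qed.

Lemma Op_diff_small f g h k (e : R) : D f -> D g -> Op f h -> Op g k -> 0 <= e ->
  (hpow (f \- g)%R <= ((e / C) `^ p)%:E)%E -> (Nm (h \- k)%R <= e%:E)%E.
Proof.
move=> Df Dg fh gk e0 H; apply: (le_trans (Op_diff Df Dg fh gk)).
rewrite [e](_ : _ = C * (e / C)); last by rewrite mulrCA divff ?mulr1 // gt_eqF.
rewrite EFinM; apply: lee_wpmul2l; first by rewrite lee_fin ltW.
by apply/hnorm_le_hpow => //; rewrite divr_ge0 // ltW.
Qed.

(** A bounded operator with bounded differences on a dense subset extends to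
    the completion: images of Cauchy sequences are Cauchy in measure, hence
    have an almost everywhere limit, which the Fatou property controls. *)
Theorem extension :
  extends_boundedly mu L p m D Op [set h | cmeasurable h /\ (Nm h < +oo)%E] Nm.
Proof.
have [N0 mono fat cheb [K K0 tri]] := HN.
have Dm f : D f -> cmeasurable f by move=> /D_hat[[]].
have fin f h : D f -> Op f h -> (Nm h < +oo)%E.
  move=> Df fh; apply: (le_lt_trans (Op_bound Df fh)).
  rewrite lte_mul_pinfty ?lee_fin ?(ltW C0) //.
  by rewrite hnormE // poweR_lty // hat_hpow //; exact: D_hat.
split=> //; exists C => //; split=> [f h Df fh|xi Hxi].
  by split; [split; [exact: Op_meas fh|exact: fin fh]|exact: Op_bound].
have [hxi _] := Hxi.
have mxi k : cmeasurable (xi k) by have [[]] := hxi k.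
(* a sequence in D with the same limit as xi *)
have /choice[eta Heta] (k : nat) : exists g, D g /\ (hnorm (g \- xi k)%R < (k.+1%:R^-1)%:E)%E.
  have [|g Dg Hg] := D_dense (hxi k) (e := k.+1%:R^-1); first by rewrite invr_gt0.
  by exists g.
have Deta k : D (eta k) by case: (Heta k).
have meta k : cmeasurable (eta k) by exact: Dm.
have etaxi (e : R) : 0 < e -> exists N, forall k, (N <= k)%N ->
    (hpow (eta k \- xi k)%R <= e%:E)%E.
  move=> e0; have [N HNe] := ex_inv_succ_lt (powR_gt0 p^-1 e0).
  exists N => k kN; rewrite -[e](powRVK p0) ?(ltW e0) //.
  apply/hnorm_le_hpow; rewrite ?powR_ge0 //.
  case: (Heta k) => _ /ltW h; apply: (le_trans h); rewrite lee_fin.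
  apply: le_trans (ltW HNe); rewrite lef_pV2 ?posrE // ler_nat ltnS //.
have approx_eta : hardy_approx mu L p m D xi eta.
  split=> //; apply/cvge0P => [n|e e0]; first exact: hnorm_ge0.
  have [N HNe] := etaxi _ (powR_gt0 p e0); exists N => n /HNe h.
  by apply/hnorm_le_hpow => //; exact: ltW.
have eta_cauchy (e : R) : 0 < e -> exists N, forall k l, (N <= k)%N -> (N <= l)%N ->
    (hpow (eta k \- eta l)%R <= e%:E)%E.
  move=> e0; have e3 : 0 < e / 3 by rewrite divr_gt0.
  have [N1 H1] := etaxi _ e3; have [N2 H2] := hardy_cauchy_hpow p0 Hxi e3.
  exists (maxn N1 N2) => k l; rewrite !geq_max => /andP[k1 k2] /andP[l1 l2].
  apply: (le_trans (hpow_triangle mu L p m (meta k) (mxi k) (meta l))).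
  apply: (@le_trans _ _ ((e / 3)%:E + ((e / 3)%:E + (e / 3)%:E))%E).
    apply: leeD; first exact: H1.
    apply: (le_trans (hpow_triangle mu L p m (mxi k) (mxi l) (meta l))).
    by apply: leeD; [exact: H2|rewrite hpow_distC //; exact: H1].
  by rewrite -!EFinD lee_fin; lra.
have /choice[hs Hhs] (k : nat) : exists h, Op (eta k) h by exact: Op_ex.
have mhs k : cmeasurable (hs k) by exact: Op_meas (Hhs k).
have hs_cauchy (e : R) : 0 < e -> exists N, forall k l, (N <= k)%N -> (N <= l)%N ->
    (Nm (hs k \- hs l)%R <= e%:E)%E.
  move=> e0; have [N HNe] := eta_cauchy _ (powR_gt0 p (divr_gt0 e0 C0)).
  exists N => k l kN lN; apply: (Op_diff_small (Deta k) (Deta l)) => //; first exact: ltW.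
  exact: HNe.
(* the image of the limit is an almost everywhere limit of a subsequence *)
have [|g [phi [mg phi_ge gcvg]]] := cauchy_in_measure mhs (mu := mu).
  move=> e1 e2 e10 e20; have [e3 e30 H3] := cheb e1 e2 e10 e20.
  have [N HNe] := hs_cauchy e3 e30; exists N => k l kN lN.
  apply: (H3 (hs k \- hs l)); [exact: cmeasurableB|exact: HNe].
have hs_g (e : R) : 0 < e -> exists N, forall k, (N <= k)%N -> (Nm (hs k \- g)%R <= e%:E)%E.
  move=> e0; have [N HNe] := hs_cauchy e e0; exists N => k kN.
  apply: (fat (fun i => hs k \- hs (phi (N + i)%N))).
  - by move=> i; exact: cmeasurableB.
  - exact: cmeasurableB.
  - apply: filterS gcvg => x hx; apply: clim_sub_cst => e' /hx[N' HN'].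
    by exists N' => i iN'; apply: HN'; rewrite (leq_trans iN') // leq_addl.
  - by move=> i; apply: HNe => //; apply: leq_trans (phi_ge _); exact: leq_addr.
have gfin : (Nm g < +oo)%E.
  have [N HNe] := hs_g 1 ltr01.
  have -> : g = hs N \+ (fun x => - (hs N \- g) x).
    by apply/funext => x /=; rewrite opprB addrC subrK.
  have mB : cmeasurable (hs N \- g) by exact: cmeasurableB.
  apply: (le_lt_trans (tri _ _ (mhs N) (cmeasurableN mB))).
  rewrite lte_mul_pinfty ?lee_fin ?(ltW K0) // lte_add_pinfty //.
    exact: fin (Hhs N).
  rewrite (quasinorm_opp mB); apply: (le_lt_trans (HNe N (leqnn N))).
  by rewrite ltry.
exists g; split=> //.
- have [l l0 [-> lim_le]] := hardy_lim_normP p0 Hxi.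
  rewrite -EFinM; apply/lee_addgt0Pr => e e0.
  have eC : 0 < e / C by rewrite divr_gt0.
  have eC2 : 0 < e / C / 2 by rewrite divr_gt0.
  have [N1 H1] := lim_le _ eC2.
  have gap : 0 < (l + e / C) `^ p - (l + e / C / 2) `^ p.
    rewrite subr_gt0 gt0_ltr_powR ?nnegrE ?addr_ge0 ?(ltW eC) ?(ltW eC2) // ltrD2l.
    by rewrite ltr_pdivrMr // ltr_pMr // ltr1n.
  have [N2 H2] := etaxi _ gap.
  apply: (fat (fun i => hs (phi (maxn N1 N2 + i)%N))) => //.
    apply: filterS gcvg => x hx e' /hx[N' HN'].
    by exists N' => i iN'; apply: HN'; rewrite (leq_trans iN') // leq_addl.
  move=> i; set k := phi _.
  have : (maxn N1 N2 <= k)%N by apply: leq_trans (phi_ge _); exact: leq_addr.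
  rewrite geq_max => /andP[k1 k2].
  apply: (le_trans (Op_bound (Deta k) (Hhs k))).
  rewrite -EFinD (_ : C * l + e = C * (l + e / C)); last by field; rewrite gt_eqF.
  rewrite EFinM; apply: lee_wpmul2l; first by rewrite lee_fin ltW.
  apply/hnorm_le_hpow => //; first by rewrite addr_ge0 // ltW.
  apply: (le_trans (hpow_sub mu L p m (meta k) (mxi k))).
  apply: (le_trans (leeD (H1 k k1) (H2 k k2))).
  by rewrite -EFinD lee_fin addrC subrK.
- by exists eta.
(* any other sequence with this limit is asymptotically close to eta *)
- move=> eta' hs' [Deta' /cvge0P-/(_ (fun n => hnorm_ge0 mu L m p0 _)) Heta'] Hhs'.
  have meta' k : cmeasurable (eta' k) by exact: Dm.
  have mhs' k : cmeasurable (hs' k) by exact: Op_meas (Hhs' k).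
  apply/cvge0P => [n|e e0]; first exact: N0.
  have K2 : 0 < e / K / 2 by rewrite !divr_gt0.
  have [N1 H1] := hs_g _ K2.
  have q0 : 0 < (e / K / 2 / C) `^ p / 2 by rewrite divr_gt0 // powR_gt0 // divr_gt0.
  have [N2 H2] := etaxi _ q0.
  have [N3 H3] := Heta' _ (powR_gt0 p^-1 q0).
  exists (maxn N1 (maxn N2 N3)) => k; rewrite !geq_max => /and3P[k1 k2 k3].
  have -> : hs' k \- g = (hs' k \- hs k) \+ (hs k \- g).
    by apply/funext => x /=; rewrite addrA subrK.
  have mB1 : cmeasurable (hs' k \- hs k) by exact: cmeasurableB.
  have mB2 : cmeasurable (hs k \- g) by exact: cmeasurableB.
  apply: (le_trans (tri _ _ mB1 mB2)).
  rewrite [e](_ : _ = K * (e / K / 2 + e / K / 2)); last by field; rewrite gt_eqF.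
  rewrite EFinM; apply: lee_wpmul2l; first by rewrite lee_fin ltW.
  rewrite EFinD; apply: leeD; last exact: H1.
  apply: (Op_diff_small (Deta' k) (Deta k)) => //; first exact: ltW.
  apply: (le_trans (hpow_triangle mu L p m (meta' k) (mxi k) (meta k))).
  rewrite [X in (_ <= X%:E)%E]splitr EFinD; apply: leeD; last by rewrite hpow_distC //; exact: H2.
  rewrite -[X in (_ <= X%:E)%E](powRVK p0) ?(ltW q0) //.
  by apply/hnorm_le_hpow; rewrite ?powR_ge0 //; exact: H3.
Qed.

End Extension.

(** * Functions with decay on annuli *)

Section Annuli.
Context {d : measure_display} {R : realType} {X : borelMetricType d R}.
Variable mu : {measure set X -> \bar R}.
Implicit Types (x y z : X) (r s t : R).

Lemma measurable_annulus x r j : measurable (annulus x r j).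
Proof.
by case: j => [|j]; [exact: measurable_mball|apply: measurableD; exact: measurable_mball].
Qed.

Lemma annulus_sub x r j : annulus x r j `<=` ball x (2 ^+ j * r).
Proof. by case: j => [|j] y; [rewrite expr0 mul1r|case]. Qed.

Lemma rint_annuli x r (u : X -> R) (A K rho : R) : 0 < r ->
  measurable_fun setT u -> (forall y, 0 <= u y) -> 0 <= K -> 0 <= rho < 1 ->
  (rint mu (ball x (2 * r)) u <= A%:E)%E ->
  (forall j, (2 <= j)%N -> (rint mu (annulus x r j) u <= (K * rho ^+ j)%:E)%E) ->
  (rint mu setT u <= (A + K / (1 - rho))%:E)%E.
Proof.
move=> r0 mfu u0 K0 /andP[rho0 rho1] hA hj.
have rho10 : 0 < 1 - rho by rewrite subr_gt0.
have H N : (rint mu (ball x (2 ^+ N.+1 * r)) u <=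
    (A + K * (1 - rho ^+ N) / (1 - rho))%:E)%E.
  elim: N => [|N IH]; first by rewrite expr1 expr0 subrr mulr0 mul0r addr0.
  have mB := measurable_mball x (2 ^+ N.+1 * r).
  have mA := measurable_annulus x r N.+2.
  apply: (@le_trans _ _ (rint mu (ball x (2 ^+ N.+1 * r) `|` annulus x r N.+2) u)).
    apply: rint_subset => //; [exact: measurable_mball|exact: measurableU|].
    move=> y By; have [?|?] := pselect (ball x (2 ^+ N.+1 * r) y); first by left.
    by right.
  apply: (le_trans (rint_setU mu mB mA mfu u0)).
  apply: (le_trans (leeD IH (hj N.+2 isT))).
  rewrite -EFinD lee_fin -addrA lerD2l.
  have -> : K * (1 - rho ^+ N) / (1 - rho) + K * rho ^+ N.+2 =
    K * (1 - rho ^+ N.+1) / (1 - rho) - K * (rho ^+ N * (1 - rho ^+ 2)).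
    by rewrite !exprS; field; rewrite gt_eqF.
  rewrite gerBl mulr_ge0 // mulr_ge0 ?exprn_ge0 // subr_ge0.
  by rewrite expr_le1 // ltW.
apply: (rint_balls_le (x := x) r0) => // N.
apply: (@le_trans _ _ (rint mu (ball x (2 ^+ N.+1 * r)) u)).
  apply: rint_subset => //; try exact: measurable_mball.
  apply: ball_le; rewrite ler_pM2r // exprS ler_peMl ?exprn_ge0 // ler1n //.
apply: (le_trans (H N)); rewrite lee_fin lerD2l ler_pM2r ?invr_gt0 //.
by rewrite -[leRHS]mulr1 ler_wpM2l // gerBl exprn_ge0.
Qed.

Lemma powR_expn (a q : R) j : 0 <= a -> (a ^+ j) `^ q = (a `^ q) ^+ j.
Proof.
by move=> a0; rewrite -(powR_mulrn j a0) -(powR_mulrn j (powR_ge0 a q)) -!powRrM mulrC.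
Qed.

Variables (c n : R).
Hypothesis c0 : 0 < c.
Hypothesis growth : forall x r l, 0 < r -> 1 <= l ->
  (mu (ball x (l * r)) <= (c * l `^ n)%:E * mu (ball x r))%E.
Variable Cd : R.
Hypothesis Cd0 : 0 < Cd.
Hypothesis dbl : forall x r, 0 < r ->
  (mu (ball x (2 * r)) <= Cd%:E * mu (ball x r))%E /\ (mu (ball x r) < +oo)%E.
Hypothesis vpos : forall x r, 0 < r -> 0 < vol mu x r.
Local Notation V := (vol mu).
Local Notation sg := (2 `^ n).

Lemma sg0 : 0 < sg. Proof. exact: powR_gt0. Qed.

Lemma mball_pow2 x r j : 0 < r ->
  (mu (ball x (2 ^+ j * r)) <= (c * sg ^+ j * V x r)%:E)%E.
Proof.
move=> r0; apply: (le_trans (growth x r0 _)); first by rewrite exprn_ege1 // ler1n.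
by rewrite (volE dbl) // -EFinM powR_expn.
Qed.

Lemma mannulus x r j : 0 < r ->
  (mu (annulus x r j) <= (c * sg ^+ j * V x r)%:E)%E.
Proof.
move=> r0; apply: le_trans (mball_pow2 x j r0); apply: le_measure; rewrite ?inE.
- exact: measurable_annulus.
- exact: measurable_mball.
- exact: annulus_sub.
Qed.

Lemma powR_balance (p B tau v k : R) j : 0 < p -> 0 < B -> 0 < tau -> 0 < v -> 0 < k ->
  (B * tau ^+ j * v `^ (2^-1 - p^-1)) `^ p * (k * sg ^+ j * v) `^ (1 - p / 2) =
  B `^ p * k `^ (1 - p / 2) * (tau `^ p * sg `^ (1 - p / 2)) ^+ j.
Proof.
move=> p0 B0 tau0 v0 k0.
have [B1 c1 t1 v1 s1] := And5 (ltW B0) (ltW k0) (ltW tau0) (ltW v0) (ltW sg0).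
rewrite !powRM ?mulr_ge0 ?exprn_ge0 ?powR_ge0 //.
rewrite (powR_expn p j t1) (powR_expn _ j s1) exprMn.
have vv : (v `^ (2^-1 - p^-1)) `^ p * v `^ (1 - p / 2) = 1.
  rewrite -powRrM -powRD; last by rewrite (gt_eqF v0) implybT.
  rewrite (_ : _ + _ = 0) ?powRr0 //; first by field; rewrite gt_eqF.
by rewrite -[RHS]mulr1 -[X in _ = _ * X]vv; ring.
Qed.

(** Hoelder's inequality on each annulus turns the decay tau ^ j of the L^2 norms
    and the growth sg ^ j of the measures into a geometric series; the powers
    of the measure of the ball cancel. *)
Lemma decay_Lp (p B tau : R) : 0 < p <= 1 -> 0 < B -> 0 < tau ->
  tau `^ p * sg `^ (1 - p / 2) < 1 ->
  exists2 K : R, 0 < K & forall (F : X -> R[i]) x r, cmeasurable F -> 0 < r ->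
    (rint mu setT (fun y => cabs (F y) ^+ 2)%R <= ((B * V x r `^ (2^-1 - p^-1)) ^+ 2)%:E)%E ->
    (forall j, (2 <= j)%N -> (rint mu (annulus x r j) (fun y => cabs (F y) ^+ 2)%R <=
       ((B * tau ^+ j * V x r `^ (2^-1 - p^-1)) ^+ 2)%:E)%E) ->
    (rint mu setT (fun y => cabs (F y) `^ p)%R <= K%:E)%E.
Proof.
move=> /andP[p0 p1] B0 tau0 rho1; set rho := tau `^ p * _ in rho1.
have rho0 : 0 < rho by rewrite mulr_gt0 // powR_gt0 // sg0.
have p02 : 0 < p <= 2 by rewrite p0 (le_trans p1) // ler1n.
pose K0 := 2 * (B `^ p * c `^ (1 - p / 2)).
have K00 : 0 < K0 by rewrite !mulr_gt0 // powR_gt0.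
pose K1 := 2 * (B `^ p * (c * sg ^+ 1) `^ (1 - p / 2)).
have K10 : 0 < K1 by rewrite !mulr_gt0 ?powR_gt0 // mulr_gt0 // exprn_gt0 // sg0.
exists (K1 + K0 / (1 - rho)); first by rewrite addr_gt0 // divr_gt0 // subr_gt0.
move=> F x r mF r0 H0 Hj; have mcF := cmeasurable_cabs mF.
have v0 := vpos x r0; have s0 := sg0.
apply: (rint_annuli (x := x) (r := r)) => //.
- exact: measurable_powRf.
- by move=> y; exact: powR_ge0.
- exact: ltW.
- by rewrite (ltW rho0).
- have W0 : 0 < c * sg ^+ 1 * V x r by rewrite !mulr_gt0 // exprn_gt0.
  have A0 : 0 < B * V x r `^ (2^-1 - p^-1) by rewrite mulr_gt0 // powR_gt0.
  have mB := measurable_mball x (2 * r).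
  apply: le_trans (rint_interp mB mcF (fun y => cabs_ge0 _) p02 A0 W0 _ _) _.
  + apply: le_trans H0; apply: rint_subset => //; first exact: measurable_cabs2.
    by move=> y; exact: sqr_ge0.
  + by have := mball_pow2 x 1 r0; rewrite expr1.
  + rewrite lee_fin /K1 ler_pM2l // [in leLHS](_ : B = B * tau ^+ 0); last by rewrite expr0 mulr1.
    have k0 : 0 < c * sg ^+ 1 by rewrite mulr_gt0 // exprn_gt0.
    have := powR_balance 0 p0 B0 tau0 v0 k0.
    by rewrite !expr0 !mulr1 => ->.
- move=> j j2.
  have W0 : 0 < c * sg ^+ j * V x r by rewrite !mulr_gt0 // exprn_gt0.
  have A0 : 0 < B * tau ^+ j * V x r `^ (2^-1 - p^-1).
    by rewrite !mulr_gt0 ?exprn_gt0 ?powR_gt0.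
  have mB := measurable_annulus x r j.
  apply: le_trans (rint_interp mB mcF (fun y => cabs_ge0 _) p02 A0 W0 (Hj j j2) (mannulus x j r0)) _.
  by rewrite powR_balance // mulrA.
Qed.

Section Oscillation.
Variables (g : X -> R[i]) (be : X -> R -> R[i]) (M M2 : R).
Hypothesis mg : cmeasurable g.
Hypothesis M0 : 0 < M.
Hypothesis M20 : 0 < M2.
Hypothesis osc1 : forall x r, 0 < r ->
  (rint mu (ball x r) (fun y => cabs (g y - be x r))%R <= (M * V x r)%:E)%E.
Hypothesis osc2 : forall x r, 0 < r ->
  (rint mu (ball x r) (fun y => cabs (g y - be x r) ^+ 2)%R <= (M2 ^+ 2 * V x r)%:E)%E.

(** The means over a ball and over its double differ by at most M + M * Cd. *)
Lemma mean_growth x r j : 0 < r ->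
  cabs (be x (2 ^+ j * r) - be x r) <= j%:R * (M + M * Cd).
Proof.
move=> r0; elim: j => [|j IH]; first by rewrite expr0 mul1r subrr cabs0 mul0r.
have s0 : 0 < 2 ^+ j * r by rewrite mulr_gt0 // exprn_gt0.
have s20 : 0 < 2 ^+ j.+1 * r by rewrite mulr_gt0 // exprn_gt0.
have sE : 2 ^+ j.+1 * r = 2 * (2 ^+ j * r) by rewrite exprS mulrA.
apply: (le_trans (cabs_triangle (be x (2 ^+ j * r)) _ _)).
rewrite -(natr1 j) mulrDl mul1r addrC; apply: lerD => //; rewrite cabs_distC.
apply: (mean_dist dbl vpos mg osc1) => //.
apply: (@le_trans _ _ (rint mu (ball x (2 ^+ j.+1 * r)) (fun y => cabs (g y - be x (2 ^+ j.+1 * r)))%R)).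
  apply: rint_subset; try exact: measurable_mball; try exact: mdev; first by [].
  by apply: ball_le; rewrite sE ler_peMl ?ler1n // ltW.
apply: (le_trans (osc1 x s20)); rewrite lee_fin -mulrA ler_pM2l // sE.
exact: (vol_double dbl).
Qed.

(** The square oscillation around the mean over the ball of radius r, not over
    the large ball itself: the means over the two balls differ by O(j). *)
Lemma osc2_growth x r j : 0 < r ->
  (rint mu (ball x (2 ^+ j * r)) (fun y => cabs (g y - be x r) ^+ 2)%R <=
   (((2 * M2 + 2 * (M + M * Cd)) * (j.+1)%:R * Num.sqrt (c * sg ^+ j * V x r)) ^+ 2)%:E)%E.
Proof.
move=> r0; have s0 : 0 < 2 ^+ j * r by rewrite mulr_gt0 // exprn_gt0.
set s := 2 ^+ j * r in s0 *; pose b := j%:R * (M + M * Cd).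
have MM : 0 <= M + M * Cd by rewrite addr_ge0 ?mulr_ge0 // ltW.
have b0 : 0 <= b by rewrite mulr_ge0.
have mB := measurable_mball x s.
have m2 : measurable_fun setT (fun y => cabs (g y - be x s) ^+ 2).
  by apply: measurable_funX; exact: mdev.
apply: (@le_trans _ _ (rint mu (ball x s) (fun y => 2 * cabs (g y - be x s) ^+ 2 + 2 * b ^+ 2)%R)).
  apply: le_rint => //.
  - by apply: measurable_funX; exact: mdev.
  - apply: measurable_funD; last exact: measurable_cst.
    by apply: measurable_funM => //; exact: measurable_cst.
  - by move=> y; exact: sqr_ge0.
  - move=> y _; have -> : g y - be x r = (g y - be x s) + (be x s - be x r).
      by rewrite addrA subrK.
    apply: (le_trans (sqr_cabsD _ _)); rewrite lerD2l ler_wpM2l //.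
    by rewrite ler_sqr ?nnegrE //; exact: mean_growth.
rewrite rintD //; first last.
- by move=> y; rewrite mulr_ge0 // sqr_ge0.
- by move=> y; rewrite mulr_ge0 // sqr_ge0.
- by apply: measurable_funM => //; exact: measurable_cst.
rewrite rintZ //; last by move=> y; exact: sqr_ge0.
rewrite rint_cst // (volE dbl) //.
apply: (@le_trans _ _ (2%:E * (M2 ^+ 2 * V x s)%:E + (2 * b ^+ 2)%:E * (V x s)%:E)%E).
  by apply: leeD => //; apply: lee_wpmul2l; rewrite ?lee_fin //; exact: osc2.
have Vs : V x s <= c * sg ^+ j * V x r.
  by rewrite -lee_fin -(volE dbl) //; exact: mball_pow2.
rewrite -!EFinM -EFinD lee_fin [leRHS]exprMn sqr_sqrtr; last first.
  by rewrite (le_trans _ Vs) // vol_ge0.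
apply: (@le_trans _ _ (((2 * M2 + 2 * (M + M * Cd)) * j.+1%:R) ^+ 2 * V x s)); last first.
  by rewrite ler_wpM2l // sqr_ge0.
rewrite mulrA -mulrDl ler_wpM2r ?vol_ge0 //.
apply: (@le_trans _ _ ((2 * M2 + 2 * b) ^+ 2)).
  rewrite (_ : (2 * M2 + 2 * b) ^+ 2 = 4 * M2 ^+ 2 + 8 * (M2 * b) + 4 * b ^+ 2); last by ring.
  by have := mulr_ge0 (ltW M20) b0; have := sqr_ge0 M2; have := sqr_ge0 b; lra.
have M2_ge0 : 0 <= 2 * M2 by rewrite mulr_ge0 // ltW.
have h1 : 0 <= 2 * M2 + 2 * b by rewrite addr_ge0 // mulr_ge0.
have h2 : 0 <= (2 * M2 + 2 * (M + M * Cd)) * j.+1%:R.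
  by rewrite mulr_ge0 // addr_ge0 // mulr_ge0.
rewrite ler_sqr ?nnegrE //.
rewrite /b (mulrDl (2 * M2)); apply: lerD; first by rewrite ler_peMr // ler1n.
by rewrite -mulrA ler_wpM2l // mulrC ler_wpM2l // ler_nat.
Qed.

(** By Bernoulli's inequality; a factor j + 1 does not spoil geometric decay. *)
Lemma linear_le_geometric (rho : R) : 0 < rho -> rho < 1 ->
  exists eta K : R, [/\ 0 < eta, 0 < K, eta * rho < 1 &
    forall j : nat, j.+1%:R <= K * eta ^+ j].
Proof.
move=> r0 r1; pose e := (1 - rho) / 2.
have e0 : 0 < e by rewrite divr_gt0 // subr_gt0.
have e1 : e <= 1 by rewrite /e ler_pdivrMr //; lra.
have bern (j : nat) : 1 + j%:R * e <= (1 + e) ^+ j.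
  elim: j => [|j IH]; first by rewrite mul0r addr0 expr0.
  rewrite exprS; apply: (@le_trans _ _ ((1 + e) * (1 + j%:R * e))); last first.
    by rewrite ler_wpM2l // addr_ge0 // ltW.
  rewrite mulrS; have := mulr_ge0 (ler0n R j) (sqr_ge0 e); lra.
exists (1 + e), e^-1; split=> [|||j]; rewrite ?invr_gt0 ?addr_gt0 //.
  have : rho * (rho - 1) < 0 by rewrite nmulr_llt0 ?subr_lt0.
  have : (1 - rho) * (1 - rho) > 0 by rewrite mulr_gt0 // subr_gt0.
  by rewrite /e; lra.
rewrite ler_pdivlMl //; apply: le_trans (bern j).
by rewrite mulrS; move: e1; lra.
Qed.

(** The same decay, for p = 1, also beats the growth of the oscillation of a
    BMO function. *)
Lemma decay_osc (B tau : R) : 0 < B -> 0 < tau -> tau * Num.sqrt sg < 1 ->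
  exists2 K : R, 0 < K & forall (F : X -> R[i]) x r, cmeasurable F -> 0 < r ->
    (rint mu setT (fun y => cabs (F y) ^+ 2)%R <= ((B * V x r `^ (2^-1 - 1^-1)) ^+ 2)%:E)%E ->
    (forall j, (2 <= j)%N -> (rint mu (annulus x r j) (fun y => cabs (F y) ^+ 2)%R <=
       ((B * tau ^+ j * V x r `^ (2^-1 - 1^-1)) ^+ 2)%:E)%E) ->
    (rint mu setT (fun y => cabs (g y - be x r) * cabs (F y))%R <= K%:E)%E.
Proof.
move=> B0 tau0 rho1; have s0 := sg0; have ss0 : 0 < Num.sqrt sg by rewrite sqrtr_gt0.
have rho0 : 0 < tau * Num.sqrt sg by rewrite mulr_gt0.
have [eta [K1 [eta0 K10 er Kj]]] := linear_le_geometric rho0 rho1.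
pose Q := 2 * M2 + 2 * (M + M * Cd).
have Q0 : 0 < Q by rewrite addr_gt0 ?mulr_gt0 // addr_gt0 // mulr_gt0.
have sc0 : 0 < Num.sqrt c by rewrite sqrtr_gt0.
pose A := Q * 2%:R * Num.sqrt c * Num.sqrt sg * B.
have A0 : 0 < A by rewrite !mulr_gt0.
pose K0 := Q * K1 * Num.sqrt c * B.
have K00 : 0 < K0 by rewrite !mulr_gt0.
exists (A + K0 / (1 - eta * (tau * Num.sqrt sg))).
  by rewrite addr_gt0 // divr_gt0 // subr_gt0.
move=> F x r mF r0 H0 Hj; have mcF := cmeasurable_cabs mF.
have v0 := vpos x r0.
have sv0 : 0 < Num.sqrt (V x r) by rewrite sqrtr_gt0.
have vE : V x r `^ (2^-1 - 1^-1) = (Num.sqrt (V x r))^-1.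
  rewrite -powR12_sqrt ?(ltW v0) // -powRN; congr (_ `^ _); rewrite invr1; lra.
have mgb : measurable_fun setT (fun y => cabs (g y - be x r)) by exact: mdev.
have mgb2 : measurable_fun setT (fun y => cabs (g y - be x r) ^+ 2) by exact: measurable_funX.
have sqE j : Num.sqrt (c * sg ^+ j * V x r) = Num.sqrt c * Num.sqrt sg ^+ j * Num.sqrt (V x r).
  rewrite !sqrtrM ?mulr_ge0 ?exprn_ge0 ?(ltW c0) ?(ltW s0) //.
  rewrite (_ : Num.sqrt (sg ^+ j) = Num.sqrt sg ^+ j) //.
  elim: j => [|j IHj]; first by rewrite !expr0 sqrtr1.
  by rewrite !exprS sqrtrM ?(ltW s0) // IHj.
have sq0 j : 0 < Num.sqrt (c * sg ^+ j * V x r).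
  by rewrite sqrtr_gt0 !mulr_gt0 // exprn_gt0.
apply: (rint_annuli (x := x) (r := r)) => //.
- exact: measurable_funM.
- by move=> y; rewrite mulr_ge0.
- exact: ltW.
- by rewrite er mulr_ge0 // ltW.
- have B1 : 0 < Q * 2%:R * Num.sqrt (c * sg ^+ 1 * V x r) by rewrite !mulr_gt0.
  have B2 : 0 < B * V x r `^ (2^-1 - 1^-1) by rewrite mulr_gt0 // powR_gt0.
  have mB := measurable_mball x (2 * r).
  apply: le_trans (rint_CauchySchwarz mB mgb mcF (fun y => cabs_ge0 _) (fun y => cabs_ge0 _) B1 B2 _ _) _.
  + by have := osc2_growth x 1 r0; rewrite expr1.
  + apply: le_trans H0; apply: rint_subset => //; first exact: measurable_cabs2.
    by move=> y; exact: sqr_ge0.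
  + rewrite lee_fin vE sqE expr1 /A.
    rewrite (_ : _ * _ = Q * 2 * Num.sqrt c * Num.sqrt sg * B) //.
    by field; rewrite gt_eqF.
- move=> j j2.
  have B1 : 0 < Q * j.+1%:R * Num.sqrt (c * sg ^+ j * V x r) by rewrite !mulr_gt0.
  have B2 : 0 < B * tau ^+ j * V x r `^ (2^-1 - 1^-1).
    by rewrite !mulr_gt0 ?exprn_gt0 // powR_gt0.
  have mB := measurable_annulus x r j.
  apply: le_trans (rint_CauchySchwarz mB mgb mcF (fun y => cabs_ge0 _) (fun y => cabs_ge0 _) B1 B2 _ (Hj j j2)) _.
  + apply: le_trans (osc2_growth x j r0); apply: rint_subset => //.
      exact: measurable_mball.
      by move=> y; exact: sqr_ge0.
    exact: annulus_sub.
  + rewrite lee_fin vE sqE /K0.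
    rewrite [leLHS](_ : _ = Q * Num.sqrt c * B * (tau * Num.sqrt sg) ^+ j * j.+1%:R); last first.
      by rewrite exprMn; field; rewrite gt_eqF.
    rewrite [leRHS](_ : _ = Q * Num.sqrt c * B * (tau * Num.sqrt sg) ^+ j * (K1 * eta ^+ j)).
      rewrite ler_wpM2l // !mulr_ge0 ?exprn_ge0 ?mulr_ge0 ?(ltW Q0) ?(ltW B0) ?(ltW tau0) ?(ltW ss0) ?(ltW sc0) //.
    by rewrite [(eta * _) ^+ j]exprMn; ring.
Qed.

End Oscillation.
End Annuli.

(** * Boundedness from the Hardy space to L^p *)

Section AtomImages.
Context {d : measure_display} {R : realType} {X : borelMetricType d R}.
Variable mu : {measure set X -> \bar R}.
Variable L : @unbounded_op d R X.
Hypothesis HL : densely_defined_linear mu L.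
Variables (m : nat) (T : (X -> R[i]) -> (X -> R[i])).
Hypothesis HT : subadditive_on mu (cLp mu 2) T.
Hypothesis T2 : L2_bounded mu T.
Variable Cd : R.
Hypothesis Cd0 : 0 < Cd.
Hypothesis dbl : forall (x : X) (r : R), 0 < r ->
  (mu (ball x (2 * r)) <= Cd%:E * mu (ball x r))%E /\ (mu (ball x r) < +oo)%E.
Local Notation V := (vol mu).
Local Notation tau := (2 ^- (2 * m) : R).

Definition annular_decay (q B : R) : Prop :=
  forall (a : X -> R[i]) (x : X) (r : R) (j : nat), 0 < r ->
    ball_atom mu L q m a x r -> (2 <= j)%N ->
    (rint mu (annulus x r j) (fun y => cabs (T a y) ^+ 2)%R <=
     ((B * tau ^+ j * V x r `^ (2^-1 - q^-1)) ^+ 2)%:E)%E.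

Lemma annular_decayW (q B B' : R) : 0 <= B -> B <= B' ->
  annular_decay q B -> annular_decay q B'.
Proof.
move=> B0 BB' H a x r j r0 Ha j2; apply: (le_trans (H a x r j r0 Ha j2)).
have t0 : 0 <= tau ^+ j by rewrite exprn_ge0 // invr_ge0 exprn_ge0.
have v0 := powR_ge0 (V x r) (2^-1 - q^-1).
have B'0 := le_trans B0 BB'; have b1 := mulr_ge0 (mulr_ge0 B0 t0) v0.
have b2 := mulr_ge0 (mulr_ge0 B'0 t0) v0.
by rewrite lee_fin ler_sqr ?nnegrE // ler_wpM2r // ler_wpM2r.
Qed.

Section Positive.
Hypothesis vpos : forall (x : X) (r : R), 0 < r -> 0 < V x r.

(** By homogeneity: a (q,2,m)-atom is a multiple of a (p,2,m)-atom with the same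
    ball. *)
Lemma annular_decay_rescale (p q B : R) : 0 <= B -> annular_decay p B -> annular_decay q B.
Proof.
have [mT _ TZ] := HT.
move=> B0 H a x r j r0 Ha j2; have v0 := vpos x r0.
set s := V x r `^ (q^-1 - p^-1); have s0 : 0 < s by rewrite powR_gt0.
have Hsa := ball_atom_rescale HL r0 Ha p v0; rewrite -/s in Hsa.
have [[ma _] [msa _]] := (proj1 Ha, proj1 Hsa).
have mTa := mT _ (proj1 Ha); have mTsa := mT _ (proj1 Hsa).
have mA := measurable_annulus x r j.
apply: (@le_trans _ _ (rint mu (annulus x r j)
    (fun y => s^-1 ^+ 2 * cabs (T (s%:C \*o a) y) ^+ 2)%R)).
  apply: ae_le_rint => //.
  - exact: measurable_cabs2.
  - by apply: measurable_funM; [exact: measurable_cst|exact: measurable_cabs2].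
  - by move=> y; exact: sqr_ge0.
  - by move=> y; rewrite mulr_ge0 ?sqr_ge0.
  - have := TZ (s^-1)%:C _ (proj1 Hsa).
    have -> : (s^-1)%:C \*o (s%:C \*o a) = a.
      apply/funext => y /=; rewrite mulrA (_ : (s^-1)%:C * s%:C = 1) ?mul1r //.
      by rewrite -rmorphM mulVf ?gt_eqF // rmorph1.
    apply: filterS => y; rewrite cabs_real ger0_norm ?invr_ge0 ?(ltW s0) // => h _.
    by rewrite -exprMn ler_sqr ?nnegrE // mulr_ge0 // invr_ge0 ltW.
rewrite rintZ ?sqr_ge0 //; [|exact: measurable_cabs2|by move=> y; exact: sqr_ge0].
apply: (@le_trans _ _ ((s^-1 ^+ 2)%:E * ((B * tau ^+ j * V x r `^ (2^-1 - p^-1)) ^+ 2)%:E)%E).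
  by apply: lee_wpmul2l; [rewrite lee_fin sqr_ge0|exact: H Hsa j2].
rewrite -EFinM lee_fin -exprMn.
have -> : s^-1 * (B * tau ^+ j * V x r `^ (2^-1 - p^-1)) =
    B * tau ^+ j * V x r `^ (2^-1 - q^-1) => //.
have -> : 2^-1 - p^-1 = (q^-1 - p^-1) + (2^-1 - q^-1) by rewrite [RHS]addrC subrKA.
rewrite powRD; last by rewrite (gt_eqF v0) implybT.
by rewrite -/s; field; rewrite gt_eqF.
Qed.

(** A constant atom fits into the same scheme: a space of finite measure is
    bounded, so that the ball is the whole space and its annuli are empty. *)
Lemma atom_decay (q B : R) a : 0 < q -> 0 < B -> annular_decay q B ->
  (forall f (A : R), cLp mu 2 f -> 0 <= A ->
    (rint mu setT (fun x => cabs (f x) ^+ 2)%R <= (A ^+ 2)%:E)%E ->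
    (rint mu setT (fun x => cabs (T f x) ^+ 2)%R <= ((B * A) ^+ 2)%:E)%E) ->
  atom mu L q m a -> exists x r, 0 < r /\
   [/\ (rint mu setT (fun y => cabs (a y) ^+ 2)%R <= ((V x r `^ (2^-1 - q^-1)) ^+ 2)%:E)%E,
       {ae mu, forall y, ~ ball x r y -> a y = 0},
       (rint mu setT (fun y => cabs (T a y) ^+ 2)%R <= ((B * V x r `^ (2^-1 - q^-1)) ^+ 2)%:E)%E &
       forall j, (2 <= j)%N -> (rint mu (annulus x r j) (fun y => cabs (T a y) ^+ 2)%R <=
         ((B * tau ^+ j * V x r `^ (2^-1 - q^-1)) ^+ 2)%:E)%E].
Proof.
move=> q0 B0 HB TB Ha; have a2 := atom_cLp2 Ha.
case: (Ha) => [[x [r [r0 Hb]]]|[muT _ aE]].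
  exists x, r; split=> //; have n2 := ball_atom_norm HL r0 Hb.
  split=> //.
  - by apply: (negligible_off_esupp Cd0 dbl vpos (proj1 a2)); exact: (ball_atom_esupp HL Hb).
  - by apply: TB => //; exact: powR_ge0.
  - by move=> j; exact: HB.
have [x [r [r0 rX]]] := finite_bounded Cd0 dbl vpos muT.
have XE : ball x r = setT by apply/seteqP; split.
have VE : V x r = fine (mu setT) by rewrite /vol XE.
have mu0 : (0 < mu setT < +oo)%E.
  by rewrite muT andbT -XE (volE dbl) // lte_fin vpos.
have n2 := cst_atom_norm q0 Ha mu0 aE; rewrite -VE in n2.
exists x, r; split=> //; split=> //.
- exact: aeW.
- by apply: TB => //; exact: powR_ge0.
- move=> j j2; rewrite (_ : annulus x r j = set0).
    by rewrite /rint integral_set0 lee_fin sqr_ge0.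
  case: j j2 => // j _; apply/seteqP; split=> // y [_] []; apply: ball_le (rX y).
  by rewrite ler_peMl ?(ltW r0) // exprn_ege1 // ler1n.
Qed.

End Positive.

Lemma rint_null (D : set X) (u : X -> R) : mu setT = 0%E -> measurable D ->
  measurable_fun setT u -> (forall y, 0 <= u y) -> rint mu D u = 0%E.
Proof.
move=> mu0 mD mfu u0; apply/eqP; rewrite eq_le rint_ge0 // andbT.
apply: (@le_trans _ _ (rint mu D (fun=> 0)%R)).
  apply: ae_le_rint => //; exact: measure0_ae.
by rewrite rint_cst // mul0e.
Qed.

Variables (c n : R).
Hypothesis c0 : 0 < c.
Hypothesis n0 : 0 < n.
Hypothesis growth : forall (x : X) (r l : R), 0 < r -> 1 <= l ->
  (mu (ball x (l * r)) <= (c * l `^ n)%:E * mu (ball x r))%E.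

Let tau_gt0 : 0 < tau.
Proof. by rewrite invr_gt0 exprn_gt0. Qed.

Lemma tauE : tau = 2 `^ (- (2 * m)%:R).
Proof. by rewrite powRN powR_mulrn. Qed.

(** The condition on m says exactly that the decay wins over the growth. *)
Lemma decay_rate (p : R) : 0 < p <= 1 -> n * (2 - p) / (4 * p) < m%:R ->
  tau `^ p * (2 `^ n) `^ (1 - p / 2) < 1.
Proof.
move=> /andP[p0 p1] hm; rewrite tauE -!powRrM -powRD; last first.
  by rewrite (gt_eqF (ltr0Sn R 1)) implybT.
have e0 : - (2 * m)%:R * p + n * (1 - p / 2) < 0.
  move: hm; rewrite ltr_pdivrMr ?mulr_gt0 // natrM => hm.
  have : n * (2 - p) = 2 * (n * (1 - p / 2)) by field.
  have : m%:R * (4 * p) = 2 * (2 * m%:R * p) by ring.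
  by lra.
rewrite -[ltRHS](powRr0 2) lt_neqAle; apply/andP; split.
  by rewrite powRr0 powR_eq1 negb_or negb_or (lt_eqF e0) ltNge ler0n /= andbT pnatr_eq1.
by apply: ler_powR; [rewrite ler1n|exact: ltW].
Qed.

Lemma decay_rate1 (p : R) : 0 < p <= 1 -> n * (2 - p) / (4 * p) < m%:R ->
  tau * Num.sqrt (2 `^ n) < 1.
Proof.
move=> /andP[p0 p1] hm.
have hm1 : n * (2 - 1) / (4 * 1) < m%:R.
  apply: le_lt_trans hm; rewrite ler_pdivlMr ?mulr_gt0 //.
  rewrite (_ : _ * (4 * p) = n * p); last by field.
  by rewrite ler_pM2l //; lra.
have := decay_rate (p := 1) _ hm1; rewrite ltr01 lexx => /(_ isT).
rewrite powRr1 ?(ltW tau_gt0) // -powR12_sqrt ?powR_ge0 //.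
by rewrite (_ : 1 - 1 / 2 = 2^-1) //; field.
Qed.

(** If the whole space is a null set, the volumes of balls give no information,
    but all integrals vanish. *)
Lemma atom_image_Lp (p B : R) : 0 < p <= 1 -> n * (2 - p) / (4 * p) < m%:R ->
  0 < B -> annular_decay p B ->
  exists2 K : R, 0 < K & forall a, atom mu L p m a ->
    (rint mu setT (fun y => cabs (T a y) `^ p)%R <= K%:E)%E.
Proof.
move=> p01 hm B0 HB; have /andP[p0 p1] := p01; have [mT _ _] := HT.
have [vpos|mu0] := vol_gt0_or_null Cd0 dbl; last first.
  exists 1 => // a /atom_cLp2/mT mTa; rewrite rint_null ?lee_fin //.
    exact/measurable_powRf/cmeasurable_cabs.
  by move=> y; exact: powR_ge0.
have [C C0 HC] := L2_bounded_rint T2.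
pose B' := Num.max B C.
have B'0 : 0 < B' by rewrite lt_max B0.
have HB' : annular_decay p B' by apply: annular_decayW HB; rewrite ?(ltW B0) // le_max lexx.
have [K K0 HK] := decay_Lp c0 growth dbl vpos p01 B'0 tau_gt0 (decay_rate p01 hm).
exists K => // a Ha; have a2 := atom_cLp2 Ha.
have [|x [r [r0 [_ _ h1 h2]]]] := atom_decay vpos p0 B'0 HB' _ Ha; last first.
  by apply: HK h1 h2 => //; exact: mT.
move=> f A f2 A0 fA; apply: (le_trans (HC f A f2 A0 fA)); rewrite lee_fin.
rewrite ler_sqr ?nnegrE ?mulr_ge0 ?(ltW C0) ?(ltW B'0) //.
by rewrite ler_wpM2r // le_max lexx orbT.
Qed.

Section HardyToLp.
Variables (p K : R).
Hypothesis p01 : 0 < p <= 1.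
Hypothesis K0 : 0 < K.
Hypothesis HK : forall a, atom mu L p m a ->
  (rint mu setT (fun y => cabs (T a y) `^ p)%R <= K%:E)%E.

(** Although T need not be linear, |T f| is at most the sum of the |lam j T (a j)|
    almost everywhere, because T of the remainders tends to 0 in measure; as
    p <= 1, the p-th powers may be summed. *)
Lemma rep_image_Lp f lam a : cLp mu 2 f -> atomic_rep mu L p m f lam a ->
  (rint mu setT (fun x => cabs (T f x) `^ p)%R <= K%:E * hsum p lam)%E.
Proof.
have /andP[p0 p1] := p01; have [mT _ TZ] := HT.
move=> f2 Hf; have a2 := rep_meas Hf; have [Ha hl _] := Hf.
pose w j x := (cabs (lam j) * cabs (T (a j) x)) `^ p.
have w0 j x : 0 <= w j x by exact: powR_ge0.
have mw j : measurable_fun setT (w j).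
  apply: measurable_powRf; apply: measurable_funM; first exact: measurable_cst.
  exact/cmeasurable_cabs/mT.
have mTf := mT f f2.
have dom : {ae mu, forall x, ((cabs (T f x) `^ p)%:E <= \sum_(0 <= j <oo) (w j x)%:E)%E}.
  apply: ae_le_approx => e1 e2 e10 e20.
  have d0 : 0 < e1 `^ p^-1 by rewrite powR_gt0.
  have [e3 e30 H3] := L2_bounded_small T2 HT d0 e20.
  have [N HN] := rep_cvg Hf e30.
  have S2 := psum_cLp2 N Hf; set S := (fun x => _) in S2.
  have fS2 : cLp mu 2 (f \- S) by exact: (linB (@cLp2_linear _ _ _ mu)).
  exists [set x | e1 `^ p^-1 < cabs (T (f \- S) x)]; split.
  - by apply: measurable_gt; apply: cmeasurable_cabs; exact: mT.
  - by apply: H3 => //; exact: HN.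
  apply: filterS2 (subadditive_split HT f2 S2)
    (subadditive_sum (@cLp2_linear _ _ _ mu) HT lam N a2) => x h1 h2.
  have [h3|h3] := ltP (e1 `^ p^-1) (cabs (T (f \- S) x)); [by right|left].
  apply: (@le_trans _ _ ((\sum_(0 <= j < N) w j x) + e1)%:E); last first.
    rewrite EFinD; apply: leeD => //; rewrite -sumEFin.
    by apply: nneseries_lim_ge => j _ _; rewrite lee_fin.
  rewrite lee_fin; apply: (@le_trans _ _
      ((\sum_(0 <= j < N) cabs (lam j) * cabs (T (a j) x) + e1 `^ p^-1) `^ p)).
    rewrite ge0_ler_powR ?nnegrE ?(ltW p0) // ?addr_ge0 ?powR_ge0 //.
      by apply: sumr_ge0 => j _; rewrite mulr_ge0.
    by apply: (le_trans h1); rewrite lerD.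
  apply: le_trans (powR_subadd p01 _ _) _; rewrite ?powR_ge0 //.
    by apply: sumr_ge0 => j _; rewrite mulr_ge0.
  rewrite powRVK ?(ltW e10) // lerD2r; apply: powR_sum_subadd => // j.
  by rewrite mulr_ge0.
apply: (@le_trans _ _ (\int[mu]_x (\sum_(0 <= j <oo) (w j x)%:E))%E).
  apply: ae_ge0_le_integral => //.
  - by move=> x _; rewrite lee_fin powR_ge0.
  - by apply: meas_EFin; apply: measurable_powRf; exact: cmeasurable_cabs.
  - by move=> x _; apply: nneseries_ge0 => j _ _; rewrite lee_fin.
  - apply: ge0_emeasurable_sum => [j x _ _|j _]; first by rewrite lee_fin.
    exact: meas_EFin.
  - by apply: filterS dom => x h _.
rewrite integral_nneseries //; [|by move=> j; exact: meas_EFin|by move=> j x _; rewrite lee_fin].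
rewrite /hsum -nneseriesZl; last by move=> j _; rewrite lee_fin powR_ge0.
apply: lee_nneseries => [j _ _|j _].
  by apply: integral_ge0 => x _; rewrite lee_fin.
have mTa := mT _ (a2 j).
rewrite -[leLHS]/(rint mu setT (w j)).
rewrite (_ : w j = fun x => cabs (lam j) `^ p * cabs (T (a j) x) `^ p); last first.
  by apply/funext => x; rewrite /w powRM.
rewrite rintZ ?powR_ge0 //; [|exact/measurable_powRf/cmeasurable_cabs|by move=> x; exact: powR_ge0].
rewrite muleC; apply: lee_wpmul2r; first by rewrite lee_fin powR_ge0.
exact: HK.
Qed.

Lemma hardy_image_Lp f : hardy_at mu L p m f ->
  (cLnorm mu p (T f) <= (K `^ p^-1)%:E * hardy_norm mu L p m f)%E.
Proof.
have /andP[p0 p1] := p01.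
move=> [f2 _]; apply: hnorm_bound => [|lam a Hf]; first by rewrite powR_gt0.
rewrite cLnormE -poweR_EFin -poweRM ?lee_fin ?(ltW K0) ?hsum_ge0 //.
apply: poweR_le; rewrite ?invr_ge0 ?(ltW p0) ?rint_cabs_ge0 //.
exact: rep_image_Lp Hf.
Qed.

Theorem hardy_to_Lp : extends_boundedly mu L p m (hardy_at mu L p m)
  (fun f h => h = T f) (cLp mu p) (cLnorm mu p).
Proof.
have /andP[p0 p1] := p01; have [mT Tdiff _] := HT.
have [_ mono _ _ _] := cLnorm_fatou_quasinorm mu p01.
apply: (@extension _ _ _ mu L p m p0 _ _ (cLnorm mu p)
  (cLnorm_fatou_quasinorm mu p01) _ _ _ _ (K `^ p^-1)) => //.
- move=> f Hf e e0; exists f => //.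
  by rewrite hnormE // (hpow_self p0 f Hf) poweR0r ?invr_eq0 ?gt_eqF // lte_fin.
- by move=> f _; exists (T f).
- by move=> f h [f2 _] ->; exact: mT.
- by rewrite powR_gt0.
- by move=> f h Hf ->; exact: hardy_image_Lp.
- move=> f g h k Hf Hg -> ->; have Hfg := hat_linB Hf Hg.
  apply: le_trans (hardy_image_Lp Hfg); apply: mono.
  + by apply: cmeasurableB; apply: mT; [case: Hf|case: Hg].
  + by apply: mT; case: Hfg.
  + by apply: Tdiff; [case: Hf|case: Hg].
Qed.

End HardyToLp.
End AtomImages.

(** * Commutators *)

Section Countable.
Context {d : measure_display} {R : realType} {X : borelMetricType d R}.
Variable mu : {measure set X -> \bar R}.

Lemma ae_forall_countable (I : countType) (P : I -> X -> Prop) :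
  (forall i, {ae mu, forall x, P i x}) -> {ae mu, forall x, forall i, P i x}.
Proof.
move=> H; have : {ae mu, forall x, forall n, forall i, unpickle n = Some i -> P i x}.
  apply: ae_foralln => n; case E : (@unpickle I n) => [i|]; last by apply: aeW.
  by apply: filterS (H i) => x Pix j [<-].
by apply: filterS => x h i; apply: h (pickle i) i (pickleK i).
Qed.

Lemma measurable_countable_choice (I : countType) (G : I -> X -> R) (s : X -> I) :
  (forall i, measurable_fun setT (G i)) -> (forall i, measurable [set x | s x = i]) ->
  measurable_fun setT (fun x => G (s x) x).
Proof.
move=> mG ms _ A mA; rewrite setTI.
rewrite (_ : _ @^-1` A = \bigcup_n
  (if @unpickle I n is Some i then [set x | s x = i] `&` (G i @^-1` A) else set0)).
  apply: bigcupT_measurable => n; case: unpickle => [i|] //.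
  by apply: measurableI => //; rewrite -[X in measurable X]setTI; exact: mG.
apply/seteqP; split=> x.
  by move=> Ax; exists (pickle (s x)) => //; rewrite pickleK.
by move=> [n _]; case: unpickle => [i|] // [/= <-].
Qed.

Lemma measurable_floor_eq (u : X -> R) (z : int) : measurable_fun setT u ->
  measurable [set x | Num.floor (u x) = z].
Proof.
move=> mfu; rewrite (_ : [set x | _] = u @^-1` `[z%:~R, (z + 1)%:~R[%classic).
  by rewrite -[X in measurable X]setTI; exact: mfu.
apply/seteqP; split=> x /=; rewrite in_itv /=.
  by move=> <-; rewrite floor_le_tmp floorD1_gt.
by move=> h; apply: floor_def.
Qed.

Definition crat (q : rat * rat) : R[i] := ratr q.1 +i* ratr q.2.

Definition rat_approx (i : nat) (z : int * int) : rat * rat :=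
  (z.1%:~R / i.+1%:R, z.2%:~R / i.+1%:R).

Lemma rat_approx_close (i : nat) (w : R[i]) :
  cabs (crat (rat_approx i (Num.floor (i.+1%:R * complex.Re w),
     Num.floor (i.+1%:R * complex.Im w))) - w) <= 2 * i.+1%:R^-1.
Proof.
have key (t : R) : `|ratr ((Num.floor (i.+1%:R * t))%:~R / i.+1%:R) - t| <= i.+1%:R^-1.
  rewrite rmorphM fmorphV rmorph_int rmorph_nat.
  have i0 : 0 < i.+1%:R :> R by [].
  have h1 := floor_le_tmp (i.+1%:R * t); have h2 := floorD1_gt (i.+1%:R * t).
  rewrite -(ler_pM2l i0) -{1}(gtr0_norm i0) -normrM mulrBr mulrCA divff ?gt_eqF // mulr1.
  move: h2; rewrite rmorphD /= => h2.
  by rewrite ler_norml; apply/andP; split; lra.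
apply: (le_trans (cabs_le_ReIm _)); rewrite ReB ImB /=.
have -> : 2 * (i.+1%:R^-1 : R) = i.+1%:R^-1 + i.+1%:R^-1 by rewrite mulr_natl mulr2n.
by apply: lerD; exact: key.
Qed.

Lemma crat_dense (w : R[i]) (e : R) : 0 < e -> exists q, cabs (crat q - w) < e.
Proof.
move=> e0; have [k ke] := ex_inv_succ_lt (divr_gt0 e0 (ltr0Sn R 1)).
eexists; apply: (le_lt_trans (rat_approx_close k w)).
by move: ke; rewrite ltr_pdivlMr // mulrC.
Qed.

End Countable.

Section Commutator.
Context {d : measure_display} {R : realType} {X : borelMetricType d R}.
Variable mu : {measure set X -> \bar R}.
Variables (T : (X -> R[i]) -> (X -> R[i])) (b : X -> R[i]).
Hypothesis HT : subadditive_on mu (cL1_plus_L2 mu) T.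
Hypothesis mb : cmeasurable b.
Local Notation L12 := (cL1_plus_L2 mu).
Local Notation Fc f c := (fun y => (c - b y) * f y).

(** The functions f for which every T ((c - b) f) makes sense. *)
Definition admissible (f : X -> R[i]) : Prop :=
  L12 f /\ forall c : R[i], L12 (Fc f c).

Lemma admissibleB f g : admissible f -> admissible g -> admissible (f \- g).
Proof.
move=> [f12 Hf] [g12 Hg]; have linL := @cL12_linear _ _ _ mu.
split; first exact: linB.
move=> c; have -> : Fc (f \- g) c = Fc f c \- Fc g c.
  by apply/funext => y /=; rewrite mulrBr.
exact: linB.
Qed.

(** (c - b) f and (c' - b) f differ by (c - c') f, and T is homogeneous. *)
Lemma commutator_lipschitz f : admissible f ->
  {ae mu, forall x, forall q q' : rat * rat,
     cabs (T (Fc f (crat q)) x - T (Fc f (crat q')) x) <=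
     cabs (crat q - crat q' : R[i]) * cabs (T f x)}.
Proof.
move=> [f12 Hf]; have [_ Td TZ] := HT.
have : {ae mu, forall x, forall qq : (rat * rat) * (rat * rat),
     cabs (T (Fc f (crat qq.1)) x - T (Fc f (crat qq.2)) x) <=
     cabs (crat qq.1 - crat qq.2 : R[i]) * cabs (T f x)}.
  apply: ae_forall_countable => -[q q'] /=.
  have := TZ (crat q - crat q') f f12.
  have -> : (crat q - crat q') \*o f = Fc f (crat q) \- Fc f (crat q').
    by apply/funext => y /=; rewrite -mulrBl opprB addrA subrK.
  move=> h1; apply: filterS2 h1 (Td _ _ (Hf (crat q)) (Hf (crat q'))) => x h1 h2.
  exact: le_trans h2 h1.
by apply: filterS => x h q q'; exact: h (q, q').
Qed.

(** By the Lipschitz bound T ((c - b) f) (x) converges as c tends to b(x); the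
    limit is measurable because c may be taken to be b(x) rounded down to
    multiples of 1 / (i + 1), which takes countably many values. *)
Lemma commutator_exists f : admissible f -> exists g, is_commutator mu b T f g.
Proof.
move=> Hf; have [f12 HFc] := Hf; have [mT Td TZ] := HT.
pose s i (x : X) : int * int := (Num.floor (i.+1%:R * complex.Re (b x)),
   Num.floor (i.+1%:R * complex.Im (b x))).
pose ap i x := rat_approx i (s i x).
have ms i z : measurable [set x | s i x = z].
  rewrite (_ : [set x | _] = [set x | Num.floor (i.+1%:R * complex.Re (b x)) = z.1] `&`
     [set x | Num.floor (i.+1%:R * complex.Im (b x)) = z.2]).
    case: mb => mbr mbi; apply: measurableI; apply: measurable_floor_eq;
      by apply: measurable_funM => //; exact: measurable_cst.
  by apply/seteqP; split=> x; rewrite /s; case: z => z1 z2 /=; [case=> -> ->|case=> -> ->].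
pose H i x := T (Fc f (crat (ap i x))) x.
have mH i : cmeasurable (H i).
  split.
  - apply: (measurable_countable_choice
      (G := fun z x => complex.Re (T (Fc f (crat (rat_approx i z))) x))) => // z.
    by case: (mT _ (HFc (crat (rat_approx i z)))).
  - apply: (measurable_countable_choice
      (G := fun z x => complex.Im (T (Fc f (crat (rat_approx i z))) x))) => // z.
    by case: (mT _ (HFc (crat (rat_approx i z)))).
have [g mg Hg] := measurable_complex_limit mH.
exists g; split=> //; apply: filterS (commutator_lipschitz Hf) => x lip.
set t := cabs (T f x) in lip.
have t0 : 0 <= t by exact: cabs_ge0.
have close i : cabs (crat (ap i x) - b x) <= 2 * i.+1%:R^-1.
  exact: rat_approx_close.
have small (e : R) : 0 < e -> exists N, forall i, (N <= i)%N ->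
    cabs (crat (ap i x) - b x) * t <= e.
  move=> e0; have q0 : 0 < e / (2 * (t + 1)) by rewrite divr_gt0 // mulr_gt0 // ltr_wpDl.
  have [N HN] := ex_inv_succ_lt q0; exists N => i Ni.
  have iN : i.+1%:R^-1 <= N.+1%:R^-1 :> R by rewrite lef_pV2 ?posrE // ler_nat ltnS.
  have : cabs (crat (ap i x) - b x) <= e / (t + 1).
    apply: (le_trans (close i)).
    have -> : e / (t + 1) = 2 * (e / (2 * (t + 1))) by field; rewrite gt_eqF // ltr_wpDl.
    by rewrite ler_wpM2l // (le_trans iN) // ltW.
  rewrite ler_pdivlMr ?ltr_wpDl //; apply: le_trans.
  by rewrite mulrDr mulr1 lerDl.
have cH : ccauchy (H ^~ x).
  move=> e e0; have [N HN] := small (e / 2) (divr_gt0 e0 (ltr0Sn _ 1)).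
  exists N => i j Ni Nj; apply: (le_trans (lip _ _)).
  apply: (@le_trans _ _ (cabs (crat (ap i x) - b x) * t + cabs (crat (ap j x) - b x) * t)).
    rewrite -mulrDl ler_wpM2r // [cabs (crat (ap j x) - b x)]cabs_distC.
    exact: cabs_triangle.
  by rewrite [e]splitr lerD // HN.
have gx := Hg x cH.
move=> e e0; have e4 : 0 < e / 4 by rewrite divr_gt0.
have [N1 HN1] := small _ e4; have [N2 HN2] := gx _ e4.
exists (e / 4 / (t + 1)); first by rewrite divr_gt0 // ltr_wpDl.
move=> q1 q2 /=; rewrite -[_ +i* _]/(crat (q1, q2)) => cq.
pose i := maxn N1 N2.
apply: (le_lt_trans (cabs_triangle (H i x) _ _)).
have h2 := HN2 i (leq_maxr _ _).
have h1 : cabs (T (Fc f (crat (q1, q2))) x - H i x) <= e / 4 + e / 4.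
  apply: (le_trans (lip _ _)).
  apply: (@le_trans _ _ (cabs (crat (q1, q2) - b x) * t + cabs (crat (ap i x) - b x) * t)).
    rewrite -mulrDl ler_wpM2r // [cabs (crat (ap i x) - b x)]cabs_distC.
    exact: cabs_triangle.
  apply: lerD; last exact: HN1 (leq_maxl _ _).
  move: cq; rewrite ltr_pdivlMr ?ltr_wpDl // => /ltW; apply: le_trans.
  by rewrite mulrDr mulr1 lerDl.
by move: h1 h2; lra.
Qed.

(** The commutator at x is a limit along complex rationals, so estimates for
    all of these at once pass to it. *)
Lemma commutator_le f g (x : X) (A Z : R) :
  (forall e : R, 0 < e -> exists2 del : R, 0 < del &
     forall q1 q2 : rat, let c : R[i] := ratr q1 +i* ratr q2 in
       cabs (c - b x) < del ->
       cabs (T (fun y => (c - b y) * f y) x - g x) < e) ->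
  0 <= Z ->
  (forall q, cabs (T (Fc f (crat q)) x) <= A + cabs (crat q - b x) * Z) ->
  cabs (g x) <= A.
Proof.
move=> lim Z0 H; apply/ler_addgt0Pr => e e0.
have e2 : 0 < e / 2 by rewrite divr_gt0.
have Z1 : 0 < Z + 1 by rewrite ltr_wpDl.
have [del del0 Hdel] := lim _ e2.
have d0 : 0 < Num.min del (e / 2 / (Z + 1)) by rewrite lt_min del0 divr_gt0.
have [[q1 q2] Hq] := crat_dense (b x) d0; move: Hq; rewrite lt_min => /andP[c1 c2].
have h1 := Hdel q1 q2 c1; have h2 := H (q1, q2).
have h3 : cabs (crat (q1, q2) - b x) * Z <= e / 2.
  move: c2; rewrite ltr_pdivlMr // => /ltW; apply: le_trans.
  by rewrite mulrDr mulr1 lerDl.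
have := cabs_dist_le (g x) (T (Fc f (crat (q1, q2))) x).
rewrite cabs_distC => /(le_trans (ler_norm _)).
by move: h1 h2 h3; rewrite /crat /=; lra.
Qed.

(** For nonlinear T the commutator of f - g is not the difference of the
    commutators, but it dominates that difference. *)
Lemma commutator_diff f g h k : admissible f -> admissible g ->
  is_commutator mu b T f h -> is_commutator mu b T g k ->
  exists2 l, is_commutator mu b T (f \- g) l &
    {ae mu, forall x, cabs (h x - k x) <= cabs (l x)}.
Proof.
move=> Hf Hg [mh lh] [mk lk]; have Hfg := admissibleB Hf Hg.
have [l [ml ll]] := commutator_exists Hfg; exists l => //.
have [_ Td _] := HT; have [_ HFf] := Hf; have [_ HFg] := Hg.
have diff : {ae mu, forall x, forall q : rat * rat,
    cabs (T (Fc f (crat q)) x - T (Fc g (crat q)) x) <= cabs (T (Fc (f \- g) (crat q)) x)}.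
  apply: ae_forall_countable => q.
  have := Td _ _ (HFf (crat q)) (HFg (crat q)).
  have -> // : Fc f (crat q) \- Fc g (crat q) = Fc (f \- g) (crat q).
  by apply/funext => y /=; rewrite mulrBr.
apply: filterS2 diff (filterI lh (filterI lk ll)) => x D [h1 [k1 l1]].
apply/ler_addgt0Pr => e e0; have e3 : 0 < e / 3 by rewrite divr_gt0.
have [d1 d10 H1] := h1 _ e3; have [d2 d20 H2] := k1 _ e3; have [d3 d30 H3] := l1 _ e3.
have d0 : 0 < Num.min d1 (Num.min d2 d3) by rewrite !lt_min d10 d20.
have [[q1 q2] Hq] := crat_dense (b x) d0; move: Hq; rewrite !lt_min => /and3P[c1 c2 c3].
have := H1 q1 q2 c1; have := H2 q1 q2 c2; have := H3 q1 q2 c3.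
have := D (q1, q2); rewrite /crat /=; set c := _ +i* _.
set tf := T (Fc f c) x; set tg := T (Fc g c) x; set tfg := T _ x.
move=> h0 hl hk hh.
have := cabs_triangle tf (h x) (k x); have := cabs_triangle tg tf (k x).
have := cabs_dist_le tfg (l x) => /(le_trans (ler_norm _)).
by move: hh; rewrite cabs_distC; lra.
Qed.

End Commutator.

(** * The weak-type estimate for the commutator *)

Section Multiplication.
Context {d : measure_display} {R : realType} {X : borelMetricType d R}.
Variable mu : {measure set X -> \bar R}.
Implicit Types f g h : X -> R[i].

Lemma rint_off (B : set X) (u : X -> R) : measurable B ->
  measurable_fun setT u -> (forall y, 0 <= u y) ->
  {ae mu, forall y, ~ B y -> u y = 0} -> (rint mu setT u <= rint mu B u)%E.
Proof.
move=> mB mfu u0 H; have mC := measurableC mB.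
rewrite -(setUv B); apply: (le_trans (rint_setU mu mB mC mfu u0)).
rewrite -[leRHS]adde0; apply: leeD => //.
apply: (@le_trans _ _ (rint mu (~` B) (fun=> 0)%R)).
  by apply: ae_le_rint => //; apply: filterS H => y h By; rewrite h.
by rewrite rint_cst // mul0e.
Qed.

Lemma cLp2_bounded_mul (u f : X -> R[i]) (K : R) : cmeasurable u -> 0 <= K ->
  (forall y, cabs (u y) <= K) -> cLp mu 2 f -> cLp mu 2 (u \* f).
Proof.
move=> mfu K0 uK /cLp2P[mf f2]; apply/cLp2P; split; first exact: cmeasurableM.
apply: (@le_lt_trans _ _ ((K ^+ 2)%:E * rint mu setT (fun x => cabs (f x) ^+ 2)%R)%E).
  rewrite -rintZ ?sqr_ge0 //; [|exact: measurable_cabs2|by move=> y; exact: sqr_ge0].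
  apply: le_rint => //.
  - by apply: measurable_cabs2; exact: cmeasurableM.
  - by apply: measurable_funM; [exact: measurable_cst|exact: measurable_cabs2].
  - by move=> y; exact: sqr_ge0.
  - by move=> y _; rewrite cabsM exprMn ler_wpM2r ?sqr_ge0 // ler_sqr ?nnegrE.
by rewrite lte_mul_pinfty // lee_fin sqr_ge0.
Qed.

Lemma cLnorm2_bounded_mul (u f : X -> R[i]) (K e : R) : cmeasurable u -> 0 <= K -> 0 <= e ->
  (forall y, cabs (u y) <= K) -> cmeasurable f -> (cLnorm mu 2 f <= e%:E)%E ->
  (cLnorm mu 2 (u \* f)%R <= (K * e)%:E)%E.
Proof.
move=> mfu K0 e0 uK mf /cLnorm2_le -/(_ e0) fe.
apply/cLnorm2_le; first exact: mulr_ge0.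
apply: (@le_trans _ _ ((K ^+ 2)%:E * rint mu setT (fun x => cabs (f x) ^+ 2)%R)%E).
  rewrite -rintZ ?sqr_ge0 //; [|exact: measurable_cabs2|by move=> y; exact: sqr_ge0].
  apply: le_rint => //.
  - by apply: measurable_cabs2; exact: cmeasurableM.
  - by apply: measurable_funM; [exact: measurable_cst|exact: measurable_cabs2].
  - by move=> y; exact: sqr_ge0.
  - by move=> y _; rewrite cabsM exprMn ler_wpM2r ?sqr_ge0 // ler_sqr ?nnegrE.
by rewrite exprMn [leRHS]EFinM; apply: lee_wpmul2l => //; rewrite lee_fin sqr_ge0.
Qed.

Lemma rint_sum_le (u : nat -> X -> R) (l : nat -> R) (K : R) N :
  (forall j, measurable_fun setT (u j)) -> (forall j x, 0 <= u j x) ->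
  (forall j, 0 <= l j) -> 0 <= K ->
  (forall j, (rint mu setT (u j) <= K%:E)%E) ->
  (rint mu setT (fun x => \sum_(0 <= j < N) l j * u j x)%R <=
   (K * \sum_(0 <= j < N) l j)%:E)%E.
Proof.
move=> mfu u0 l0 K0 H.
have ms k : measurable_fun setT (fun x => \sum_(0 <= j < k) l j * u j x).
  apply: measurable_sum => j; apply: measurable_funM => //; exact: measurable_cst.
elim: N => [|N IH].
  rewrite (_ : (fun x => _) = (fun=> 0)); last by apply/funext => x; rewrite big_nil.
  by rewrite rint_cst // mul0e big_nil mulr0.
rewrite (_ : (fun x => _) = (fun x => \sum_(0 <= j < N) l j * u j x + l N * u N x)); last first.
  by apply/funext => x; rewrite big_nat_recr.
rewrite rintD //.
- rewrite big_nat_recr //= mulrDr EFinD; apply: leeD => //.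
  by rewrite rintZ // mulrC EFinM; apply: lee_wpmul2l; rewrite ?lee_fin.
- by apply: measurable_funM => //; exact: measurable_cst.
- by move=> x; apply: sumr_ge0 => j _; rewrite mulr_ge0.
- by move=> x; rewrite mulr_ge0.
Qed.

(** By Fatou's lemma for the functions 2 |b f| - |(b_k - b) f|, where b_k is the
    truncation of b; they are nonnegative and tend to 2 |b f|. *)
Lemma clamp_approx (b f : X -> R[i]) (K0 : nat) (e : R) : cmeasurable b ->
  cmeasurable f -> (rint mu setT (fun y => cabs (b y * f y))%R < +oo)%E -> 0 < e ->
  exists2 k : nat, (K0 <= k)%N &
    (rint mu setT (fun y => cabs ((clampC k%:R (b y) - b y) * f y))%R <= e%:E)%E.
Proof.
move=> mb mf fin e0; apply: contrapT => H.
pose w k y := cabs ((clampC k%:R (b y) - b y) * f y).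
have mbf : measurable_fun setT (fun y => cabs (b y * f y)).
  by apply: cmeasurable_cabs; exact: cmeasurableM.
have mw k : measurable_fun setT (w k).
  apply: cmeasurable_cabs; apply: cmeasurableM => //.
  by apply: cmeasurableB => //; exact: cmeasurable_clamp.
pose v y := 2 * cabs (b y * f y).
have mv : measurable_fun setT v by apply: measurable_funM => //; exact: measurable_cst.
have wv k y : w k y <= v y.
  rewrite /w /v !cabsM mulrA ler_wpM2r // mulr_natl mulr2n.
  apply: (le_trans (cabsB _ _)); rewrite lerD2r.
  have := clampC_lip k%:R (b y) 0; rewrite (@clampC_id _ k%:R 0) ?cabs0 //.
  by rewrite !subr0.
pose I := fine (rint mu setT v).
have vfin : (rint mu setT v < +oo)%E.
  by rewrite rintZ // lte_mul_pinfty // lee_fin.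
have IE : rint mu setT v = I%:E.
  by rewrite fineK // ge0_fin_numE // rint_ge0 // => y; rewrite mulr_ge0.
have : (rint mu setT v <= (I - e)%:E)%E.
  apply: (@fatou_rint _ _ _ mu setT (fun k y => v y - w (K0 + k)%N y)) => //.
  - by move=> k; apply: measurable_funB.
  - by move=> k y; rewrite subr_ge0.
  - by move=> y; rewrite mulr_ge0.
  - apply: aeW => y; apply: cvg_near_cst.
    exists (Num.truncn (cabs (b y))).+1 => // k; rewrite /mkset => yk.
    rewrite /w clampC_id ?subrr ?mul0r ?cabs0 ?subr0 //; apply: ltW.
    apply: (@lt_le_trans _ _ (Num.truncn (cabs (b y))).+1%:R).
      by case/andP: (truncn_itv (cabs_ge0 (b y))).
    by rewrite ler_nat (leq_trans yk) // leq_addl.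
  - move=> k.
    have E : (rint mu setT (fun y => v y - w (K0 + k)%N y)%R + rint mu setT (w (K0 + k)%N) = I%:E)%E.
      transitivity (rint mu setT (fun y => v y - w (K0 + k)%N y + w (K0 + k)%N y)%R).
        rewrite [RHS]rintD //; first exact: measurable_funB.
          by move=> y; rewrite subr_ge0.
        by move=> y; exact: cabs_ge0.
      by rewrite -IE; congr (rint _ _ _); apply/funext => y; rewrite subrK.
    have we : (e%:E < rint mu setT (w (K0 + k)%N))%E.
      by rewrite ltNge; apply/negP => h; apply: H; exists (K0 + k)%N => //; exact: leq_addr.
    have p0 : (0 <= rint mu setT (fun y => (v y - w (K0 + k)%N y)%R)%R)%E.
      by apply: rint_ge0 => y; rewrite subr_ge0.
    have q0 : (0 <= rint mu setT (w (K0 + k)%N))%E by apply: rint_ge0 => y; exact: cabs_ge0.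
    move: E we p0 q0; case: (rint mu setT (fun y => _)%R) => [P| |] //;
      case: (rint mu setT (w _)) => [Q| |] //.
    rewrite -EFinD => -[<-]; rewrite lte_fin !lee_fin => eQ _ _.
    by rewrite lerBrDr lerD2l ltW.
by rewrite IE lee_fin lerBrDr gerDl leNgt e0.
Qed.

End Multiplication.

Section WeakBound.
Context {d : measure_display} {R : realType} {X : borelMetricType d R}.
Variable mu : {measure set X -> \bar R}.
Variables (L : @unbounded_op d R X) (m : nat).
Variables (T : (X -> R[i]) -> (X -> R[i])) (b : X -> R[i]).
Local Notation L12 := (cL1_plus_L2 mu).
Hypothesis HT : subadditive_on mu L12 T.
Hypothesis T2 : L2_bounded mu T.
Variable C1 : R.
Hypothesis C10 : 0 < C1.
Hypothesis T1 : forall f, cLp mu 1 f -> (weakL1norm mu (T f) <= C1%:E * cLnorm mu 1 f)%E.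
Hypothesis mb : cmeasurable b.
Variable K : R.
Hypothesis K0 : 0 < K.
Hypothesis atom_osc : forall a, atom mu L 1 m a -> exists be : R[i],
  (rint mu setT (fun y => cabs (b y - be) * cabs (T a y))%R <= K%:E)%E /\
  (rint mu setT (fun y => cabs (b y - be) * cabs (a y))%R <= K%:E)%E.
Local Notation Fc f c := (fun y => (c - b y) * f y).

Let lin12 := @cL12_linear _ _ _ mu.
Let lin2 := @cLp2_linear _ _ _ mu.
Let HT2 : subadditive_on mu (cLp mu 2) T.
Proof. by apply: subadditive_onS HT => f; exact: cLp2_L12. Qed.

Lemma subadditive_sub f g : L12 f -> L12 g ->
  {ae mu, forall x, cabs (T (f \- g) x) <= cabs (T f x) + cabs (T g x)}.
Proof.
move=> Hf Hg; have [_ _ TZ] := HT; have Hmg := linZ lin12 (-1) Hg.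
have := subadditiveD lin12 HT Hf Hmg.
have -> : f \+ (-1 \*o g) = f \- g by apply/funext => y /=; rewrite mulN1r.
move=> h; apply: filterS2 h (TZ (-1) g Hg) => x h1 h2; apply: (le_trans h1).
by rewrite lerD2l (le_trans h2) // cabsN (_ : cabs 1 = 1) ?mul1r // cabs_real normr1.
Qed.

(** With a bounded function bk in place of b, the remainder f - s is multiplied
    by bounded functions only; the error (bk - b) f will be small in L^1, and on
    each atom of s the constant c is compared with be j instead of b. *)
Lemma commutator_splitting (f bk : X -> R[i]) (kk : R) (lam be : nat -> R[i])
    (a : nat -> X -> R[i]) N :
  cLp mu 2 f -> (forall j, cLp mu 2 (a j)) -> cmeasurable bk -> 0 <= kk ->
  (forall y, cabs (bk y) <= kk) -> L12 (fun y => (bk y - b y) * f y) ->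
  let s := fun x => \sum_(0 <= j < N) lam j * a j x in
  let F := fun x => \sum_(0 <= j < N) lam j * ((bk x - be j) * a j x) in
  {ae mu, forall x, forall q : rat * rat,
    cabs (T (Fc f (crat q)) x) <=
      cabs (crat q : R[i]) * cabs (T (f \- s) x) + cabs (T (bk \* (f \- s)) x)
      + cabs (T (fun y => (bk y - b y) * f y) x)
      + \sum_(0 <= j < N) cabs (lam j) * (cabs (crat q - be j) * cabs (T (a j) x))
      + cabs (T F x)}.
Proof.
move=> f2 a2 mbk kk0 bkK A2 s F; apply: ae_forall_countable => q; set c := crat q.
have [mT Td TZ] := HT.
have s2 : cLp mu 2 s by exact: (lin_sum lin2).
have fs2 : cLp mu 2 (f \- s) by exact: (linB lin2).
have bfs2 : cLp mu 2 (bk \* (f \- s)) by exact: cLp2_bounded_mul bkK fs2.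
have ba2 j : cLp mu 2 (fun x => (bk x - be j) * a j x).
  apply: (cLp2_bounded_mul (K := kk + cabs (be j))) => //.
  - by apply: cmeasurableB => //; exact: cmeasurable_cst.
  - by rewrite addr_ge0.
  - by move=> y; apply: (le_trans (cabsB _ _)); rewrite lerD2r.
have F2 : cLp mu 2 F by exact: (lin_sum lin2).
pose G := fun x => \sum_(0 <= j < N) lam j * ((c - be j) * a j x).
have ca2 j : cLp mu 2 (fun x => (c - be j) * a j x) by exact: (linZ lin2 (c - be j) (a2 j)).
have G2 : cLp mu 2 G by exact: (lin_sum lin2).
have c2 : cLp mu 2 (c \*o (f \- s)) by exact: (linZ lin2).
have GF : G \- F = (fun y => (c - bk y) * s y).
  apply/funext => y; rewrite /= /G /F /s -sumrB mulr_sumr; apply: eq_bigr => j _.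
  by rewrite -mulrBr -mulrBl opprB addrA subrK mulrCA.
have E : Fc f c = ((G \- F) \+ ((c \*o (f \- s)) \- (bk \* (f \- s)))) \+
    (fun y => (bk y - b y) * f y).
  apply/funext => y; rewrite GF /= -mulrBl -mulrDr [s y + _]addrC subrK.
  by rewrite -mulrDl addrA subrK.
have L2 h : cLp mu 2 h -> L12 h by exact: cLp2_L12.
have GF12 : L12 (G \- F) by exact/L2/(linB lin2).
have cb12 : L12 ((c \*o (f \- s)) \- (bk \* (f \- s))) by exact/L2/(linB lin2).
have h1 := subadditiveD lin12 HT (linDD lin12 GF12 cb12) A2.
have h2 := subadditiveD lin12 HT GF12 cb12.
have h3 := subadditive_sub (L2 _ G2) (L2 _ F2).
have h4 := subadditive_sub (L2 _ c2) (L2 _ bfs2).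
have h5 := TZ c _ (L2 _ fs2).
have h6 := subadditive_sum lin2 HT2 lam N ca2.
have h7 : {ae mu, forall x, forall j, cabs (T (fun x => (c - be j) * a j x) x) <=
    cabs (c - be j) * cabs (T (a j) x)}.
  by apply: ae_foralln => j; exact: TZ (L2 _ (a2 j)).
rewrite E; apply: filterS2 (filterI h1 (filterI h2 (filterI h3 h4)))
  (filterI h5 (filterI h6 h7)) => x [i1 [i2 [i3 i4]]] [i5 [i6 i7]].
have i8 : cabs (T G x) <=
    \sum_(0 <= j < N) cabs (lam j) * (cabs (c - be j) * cabs (T (a j) x)).
  by apply: (le_trans i6); apply: ler_sum => j _; rewrite ler_wpM2l.
move: i1 i2 i3 i4 i5 i8.
set S1 := \sum_(_ <= _ < _) _; move=> i1 i2 i3 i4 i5 i8; lra.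
Qed.

Lemma weak_dist f (t A : R) : cLp mu 1 f -> 0 < t -> 0 <= A ->
  (rint mu setT (fun x => cabs (f x))%R <= A%:E)%E ->
  (mu [set x | (t < cabs (T f x))%R] <= (C1 * A / t)%:E)%E.
Proof.
move=> f1 t0 A0 fA; apply: weakL1norm_dist => //; apply: (le_trans (T1 f1)).
by rewrite cLnorm1 EFinM; apply: lee_wpmul2l; rewrite // lee_fin ltW.
Qed.

Section Fixed.
Variables (f g : X -> R[i]) (lam : nat -> R[i]) (a : nat -> X -> R[i]) (Lam : R).
Hypothesis f2 : cLp mu 2 f.
Hypothesis bf1 : (rint mu setT (fun y => cabs (b y * f y))%R < +oo)%E.
Hypothesis Hrep : atomic_rep mu L 1 m f lam a.
Hypothesis HLam : (hsum 1 lam <= Lam%:E)%E.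
Hypothesis Hg : is_commutator mu b T f g.

Let Lam0 : 0 <= Lam.
Proof. by rewrite -lee_fin; apply: le_trans HLam; exact: hsum_ge0. Qed.

Let lam_sum N : \sum_(0 <= j < N) cabs (lam j) <= Lam.
Proof.
rewrite -lee_fin; apply: le_trans HLam; apply: le_trans (hsum_partial 1 lam N).
by rewrite lee_fin; apply: ler_sum => j _; rewrite powRr1.
Qed.

(** Where |b| <= k0, b may be replaced by a truncation.  Each part in the
    splitting of the commutator has a small distribution function: the
    remainder in L^2 and the truncation error in L^1 because they are small,
    the two sums over the atoms by the mean oscillation bounds, which survive
    truncation. *)
Lemma commutator_dist_local (t e : R) (k0 : nat) : 0 < t -> 0 < e ->
  (mu ([set x | (t < cabs (g x))%R] `&` [set x | (cabs (b x) <= k0%:R)%R]) <=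
   (5 * K * (1 + C1) * Lam / t + e)%:E)%E.
Proof.
move=> t0 e0; have [mT Td TZ] := HT; have [mT2 _ _] := HT2.
have t5 : 0 < t / 5 by rewrite divr_gt0.
have e3 : 0 < e / 3 by rewrite divr_gt0.
have k1 : 0 < k0%:R + 1 :> R by rewrite ltr_wpDl.
have [mf _] := f2.
have a2 := rep_meas Hrep; have [Ha _ _] := Hrep.
have /choice[be Hbe] j := atom_osc (Ha j).
(* the part removed by truncation is small in L^1 *)
have [d1 d10 D1] := weak_type11_small (ex_intro2 _ _ C1 C10 T1) t5 e3.
have [k kk0 Hk] := clamp_approx k0 mb mf bf1 d10.
pose bk y := clampC k%:R (b y).
have mbk : cmeasurable bk by exact: cmeasurable_clamp.
have bkK y : cabs (bk y) <= 2 * k%:R by exact: clampC_bound.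
have k2 : 0 <= 2 * k%:R :> R by rewrite mulr_ge0.
have A21 : cLp mu 1 (fun y => (bk y - b y) * f y).
  apply/cLp1P; split; last by apply: (le_lt_trans Hk); rewrite ltry.
  by apply: cmeasurableM => //; exact: cmeasurableB.
(* the tail of the decomposition is small in L^2 *)
have [d2 d20 D2] := L2_bounded_small T2 HT2 (divr_gt0 t5 k1) e3.
have [d3 d30 D3] := L2_bounded_small T2 HT2 t5 e3.
have q0 : 0 < Num.min d2 (d3 / (2 * k%:R + 1)).
  by rewrite lt_min d20 divr_gt0 // ltr_wpDl.
have [N HN] := rep_cvg Hrep q0; have {}HN := HN N (leqnn N).
pose s x := \sum_(0 <= j < N) lam j * a j x.
have s2 : cLp mu 2 s by exact: (lin_sum lin2).
have fs2 : cLp mu 2 (f \- s) by exact: (linB lin2).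
have bfs2 : cLp mu 2 (bk \* (f \- s)) by exact: cLp2_bounded_mul bkK fs2.
pose bj j := clampC k%:R (be j).
pose F x := \sum_(0 <= j < N) lam j * ((bk x - bj j) * a j x).
pose W x := \sum_(0 <= j < N) cabs (lam j) * (cabs (b x - be j) * cabs (T (a j) x)).
have m1 j : measurable_fun setT (fun x => cabs (b x - be j)) by exact: mdev.
have ma j : cmeasurable (a j) by case: (a2 j).
have mTa j : cmeasurable (T (a j)) by exact: mT2.
have mba j : cmeasurable (fun x => (bk x - bj j) * a j x).
  by apply: cmeasurableM => //; apply: cmeasurableB => //; exact: cmeasurable_cst.
have mF : cmeasurable F by apply: cmeasurable_sum => j; exact: cmeasurableZ.
have mWj j : measurable_fun setT (fun x => cabs (b x - be j) * cabs (T (a j) x)).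
  by apply: measurable_funM => //; exact: cmeasurable_cabs.
have mW : measurable_fun setT W.
  by apply: measurable_sum => j; apply: measurable_funM => //; exact: measurable_cst.
have W0 x : 0 <= W x by apply: sumr_ge0 => j _; rewrite !mulr_ge0.
have KL0 : 0 <= K * Lam by rewrite mulr_ge0 // ltW.
have KN : K * (\sum_(0 <= j < N) cabs (lam j)) <= K * Lam by rewrite ler_pM2l.
have Wint : (rint mu setT W <= (K * Lam)%:E)%E.
  apply: (@le_trans _ _ (K * \sum_(0 <= j < N) cabs (lam j))%:E); last by rewrite lee_fin.
  apply: rint_sum_le => // [j x||j]; [by rewrite mulr_ge0|exact: ltW|by case: (Hbe j)].
have Fint : (rint mu setT (fun x => cabs (F x))%R <= (K * Lam)%:E)%E.
  apply: (@le_trans _ _ (K * \sum_(0 <= j < N) cabs (lam j))%:E); last by rewrite lee_fin.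
  have mu_ j : measurable_fun setT (fun x => cabs ((bk x - bj j) * a j x)).
    exact: cmeasurable_cabs.
  apply: (@le_trans _ _ (rint mu setT
      (fun x => \sum_(0 <= j < N) cabs (lam j) * cabs ((bk x - bj j) * a j x))%R)).
    apply: le_rint => //; first exact: cmeasurable_cabs.
      by apply: measurable_sum => j; apply: measurable_funM => //; exact: measurable_cst.
    move=> x _; apply: (le_trans (cabs_sum _ _ _)).
    by apply: ler_sum => j _; rewrite cabsM.
  apply: (rint_sum_le (u := fun j x => cabs ((bk x - bj j) * a j x))) => // [|j].
    exact: ltW.
  have [_ ] := Hbe j; apply: le_trans; apply: le_rint => //.
    by apply: measurable_funM => //; exact: cmeasurable_cabs.
  by move=> x _; rewrite cabsM ler_wpM2r // clampC_lip.
have F1 : cLp mu 1 F by apply/cLp1P; split=> //; apply: (le_lt_trans Fint); rewrite ltry.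
have split := commutator_splitting lam bj N f2 a2 mbk k2 bkK (cLp1_L12 A21).
rewrite -/s -/F in split.
pose E1 := [set x | t / 5 / (k0%:R + 1) < cabs (T (f \- s) x)].
pose E2 := [set x | t / 5 < cabs (T (bk \* (f \- s)) x)].
pose E3 := [set x | t / 5 < cabs (T (fun y => (bk y - b y) * f y) x)].
pose E4 := [set x | t / 5 < W x].
pose E5 := [set x | t / 5 < cabs (T F x)].
have mE1 : measurable E1 by apply: measurable_gt; apply: cmeasurable_cabs; exact: mT2.
have mE2 : measurable E2 by apply: measurable_gt; apply: cmeasurable_cabs; exact: mT2.
have mE3 : measurable E3.
  by apply: measurable_gt; apply: cmeasurable_cabs; apply: mT; exact: cLp1_L12.
have mE4 : measurable E4 by exact: measurable_gt.
have mE5 : measurable E5.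
  by apply: measurable_gt; apply: cmeasurable_cabs; apply: mT; exact: cLp1_L12.
have b1 : (mu E1 <= (e / 3)%:E)%E.
  by apply: D2 => //; apply: (le_trans HN); rewrite lee_fin ge_min lexx.
have b2 : (mu E2 <= (e / 3)%:E)%E.
  apply: D3 => //; apply: (@le_trans _ _ (2 * k%:R * (d3 / (2 * k%:R + 1)))%:E).
    apply: cLnorm2_bounded_mul => //; first by rewrite divr_ge0 ?addr_ge0 // ltW.
      by case: fs2.
    by apply: (le_trans HN); rewrite lee_fin ge_min lexx orbT.
  rewrite lee_fin mulrA ler_pdivrMr ?ltr_wpDl // mulrC ler_pM2l //.
  by rewrite lerDl.
have b3 : (mu E3 <= (e / 3)%:E)%E by exact: D1.
have b4 : (mu E4 <= (K * Lam / (t / 5))%:E)%E by exact: chebyshev_le.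
have b5 : (mu E5 <= (C1 * (K * Lam) / (t / 5))%:E)%E by exact: weak_dist.
pose EE := E1 `|` (E2 `|` (E3 `|` (E4 `|` E5))).
have mE45 := measurableU _ _ mE4 mE5.
have mE345 := measurableU _ _ mE3 mE45.
have mE2345 := measurableU _ _ mE2 mE345.
have mEE : measurable EE := measurableU _ _ mE1 mE2345.
have muEE : (mu EE <= (5 * K * (1 + C1) * Lam / t + e)%:E)%E.
  rewrite (_ : (5 * K * (1 + C1) * Lam / t + e) = e / 3 + (e / 3 + (e / 3 +
    (K * Lam / (t / 5) + C1 * (K * Lam) / (t / 5))))); last by field; rewrite gt_eqF.
  rewrite !EFinD.
  apply: (le_trans (measureU2 mu mE1 mE2345)); apply: leeD => //.
  apply: (le_trans (measureU2 mu mE2 mE345)); apply: leeD => //.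
  apply: (le_trans (measureU2 mu mE3 mE45)); apply: leeD => //.
  by apply: (le_trans (measureU2 mu mE4 mE5)); apply: leeD.
have [mg lg] := Hg.
have [Z [mZ Z0 ZP]] : {ae mu, forall x, cabs (b x) <= k0%:R -> t < cabs (g x) -> EE x}.
  apply: filterS2 lg split => x lgx sx bx tg; apply: contrapT.
  move=> /not_orP[n1 /not_orP[n2 /not_orP[n3 /not_orP[n4 n5]]]].
  move: n1 n2 n3 n4 n5 => /negP; rewrite -leNgt => n1 /negP; rewrite -leNgt => n2.
  move=> /negP; rewrite -leNgt => n3 /negP; rewrite -leNgt => n4 /negP; rewrite -leNgt => n5.
  have bkx : bk x = b x by rewrite /bk clampC_id // (le_trans bx) // ler_nat.
  pose Zx := cabs (T (f \- s) x) + \sum_(0 <= j < N) cabs (lam j) * cabs (T (a j) x).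
  have Zx0 : 0 <= Zx by rewrite addr_ge0 //; apply: sumr_ge0 => j _; rewrite mulr_ge0.
  suff : cabs (g x) <= t by rewrite leNgt tg.
  apply: (commutator_le (f := f) lgx Zx0) => q; apply: (le_trans (sx q)).
  have cq : cabs (crat q : R[i]) <= cabs (crat q - b x) + k0%:R.
    by have := cabsD (crat q - b x) (b x); rewrite subrK; move: bx; lra.
  have c1 : cabs (crat q : R[i]) * cabs (T (f \- s) x) <=
      cabs (crat q - b x) * cabs (T (f \- s) x) + t / 5.
    apply: (@le_trans _ _ ((cabs (crat q - b x) + k0%:R) * cabs (T (f \- s) x))).
      by rewrite ler_wpM2r.
    rewrite mulrDl lerD2l; apply: (@le_trans _ _ ((k0%:R + 1) * cabs (T (f \- s) x))).
      by rewrite ler_wpM2r // lerDl.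
    by rewrite mulrC -ler_pdivlMr.
  have c2 : \sum_(0 <= j < N) cabs (lam j) * (cabs (crat q - bj j) * cabs (T (a j) x)) <=
      cabs (crat q - b x) * (\sum_(0 <= j < N) cabs (lam j) * cabs (T (a j) x)) + W x.
    rewrite mulr_sumr -big_split [leRHS]/=; apply: ler_sum => j _.
    rewrite [X in _ <= X + _]mulrCA -mulrDr ler_wpM2l // -mulrDl ler_wpM2r //.
    apply: (le_trans (cabs_triangle (b x) _ _)); rewrite lerD2l -{1}bkx.
    exact: clampC_lip.
  rewrite /Zx mulrDr; move: c1 c2 n1 n2 n3 n4 n5.
  set S1 := \sum_(_ <= _ < _) _; set S2 := \sum_(_ <= _ < _) _ => c1 c2 n1 n2 n3 n4 n5.
  lra.
apply: le_trans muEE; rewrite -(measureU0 mEE mZ Z0); apply: le_measure; rewrite ?inE.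
- apply: measurableI; first by apply: measurable_gt; exact: cmeasurable_cabs.
  rewrite (_ : [set x | _] = ~` [set x | k0%:R < cabs (b x)]).
    by apply: measurableC; apply: measurable_gt; exact: cmeasurable_cabs.
  by apply/seteqP; split=> x /=; rewrite leNgt => /negP.
- exact: measurableU.
- move=> x [tg bx]; have [?|nE] := pselect (EE x); [by left|right].
  by apply: ZP => /= h; apply: nE; exact: h.
Qed.

(** The sets where |b| <= k exhaust the space. *)
Lemma commutator_weak : (weakL1norm mu g <= (5 * K * (1 + C1) * Lam)%:E)%E.
Proof.
apply: le_weakL1norm => t t0; have [mg _] := Hg.
pose A k := [set x | t < cabs (g x)] `&` [set x | cabs (b x) <= k%:R].
have mA k : measurable (A k).
  apply: measurableI; first by apply: measurable_gt; exact: cmeasurable_cabs.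
  rewrite (_ : [set x | _] = ~` [set x | k%:R < cabs (b x)]).
    by apply: measurableC; apply: measurable_gt; exact: cmeasurable_cabs.
  by apply/seteqP; split=> x /=; rewrite leNgt => /negP.
have AE : [set x | t < cabs (g x)] = \bigcup_k A k.
  apply/seteqP; split=> [x tg|x [k _ []] //].
  exists (Num.truncn (cabs (b x))).+1 => //; split=> //=; apply: ltW.
  by case/andP: (truncn_itv (cabs_ge0 (b x))).
have ndA : nondecreasing_seq A.
  move=> i j ij; apply/subsetPset => x [tg bx]; split=> //=.
  by apply: (le_trans bx); rewrite ler_nat.
have H : (mu [set x | (t < cabs (g x))%R] <= (5 * K * (1 + C1) * Lam / t)%:E)%E.
  rewrite AE -[leLHS]mul1e -rint_cst; last exact: bigcupT_measurable.
  apply: rint_bigcup_le => // k; rewrite rint_cst // mul1e.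
  by apply/lee_addgt0Pr => e e0; rewrite -EFinD; exact: commutator_dist_local.
apply: (@le_trans _ _ (t%:E * (5 * K * (1 + C1) * Lam / t)%:E)%E).
  by apply: lee_wpmul2l; rewrite // lee_fin ltW.
by rewrite -EFinM lee_fin mulrCA divff ?mulr1 // gt_eqF.
Qed.

End Fixed.
End WeakBound.

(** * Functions with bounded support *)

Section BoundedSupport.
Context {d : measure_display} {R : realType} {X : borelMetricType d R}.
Variable mu : {measure set X -> \bar R}.
Implicit Types f g : X -> R[i].

Lemma two_balls (x y : X) (r s : R) :
  exists t : R, ball x r `|` ball y s `<=` ball x t.
Proof.
exists (Num.max r (mdist x y + s)) => z [xz|yz].
  by apply: ball_le xz; rewrite le_max lexx.
by apply: ball_sub yz; rewrite le_max lexx orbT.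
Qed.

Lemma bounded_support_linear :
  linear_closed_set [set f | cmeasurable f /\ bounded_support mu f].
Proof.
move=> a f g [mf [x [r fx]]] [mg [y [s gy]]]; have maf := cmeasurableZ a mf.
split; first exact: cmeasurableD.
have [t xt] := two_balls x y r s; exists x, t.
apply: subset_trans xt; apply: (subset_trans (esuppD maf mg)).
by apply: setUSS => //; apply: subset_trans fx; exact: esuppZ.
Qed.

Variable Cd : R.
Hypothesis Cd0 : 0 < Cd.
Hypothesis dbl : forall (x : X) (r : R), 0 < r ->
  (mu (ball x (2 * r)) <= Cd%:E * mu (ball x r))%E /\ (mu (ball x r) < +oo)%E.

Lemma atom_bounded_support (L : @unbounded_op d R X) q m a :
  densely_defined_linear mu L -> atom mu L q m a -> bounded_support mu a.
Proof.
move=> HL Ha; have [ma _] := atom_cLp2 Ha.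
have [vpos|mu0] := vol_gt0_or_null Cd0 dbl; last first.
  exists point, 1 => y /(_ 1 ltr01).
  have mS : measurable (ball y 1 `&` [set y | a y != 0]).
    by apply: measurableI; [exact: measurable_mball|exact: measurable_neq0].
  by rewrite ltNge -mu0 le_measure // inE.
case: Ha => [[x [r [r0 Hb]]]|[muT _ _]].
  by exists x, r; exact: (ball_atom_esupp HL Hb).
by have [x [r [_ rX]]] := finite_bounded Cd0 dbl vpos muT; exists x, r => y _.
Qed.

End BoundedSupport.

(** * Boundedness of the commutator *)

Section CommutatorBound.
Context {d : measure_display} {R : realType} {X : borelMetricType d R}.
Variable mu : {measure set X -> \bar R}.
Variable L : @unbounded_op d R X.
Hypothesis HL : densely_defined_linear mu L.
Variables (m : nat) (T : (X -> R[i]) -> (X -> R[i])).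
Hypothesis HT : subadditive_on mu (cL1_plus_L2 mu) T.
Hypothesis T2 : L2_bounded mu T.
Hypothesis T1 : weak_type11 mu T.
Variables Cd c n : R.
Hypothesis Cd0 : 0 < Cd.
Hypothesis dbl : forall (x : X) (r : R), 0 < r ->
  (mu (ball x (2 * r)) <= Cd%:E * mu (ball x r))%E /\ (mu (ball x r) < +oo)%E.
Hypothesis c0 : 0 < c.
Hypothesis n0 : 0 < n.
Hypothesis growth : forall (x : X) (r l : R), 0 < r -> 1 <= l ->
  (mu (ball x (l * r)) <= (c * l `^ n)%:E * mu (ball x r))%E.
Variables p B : R.
Hypothesis p01 : 0 < p <= 1.
Hypothesis m_large : n * (2 - p) / (4 * p) < m%:R.
Hypothesis B0 : 0 < B.
Hypothesis HB : annular_decay mu L m T p B.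
Variable b : X -> R[i].
Hypothesis bBMO : BMO mu b.
Local Notation V := (vol mu).

Let mb : cmeasurable b. Proof. by case: bBMO. Qed.

Let HT2 : subadditive_on mu (cLp mu 2) T.
Proof. by apply: subadditive_onS HT => f; exact: cLp2_L12. Qed.

Lemma BMO_osc2 : (forall (x : X) (r : R), 0 < r -> 0 < V x r) ->
  exists M M2 : R, [/\ 0 < M, 0 < M2,
    forall x r, 0 < r ->
      (rint mu (ball x r) (fun y => cabs (b y - average mu b x r))%R <= (M * V x r)%:E)%E &
    forall x r, 0 < r ->
      (rint mu (ball x r) (fun y => cabs (b y - average mu b x r) ^+ 2)%R <=
         (M2 ^+ 2 * V x r)%:E)%E].
Proof.
move=> vpos; have [_ _ [M HM]] := bBMO.
have M0 : 0 < Num.max M 1 by rewrite lt_max ltr01 orbT.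
have osc1 x r : 0 < r ->
    (rint mu (ball x r) (fun y => cabs (b y - average mu b x r))%R <=
     (Num.max M 1 * V x r)%:E)%E.
  move=> r0; apply: (le_trans (HM x r r0)); rewrite lee_fin ler_wpM2r ?vol_ge0 //.
  by rewrite le_max lexx.
have [M2 M20 osc2] := john_nirenberg2 Cd0 dbl vpos mb M0 osc1.
by exists (Num.max M 1), M2.
Qed.

(** Against T a, the oscillation of b over the annuli of the ball of a is
    controlled by the decay of T a; against a itself, by the Cauchy-Schwarz
    inequality on the ball. *)
Lemma atom_oscillation : exists2 K : R, 0 < K & forall a, atom mu L 1 m a ->
  exists be : R[i],
  (rint mu setT (fun y => cabs (b y - be) * cabs (T a y))%R <= K%:E)%E /\
  (rint mu setT (fun y => cabs (b y - be) * cabs (a y))%R <= K%:E)%E.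
Proof.
have [mT _ _] := HT2.
have mprod f be : cmeasurable f -> measurable_fun setT (fun y => cabs (b y - be) * cabs (f y)).
  by move=> mf; apply: measurable_funM; [exact: mdev|exact: cmeasurable_cabs].
have [vpos|mu0] := vol_gt0_or_null Cd0 dbl; last first.
  exists 1 => // a /atom_cLp2 a2; have [ma _] := a2; have mTa := mT _ a2; exists 0.
  by split; rewrite rint_null ?lee_fin ?ler01 //; try exact: mprod; move=> y; rewrite mulr_ge0.
have [M [M2 [M0 M20 osc1 osc2]]] := BMO_osc2 vpos.
have [C C0 HC] := L2_bounded_rint T2.
pose B' := Num.max B C.
have B'0 : 0 < B' by rewrite lt_max B0.
have HB' : annular_decay mu L m T 1 B'.
  apply: (annular_decay_rescale HL HT2 vpos (ltW B'0)).
  by apply: annular_decayW HB; rewrite ?(ltW B0) // le_max lexx.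
have HC' f (A : R) : cLp mu 2 f -> 0 <= A ->
    (rint mu setT (fun x => cabs (f x) ^+ 2)%R <= (A ^+ 2)%:E)%E ->
    (rint mu setT (fun x => cabs (T f x) ^+ 2)%R <= ((B' * A) ^+ 2)%:E)%E.
  move=> f2 A0 fA; apply: (le_trans (HC f A f2 A0 fA)); rewrite lee_fin.
  rewrite ler_sqr ?nnegrE ?mulr_ge0 ?(ltW C0) ?(ltW B'0) //.
  by rewrite ler_wpM2r // le_max lexx orbT.
have tau0 : 0 < 2 ^- (2 * m) :> R by rewrite invr_gt0 exprn_gt0.
have [K K0 HK] := decay_osc c0 growth Cd0 dbl vpos mb M0 M20 osc1 osc2 B'0 tau0
  (decay_rate1 n0 p01 m_large).
exists (Num.max K M2) => [|a Ha]; first by rewrite lt_max K0.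
have a2 := atom_cLp2 Ha; have [ma _] := a2.
have [x [r [r0 [a1 a0 Ta1 Ta]]]] := atom_decay HL Cd0 dbl vpos ltr01 B'0 HB' HC' Ha.
exists (average mu b x r); split.
  apply: (@le_trans _ _ K%:E); last by rewrite lee_fin le_max lexx.
  by apply: HK => //; exact: mT.
have v0 := vpos x r r0; have sv0 : 0 < Num.sqrt (V x r) by rewrite sqrtr_gt0.
have w0 : 0 < V x r `^ (2^-1 - 1^-1) by rewrite powR_gt0.
have mB : measurable (ball x r) by exact: measurable_mball.
apply: (@le_trans _ _ M2%:E); last by rewrite lee_fin le_max lexx orbT.
apply: (le_trans (rint_off mB (mprod _ _ ma) _ _)) => [y||]; first by rewrite mulr_ge0.
  by apply: filterS a0 => y h /h ->; rewrite cabs0 mulr0.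
apply: (le_trans (rint_CauchySchwarz (A := M2 * Num.sqrt (V x r))
  (B := V x r `^ (2^-1 - 1^-1)) mB (mdev _ mb) (cmeasurable_cabs ma) _ _ _ w0 _ _)) => //.
- by rewrite mulr_gt0.
- by rewrite exprMn sqr_sqrtr ?(ltW v0) //; exact: osc2.
- apply: le_trans a1; apply: rint_subset => //; first exact: measurable_cabs2.
  by move=> y; exact: sqr_ge0.
rewrite lee_fin -mulrA -[leRHS]mulr1 ler_pM2l //.
rewrite -powR12_sqrt ?(ltW v0) // -powRD ?(gt_eqF v0) ?implybT //.
by rewrite (_ : 2^-1 + (2^-1 - 1^-1) = 0) ?powRr0 //; field.
Qed.

(** Both b and f are square integrable on a ball containing the support
    of f. *)
Lemma BMO_mul_cLp1 f (z : R[i]) : cLp mu 2 f -> bounded_support mu f ->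
  cLp mu 1 (fun y => (z - b y) * f y).
Proof.
move=> /cLp2P[mf f2] [x [r fx]].
have mzb : cmeasurable (fun y => z - b y).
  by apply: cmeasurableB => //; exact: cmeasurable_cst.
have mp : cmeasurable (fun y => (z - b y) * f y) by exact: cmeasurableM.
apply/cLp1P; split=> //.
have [vpos|mu0] := vol_gt0_or_null Cd0 dbl; last first.
  by rewrite rint_null //; exact: cmeasurable_cabs.
have [M [M2 [_ M20 _ osc2]]] := BMO_osc2 vpos.
pose s := `|r| + 1; have s0 : 0 < s by rewrite ltr_wpDl.
have xs : esupp mu f `<=` ball x s.
  by apply: subset_trans fx _; apply: ball_le; rewrite ler_wpDr // ler_norm.
have f0 := negligible_off_esupp Cd0 dbl vpos mf xs.
have mB : measurable (ball x s) by exact: measurable_mball.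
apply: (le_lt_trans (rint_off mB (cmeasurable_cabs mp) _ _)) => //.
  by apply: filterS f0 => y h /h ->; rewrite mulr0 cabs0.
set be := average mu b x s in osc2 *.
have mu2 : measurable_fun setT (fun y => 2 * cabs (b y - be) ^+ 2).
  apply: measurable_funM; first exact: measurable_cst.
  by apply: measurable_funX; exact: mdev.
have mcf : measurable_fun setT (fun y => cabs (f y) ^+ 2) by exact: measurable_cabs2.
apply: (@le_lt_trans _ _ (rint mu (ball x s) (fun y => (2 * cabs (b y - be) ^+ 2 +
   2 * cabs (z - be) ^+ 2) + cabs (f y) ^+ 2)%R)).
  apply: le_rint => //.
  - exact: cmeasurable_cabs.
  - by apply: measurable_funD => //; apply: measurable_funD => //; exact: measurable_cst.
  - move=> y _; rewrite cabsM.
    have := cabs_triangle be z (b y); rewrite [cabs (be - _)]cabs_distC.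
    have := cabs_ge0 (z - b y); have := cabs_ge0 (f y).
    move: (cabs (z - b y)) (cabs (f y)) (cabs (z - be)) (cabs (b y - be)) => A F U W F0 A0 AUW.
    have h1 : A ^+ 2 <= (U + W) ^+ 2 by rewrite ler_sqr ?nnegrE // (le_trans A0).
    by move: h1 (sqr_ge0 (A - F)) (sqr_ge0 (U - W)) (sqr_ge0 A) (sqr_ge0 F); lra.
rewrite rintD //; first last.
- by move=> y; exact: sqr_ge0.
- by move=> y; rewrite addr_ge0 ?mulr_ge0 ?sqr_ge0.
- by apply: measurable_funD => //; exact: measurable_cst.
apply: lte_add_pinfty; last first.
  apply: le_lt_trans f2; apply: rint_subset => // y; exact: sqr_ge0.
have [_ Bf] := dbl x s0.
rewrite rintD //; first last.
- by move=> y; rewrite ?mulr_ge0 ?sqr_ge0.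
- by move=> y; rewrite ?mulr_ge0 ?sqr_ge0.
apply: lte_add_pinfty; last by rewrite rint_cst // lte_mul_pinfty // lee_fin mulr_ge0 ?sqr_ge0.
rewrite rintZ //; last first.
- by move=> y; exact: sqr_ge0.
- by apply: measurable_funX; exact: mdev.
rewrite lte_mul_pinfty // ?lee_fin //.
by apply: (le_lt_trans (osc2 x s s0)); rewrite ltry.
Qed.

Let D := hardy_at mu L 1 m `&` [set f | bounded_support mu f].

Let D_adm f : D f -> admissible mu b f.
Proof.
move=> [[f2 _] fb]; split; first exact: cLp2_L12.
by move=> z; apply: cLp1_L12; exact: BMO_mul_cLp1.
Qed.

Let D_sub f g : D f -> D g -> D (f \- g).
Proof.
move=> [Hf fb] [Hg gb]; split; first exact: hat_linB.
have [[[mf _] _] [[mg _] _]] := (Hf, Hg).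
by have [] := linB (@bounded_support_linear _ _ _ mu) (conj mf fb) (conj mg gb).
Qed.

Let D_dense f : hardy_at mu L 1 m f -> forall e : R, 0 < e ->
  exists2 g, D g & (hardy_norm mu L 1 m (g \- f)%R < e%:E)%E.
Proof.
move=> [f2 [lam [a Ha]]] e e0.
have [N HN] := hnorm_psum_approx ltr01 Ha e0.
exists (fun x => \sum_(0 <= j < N) lam j * a j x) => //; split.
  split; first exact: psum_cLp2 Ha.
  by exists (fun j => if (j < N)%N then lam j else 0), a; exact: (rep_psum ltr01 N Ha).
have [Hat _ _] := Ha.
have Hj j : cmeasurable (a j) /\ bounded_support mu (a j).
  split; first by case: (atom_cLp2 (Hat j)).
  exact: (atom_bounded_support Cd0 dbl HL (Hat j)).
by have [] := lin_sum (@bounded_support_linear _ _ _ mu) lam N Hj.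
Qed.

(** The functions with bounded support are dense, because atoms have bounded
    support; on them the commutator is defined and satisfies the weak-type
    estimate, which carries over to differences and thus to the completion. *)
Theorem commutator_hardy_to_weakL1 :
  extends_boundedly mu L 1 m D (is_commutator mu b T) (weakL1 mu) (weakL1norm mu).
Proof.
have [K K0 HK] := atom_oscillation; have [C1 C10 HC1] := T1.
pose C := 5 * K * (1 + C1).
have C0 : 0 < C by rewrite /C; apply: mulr_gt0; rewrite ?addr_gt0 // mulr_gt0.
have HN := @weakL1norm_fatou_quasinorm _ _ _ mu.
have bound f h : D f -> is_commutator mu b T f h ->
    (weakL1norm mu h <= C%:E * hardy_norm mu L 1 m f)%E.
  move=> [[f2 _] fb] fh; apply: hnorm_bound => // lam a Hr.
  have [_ hl _] := Hr; have h0 := hsum_ge0 1 lam.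
  rewrite invr1 poweRe1 // -[hsum 1 lam]fineK; last by rewrite ge0_fin_numE.
  apply: (commutator_weak HT T2 C10 HC1 mb K0 HK f2 _ Hr _ fh); last first.
    by rewrite fineK // ge0_fin_numE.
  have /cLp1P[_] := BMO_mul_cLp1 0 f2 fb.
  by under eq_fun do rewrite sub0r mulNr cabsN.
apply: (@extension _ _ _ mu L 1 m ltr01 D _ (weakL1norm mu) HN _ D_dense _ _ C) => //.
- by move=> f [].
- by move=> f /D_adm; exact: commutator_exists.
- by move=> f h _ [].
- move=> f g h k Df Dg fh gk; have [mh _] := fh; have [mk _] := gk.
  have [l fgl hkl] := commutator_diff HT mb (D_adm Df) (D_adm Dg) fh gk.
  have [_ mono _ _ _] := HN; have [ml _] := fgl.
  apply: (@le_trans _ _ (weakL1norm mu l)); last exact: bound (D_sub Df Dg) fgl.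
  by apply: mono => //; exact: cmeasurableB.
Qed.

End CommutatorBound.


Theorem theorem1p2 (d : measure_display) (R : realType)
    (X : borelMetricType d R) (mu : {measure set X -> \bar R})
    (n : R) (L : @unbounded_op d R X) (p : R) (m : nat)
    (T : (X -> R[i]) -> (X -> R[i])) :
  doubling mu -> 0 < n -> doubling_exponent mu n ->
  selfadjoint mu L -> nonneg_op mu L -> davies_gaffney mu L ->
  0 < p <= 1 -> n * (2 - p) / (4 * p) < m%:R ->
  lin_or_sublin_on mu (cLp mu 2) T -> L2_bounded mu T ->
  (exists2 C : R, 0 < C &
     forall (a : X -> R[i]) (x : X) (r : R) (j : nat), 0 < r ->
       ball_atom mu L p m a x r -> (2 <= j)%N ->
       ((\int[mu]_(y in annulus x r j) (cabs (T a y) ^+ 2)%:E) `^ 2^-1 <=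
          (C * 2 ^- (2 * j * m) * vol mu x r `^ (2^-1 - p^-1))%:E)%E) ->
  extends_boundedly mu L p m (hardy_at mu L p m) (fun f h => h = T f)
    (cLp mu p) (cLnorm mu p) /\
  (lin_or_sublin_on mu (cL1_plus_L2 mu) T -> weak_type11 mu T ->
   forall b : X -> R[i], BMO mu b ->
     extends_boundedly mu L 1 m
       (hardy_at mu L 1 m `&` [set f | bounded_support mu f])
       (is_commutator mu b T) (weakL1 mu) (weakL1norm mu)).
Proof.
move=> [Cd Cd0 dbl] n0 [c c0 growth] [HL _] _ _ p01 m_large HT2 T2 [B B0 HB].
have HT2' := lin_or_sublin_subadditive (@cLp2_linear _ _ _ mu) HT2.
have decay : annular_decay mu L m T p B.
  move=> a x r j r0 Ha j2; have := HB a x r j r0 Ha j2.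
  rewrite mulnAC exprM -exprVn => h.
  have A0 : 0 <= B * 2 ^- (2 * m) ^+ j * vol mu x r `^ (2^-1 - p^-1).
    by rewrite mulr_ge0 ?powR_ge0 // mulr_ge0 ?exprn_ge0 ?invr_ge0 ?exprn_ge0 // ltW.
  rewrite -powR2 //; apply/poweRV_le => //.
  by apply: rint_ge0 => y; exact: sqr_ge0.
split.
  have [K K0 HK] := atom_image_Lp HL HT2' T2 Cd0 dbl c0 growth p01 m_large B0 decay.
  exact: (hardy_to_Lp HT2' T2 p01 K0 HK).
move=> HT1 T1 b bBMO.
apply: (commutator_hardy_to_weakL1 HL _ T2 T1 Cd0 dbl c0 n0 growth p01 m_large B0 decay bBMO).
exact: lin_or_sublin_subadditive (@cL12_linear _ _ _ mu) HT1.
Qed.
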